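(* Let $\mu\in(0,1)$, let $V_\mu\subset E_\mu$ be open, and suppose the following two hypotheses hold. (1) $(A,F_1): V_\mu\to \mathcal{M}_\mu(E_1,E_0)\times E_0$ is locally Lipschitz continuous (with $\mathcal{M}_\mu(E_1,E_0)$ carrying the norm of $\mathcal{L}(E_1,E_0)$). (2) There is a number $\beta\in(\mu,1)$ such that $F_2:V_\mu\cap E_\beta\to E_0$, and there are $m\in\mathbb{N}$ and numbers $\beta_j\in[\mu,\beta]$, $\rho_j\ge 0$ with $$\frac{\rho_j(\beta-\mu)+(\beta_j-\mu)}{1-\mu}\le 1\qquad\text{for all } j=1,\dots,m,$$ such that for each $x_0\in V_\mu$ and $R>0$ there is a constant $C_R=C_R(x_0)>0$ for which $$|F_2(x_1)-F_2(x_2)|_{E_0}\le C_R\sum_{j=1}^m\big(1+|x_1|_{E_\beta}^{\rho_j}+|x_2|_{E_\beta}^{\rho_j}\big)|x_1-x_2|_{E_{\beta_j}}$$ holds for all $x_1,x_2\in\bar B_{E_\mu}(x_0,R)\cap(V_\mu\cap E_\beta)$. Consider the problem $$\dot u+A(u)u=F_1(u)+F_2(u)\ \text{ for } t>0,\qquad u(0)=x. \tag{P}$$ Then: (a) (Local solutions) Given any $x_0\in V_\mu$, there exist positive constants $\tau=\tau(x_0)$, $\varepsilon=\varepsilon(x_0)$ and $\sigma=\sigma(x_0)$ such that (P) has a unique solution $$u(\cdot,x)\in\mathbb{E}_{1,\mu}([0,\tau])=BC^1_{1-\mu}([0,\tau],E_0)\cap BC_{1-\mu}([0,\tau],E_1)$$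 for all initial values $x\in\bar B_{E_\mu}(x_0,\varepsilon)$. Moreover, $$\|u(\cdot,x_1)-u(\cdot,x_2)\|_{\mathbb{E}_{1,\mu}([0,\tau])}\le\sigma|x_1-x_2|_{E_\mu},\qquad x_1,x_2\in\bar B_{E_\mu}(x_0,\varepsilon).$$ (b) (Maximal solutions) Each solution with initial value $x_0\in V_\mu$ exists on a maximal interval $J(x_0):=[0,t^+)=[0,t^+(x_0))$ and enjoys the regularity $$u(\cdot,x_0)\in C([0,t^+),E_\mu)\cap C((0,t^+),E_1).$$ (c) (Global solutions) If the solution $u(\cdot,x_0)$ satisfies (i) $u(\cdot,x_0)\in UC(J(x_0),E_\mu)$, and (ii) there exists $\eta>0$ so that $\mathrm{dist}_{E_\mu}(u(t,x_0),\partial V_\mu)>\eta$ for all $t\in J(x_0)$, then $t^+(x_0)=\infty$, so $u(\cdot,x_0)$ is a global solution of (P). Moreover, if the embedding $E_1\hookrightarrow E_0$ is compact, then condition (i) may be replaced by the assumption: (i.a) the orbit $\{u(t,x_0):t\in[\tau,t^+(x_0))\}$ is bounded in $E_\delta$ for some $\delta\in(\mu,1]$ and some $\tau\in(0,t^+(x_0))$.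
   Context: $E_0,E_1$ are Banach spaces with $E_1$ continuously and densely embedded in $E_0$. For $\theta\in(0,1)$, $E_\theta:=(E_0,E_1)^0_{\theta,\infty}$ is the continuous interpolation space (the closure of $E_1$ in the real interpolation space $(E_0,E_1)_{\theta,\infty}$). $\bar B_E(x,R)$ is the closed ball in $E$. $UC(J,E)$ denotes uniformly continuous functions $J\to E$. For a Banach space $E$, $\mu\in(0,1)$, $J=[0,T]$, $\dot J=(0,T]$: $$BC_{1-\mu}(J,E):=\{v\in C(\dot J,E): [t\mapsto t^{1-\mu}v(t)]\in BC(\dot J,E),\ \lim_{t\to0^+}|t^{1-\mu}v(t)|_E=0\},$$ $$BC^1_{1-\mu}(J,E):=\{v\in C^1(\dot J,E): v,\dot v\in BC_{1-\mu}(J,E)\}.$$ Set $\mathbb{E}_{0,\mu}(J):=BC_{1-\mu}(J,E_0)$ with norm $\sup_{t\in\dot J}t^{1-\mu}|v(t)|_{E_0}$, and $\mathbb{E}_{1,\mu}(J):=BC^1_{1-\mu}(J,E_0)\cap BC_{1-\mu}(J,E_1)$ with norm $\sup_{t\in\dot J}t^{1-\mu}(|\dot v(t)|_{E_0}+|v(t)|_{E_1})$. Functions in $\mathbb{E}_{1,\mu}(J)$ extend continuously to $t=0$ with values in $E_0$. $\mathcal{M}_\mu(E_1,E_0)$ is the set of all $B\in\mathcal{L}(E_1,E_0)$ such that, for some (hence all) $T>0$ and $J=[0,T]$: for every $(f,x)\in\mathbb{E}_{0,\mu}(J)\times E_\mu$ there is a unique $u\in\mathbb{E}_{1,\mu}(J)$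 with $\dot u(t)+Bu(t)=f(t)$ for $t\in\dot J$ and $u(0)=x$. A solution of (P) on $[0,T]$ is a function $u\in\mathbb{E}_{1,\mu}([0,T])$ with values in $V_\mu$ satisfying the equation on $(0,T]$ and $u(0)=x$; the maximal solution $u(\cdot,x)$ is defined on the maximal interval $[0,t^+(x))$ to which the solution extends. *)

(* Defs.v *)
From HB Require Import structures.
From mathcomp Require Import all_boot all_order all_algebra.
From mathcomp Require Import all_classical all_reals all_analysis.
From mathcomp Require Import lra.

Set Implicit Arguments.
Unset Strict Implicit.
Unset Printing Implicit Defensive.

Import Order.TTheory GRing.Theory Num.Theory.
Import numFieldNormedType.Exports.

Local Open Scope classical_set_scope.
Local Open Scope ring_scope.

Record dense_embedding (R : realType) (E0 E1 : completeNormedModType R) :=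
  DenseEmbedding {
    embed :> {linear E1 -> E0} ;
    embed_inj : injective embed ;
    embed_continuous : continuous embed ;
    embed_dense : dense (range embed) }.

Definition compact_embedding (R : realType) (E0 E1 : completeNormedModType R)
    (e : dense_embedding E0 E1) :=
  forall B : set E1, bounded_set B -> precompact (e @` B).

Section interpolation.
Context {R : realType} {E0 E1 : completeNormedModType R}.
Variable e : dense_embedding E0 E1.

(* Peetre's K-functional of the couple (E0, E1). *)
Definition Kfun (t : R) (x : E0) : R :=
  inf [set `|p.1| + t * `|p.2| | p in [set p : E0 * E1 | x = p.1 + e p.2]].

(* The norm of the real interpolation space (E0, E1)_{theta, oo}, which
   consists of the x for which it is finite. *)
Definition Knorm (theta : R) (x : E0) : \bar R :=
  ereal_sup [set (t `^ (- theta) * Kfun t x)%:E | t in [set t | 0 < t]].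

(* Closure of E1 in (E0, E1)_{theta, oo}. *)
Definition cinterp_pred (theta : R) : {pred E0} := mem [set x : E0 |
  (Knorm theta x < +oo)%E /\
  forall eps : R, 0 < eps -> exists b : E1, (Knorm theta (x - e b)%R < eps%:E)%E].

Lemma Kfun_has_inf t x : 0 <= t ->
  has_inf [set `|p.1| + t * `|p.2| | p in [set p : E0 * E1 | x = p.1 + e p.2]].
Proof.
move=> t0; split.
  by exists (`|x| + t * `|0 : E1|); exists (x, 0) => //=; rewrite linear0 addr0.
by exists 0 => _ [p _ <-]; rewrite addr_ge0 ?mulr_ge0.
Qed.

Lemma Kfun_le t a b : 0 <= t -> Kfun t (a + e b) <= `|a| + t * `|b|.
Proof.
move=> t0; apply: ge_inf; first by have [] := @Kfun_has_inf t (a + e b) t0.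
by exists (a, b).
Qed.

Lemma Kfun_ge t x c : 0 <= t ->
  (forall a b, x = a + e b -> c <= `|a| + t * `|b|) -> c <= Kfun t x.
Proof.
move=> t0 H; apply: lb_le_inf; first by have [] := Kfun_has_inf x t0.
by move=> _ [[a b] /= xab <-]; exact: H.
Qed.

Lemma Kfun_ge0 t x : 0 <= t -> 0 <= Kfun t x.
Proof. by move=> t0; apply: Kfun_ge => // a b _; rewrite addr_ge0 ?mulr_ge0. Qed.

Lemma Kfun_le_norm t x : 0 <= t -> Kfun t x <= `|x|.
Proof.
by move=> t0; have := @Kfun_le t x 0 t0; rewrite linear0 addr0 normr0 mulr0 addr0.
Qed.

Lemma Kfun_embed_le t b : 0 <= t -> Kfun t (e b) <= t * `|b|.
Proof. by move=> t0; have := @Kfun_le t 0 b t0; rewrite add0r normr0 add0r. Qed.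

Lemma KfunD t x y : 0 <= t -> Kfun t (x + y) <= Kfun t x + Kfun t y.
Proof.
move=> t0; rewrite -lerBlDr; apply: Kfun_ge => // a b xab.
rewrite lerBlDr -lerBlDl; apply: Kfun_ge => // a' b' yab.
rewrite lerBlDl xab yab addrACA -linearD; apply: le_trans (Kfun_le _ _ t0) _.
have := ler_normD a a'; have := ler_wpM2l t0 (ler_normD b b'); lra.
Qed.

Lemma KfunZ_le t k x : 0 <= t -> Kfun t (k *: x) <= `|k| * Kfun t x.
Proof.
move=> t0; have [->|k0] := eqVneq k 0.
  rewrite scale0r normr0 mul0r; apply: le_trans (Kfun_le_norm _ t0) _.
  by rewrite normr0.
rewrite mulrC -ler_pdivrMr ?normr_gt0//; apply: Kfun_ge => // a b xab.
rewrite ler_pdivrMr ?normr_gt0// xab scalerDr -linearZ.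
apply: le_trans (Kfun_le _ _ t0) _; rewrite !normrZ; lra.
Qed.

Lemma Knorm_ub theta t x : 0 < t ->
  ((t `^ (- theta) * Kfun t x)%:E <= Knorm theta x)%E.
Proof. by move=> t0; apply: ereal_sup_ubound; exists t. Qed.

Lemma Knorm_le theta x c :
  (forall t, 0 < t -> ((t `^ (- theta) * Kfun t x)%:E <= c)%E) ->
  (Knorm theta x <= c)%E.
Proof. by move=> H; apply: ge_ereal_sup => _ [t /= t0 <-]; exact: H. Qed.

Lemma Knorm_ge0 theta x : (0 <= Knorm theta x)%E.
Proof.
apply: le_trans (Knorm_ub theta x ltr01).
by rewrite lee_fin mulr_ge0 ?powR_ge0 ?Kfun_ge0.
Qed.

Lemma KnormD theta x y :
  (Knorm theta (x + y)%R <= Knorm theta x + Knorm theta y)%E.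
Proof.
apply: Knorm_le => t t0.
apply: le_trans (leeD (Knorm_ub theta x t0) (Knorm_ub theta y t0)).
by rewrite -EFinD lee_fin -mulrDr ler_wpM2l ?powR_ge0// KfunD// ltW//.
Qed.

Lemma KnormZ_le theta k x :
  (Knorm theta (k *: x)%R <= `|k|%:E * Knorm theta x)%E.
Proof.
apply: Knorm_le => t t0.
have k0 : (0 <= `|k|%:E)%E by rewrite lee_fin.
apply: le_trans (lee_wpmul2l k0 (Knorm_ub theta x t0)).
rewrite -EFinM lee_fin mulrCA ler_wpM2l ?powR_ge0// KfunZ_le// ltW//.
Qed.

Lemma Knorm0 theta : Knorm theta 0 = 0%E.
Proof.
apply/eqP; rewrite eq_le Knorm_ge0 andbT.
by have := KnormZ_le theta 0 0; rewrite scale0r normr0 mul0e.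
Qed.

Lemma KnormZ theta k x : Knorm theta (k *: x) = (`|k|%:E * Knorm theta x)%E.
Proof.
have [->|k0] := eqVneq k 0; first by rewrite scale0r Knorm0 normr0 mul0e.
apply/eqP; rewrite eq_le KnormZ_le/=.
have := KnormZ_le theta k^-1 (k *: x); rewrite scalerA mulVf// scale1r.
rewrite -(@lee_pmul2l _ `|k|%:E) ?lte_fin ?normr_gt0//.
by rewrite muleA -EFinM -normrM divff// normr1 mul1e.
Qed.

Lemma embed_bound : exists2 c : R, 0 < c & forall b, `|e b| <= c * `|b|.
Proof.
have /linear_bounded_continuous/linear_boundedP := @embed_continuous _ _ _ e.
by move=> /pinfty_ex_gt0[c c0 H]; exists c.
Qed.

Lemma norm_le_Knorm :
  exists2 c : R, 0 < c & forall theta x, (`|x|%:E <= c%:E * Knorm theta x)%E.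
Proof.
have [c c0 ec] := embed_bound; exists (1 + c) => [|theta x]; first lra.
have c1 : (0 <= (1 + c)%:E)%E by rewrite lee_fin; lra.
apply: le_trans (lee_wpmul2l c1 (Knorm_ub theta x ltr01)).
rewrite powR1 mul1r -EFinM lee_fin mulrC -ler_pdivrMr; last lra.
apply: Kfun_ge => // a b ->; rewrite ler_pdivrMr; last lra.
apply: le_trans (ler_normD _ _) _.
by have := ec b; have := mulr_ge0 (ltW c0) (normr_ge0 a);
  have := normr_ge0 b; lra.
Qed.

Lemma Knorm_eq0 theta x : Knorm theta x = 0%E -> x = 0.
Proof.
move=> Kx; have [c _ /(_ theta x)] := norm_le_Knorm.
by rewrite Kx mule0 lee_fin normr_le0 => /eqP.
Qed.

Lemma cinterp_submod_closed theta : submod_closed (cinterp_pred theta).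
Proof.
split.
  apply/mem_set; rewrite /= Knorm0; split=> // eps eps0.
  by exists 0; rewrite linear0 subr0 Knorm0 lte_fin.
move=> k x y /set_mem[xoo xcl] /set_mem[yoo ycl]; apply/mem_set; split=> /=.
  apply: le_lt_trans (KnormD _ _ _) _.
  by rewrite lte_add_pinfty// KnormZ lte_mul_pinfty// lee_fin.
move=> eps eps0.
have k1 : 0 < `|k| + 1 by rewrite ltr_wpDl.
have [|b xb] := xcl (eps / 2 / (`|k| + 1)); first by rewrite !divr_gt0.
have [|b' yb] := ycl (eps / 2); first by rewrite divr_gt0.
exists (k *: b + b'); rewrite linearD linearZ opprD addrACA -scalerBr.
apply: le_lt_trans (KnormD _ _ _) _.
have k0 : (0 <= `|k|%:E)%E by rewrite lee_fin.
rewrite [eps]splitr EFinD KnormZ.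
apply: (@le_lt_trans _ _ ((eps / 2)%:E + Knorm theta (y - e b')%R)%E).
  apply: leeD => //; apply: le_trans (lee_wpmul2l k0 (ltW xb)) _.
  rewrite -EFinM lee_fin mulrCA ler_piMr// ?divr_ge0 ?(ltW eps0)//.
  by rewrite ler_pdivrMr// mul1r lerDl.
exact: lee_ltD.
Qed.

HB.instance Definition _ theta :=
  GRing.isSubmodClosed.Build _ _ (cinterp_pred theta)
    (cinterp_submod_closed theta).

Definition cinterp (theta : R) : Type := {x : E0 | x \in cinterp_pred theta}.

HB.instance Definition _ theta := SubChoice.on (cinterp theta).
HB.instance Definition _ theta :=
  [SubChoice_isSubLmodule of cinterp theta by <:].

Definition cinterp_norm theta (x : cinterp theta) : R :=
  fine (Knorm theta (\val x)).

Lemma cinterp_normE theta (x : cinterp theta) :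
  (cinterp_norm x)%:E = Knorm theta (\val x).
Proof.
have [xoo _] := set_mem (valP x).
by rewrite /cinterp_norm fineK// ge0_fin_numE ?Knorm_ge0.
Qed.

Lemma cinterp_normD theta (x y : cinterp theta) :
  cinterp_norm (x + y) <= cinterp_norm x + cinterp_norm y.
Proof. by rewrite -lee_fin EFinD !cinterp_normE raddfD KnormD. Qed.

Lemma cinterp_normZ theta k (x : cinterp theta) :
  cinterp_norm (k *: x) = `|k| * cinterp_norm x.
Proof. by apply/EFin_inj; rewrite EFinM !cinterp_normE linearZ KnormZ. Qed.

Lemma cinterp_norm0_eq0 theta (x : cinterp theta) :
  cinterp_norm x = 0 -> x = 0.
Proof.
move=> nx0; have := cinterp_normE x; rewrite nx0 => /esym/Knorm_eq0 x0.
by apply/val_inj; rewrite x0 raddf0.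
Qed.

HB.instance Definition _ theta := Lmodule_isNormed.Build R (cinterp theta)
  (@cinterp_normD theta) (@cinterp_normZ theta) (@cinterp_norm0_eq0 theta).

(* The point x of E0 viewed in E_theta; the junk value 0 is never met where
   this is used, see embed_cinterp and cinterp_sub. *)
Definition to_cinterp (theta : R) (x : E0) : cinterp theta := insubd 0 x.

Lemma to_cinterpK theta x :
  x \in cinterp_pred theta -> \val (to_cinterp theta x) = x.
Proof. by move=> xP; rewrite insubdK. Qed.

Lemma Knorm_embed_lty theta b :
  0 <= theta <= 1 -> (Knorm theta (e b) < +oo)%E.
Proof.
move=> /andP[th0 th1].
apply: (@le_lt_trans _ _ (`|b| + `|e b|)%:E); last exact: ltry.
apply: Knorm_le => t t0; rewrite lee_fin.
have [t1|/ltW t1] := leP t 1.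
  apply: (@le_trans _ _ (t `^ (- theta) * (t * `|b|))).
    by rewrite ler_wpM2l ?powR_ge0// Kfun_embed_le// ltW//.
  have -> : t `^ (- theta) * (t * `|b|) = t `^ (1 - theta) * `|b|.
    rewrite mulrA; congr (_ * _); rewrite -[X in _ * X](powRr1 (ltW t0)).
    by rewrite -powRD ?(gt_eqF t0) ?implybT// addrC.
  apply: (@le_trans _ _ `|b|); last by rewrite lerDl.
  rewrite ler_piMl// -[leRHS](powRr0 t) ger_powR ?t0//.
  by rewrite subr_ge0.
apply: (@le_trans _ _ (t `^ (- theta) * `|e b|)).
  by rewrite ler_wpM2l ?powR_ge0// Kfun_le_norm// ltW//.
apply: (@le_trans _ _ `|e b|); last by rewrite lerDr.
by rewrite ler_piMl// -[leRHS](powRr0 t) ler_powR// oppr_le0.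
Qed.

Lemma embed_cinterp theta b : 0 <= theta <= 1 -> e b \in cinterp_pred theta.
Proof.
move=> th; apply/mem_set; split=> /=; first exact: Knorm_embed_lty.
by move=> eps eps0; exists b; rewrite subrr Knorm0 lte_fin.
Qed.

Lemma Knorm_mono theta theta' : 0 <= theta <= theta' ->
  exists2 c : R, 0 < c &
    forall x, (Knorm theta x <= c%:E * Knorm theta' x)%E.
Proof.
move=> /andP[th0 thth']; have [c c0 Hc] := norm_le_Knorm.
exists (1 + c) => [|x]; first lra.
have c0' : (0 <= c%:E)%E by rewrite lee_fin ltW.
apply: Knorm_le => t t0; rewrite EFinD ge0_muleDl//.
have [t1|/ltW t1] := leP t 1.
  apply: (@le_trans _ _ (Knorm theta' x)).
    apply: le_trans (Knorm_ub theta' x t0); rewrite lee_fin ler_wpM2r//.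
      by rewrite Kfun_ge0// ltW//.
    by rewrite ger_powR ?t0// lerN2.
  by rewrite mul1e leeDl// mule_ge0 ?Knorm_ge0.
apply: (@le_trans _ _ `|x|%:E); last first.
  by apply: le_trans (Hc theta' x) _; rewrite mul1e leeDr// Knorm_ge0.
rewrite lee_fin; apply: le_trans (Kfun_le_norm x (ltW t0)).
rewrite ler_piMl ?Kfun_ge0 ?(ltW t0)//.
by rewrite -[leRHS](powRr0 t) ler_powR// oppr_le0.
Qed.

Lemma cinterp_sub theta theta' x : 0 <= theta <= theta' ->
  x \in cinterp_pred theta' -> x \in cinterp_pred theta.
Proof.
move=> th /set_mem[/= xoo xcl]; have [c c0 Hc] := Knorm_mono th.
apply/mem_set; split=> [|eps eps0] /=.
  by apply: le_lt_trans (Hc x) _; rewrite lte_mul_pinfty// lee_fin ltW//.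
have [|b xb] := xcl (eps / c); first by rewrite divr_gt0.
exists b; apply: le_lt_trans (Hc _) _.
by rewrite -[ltRHS](_ : c%:E * (eps / c)%:E = _)%E ?lte_pmul2l ?lte_fin// -EFinM
  mulrC divfK// gt_eqF.
Qed.

End interpolation.

Section weighted_spaces.
Context {R : realType}.

Definition BC (E : normedModType R) (D : set R) (v : R -> E) :=
  {within D, continuous v} /\ [bounded v t | t in D].

Definition weight (E : normedModType R) (mu : R) (v : R -> E) : R -> E :=
  fun t => t `^ (1 - mu) *: v t.

(* BC_{1-mu}([0, T], E) for T > 0; only the values on ]0, T] matter. *)
Definition BCw (E : normedModType R) (mu T : R) (v : R -> E) :=
  [/\ {within `]0, T], continuous v},
      BC `]0, T] (weight mu v) &
      `|weight mu v t| @[t --> 0^'+] --> (0 : R)].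

(* Difference quotients are restricted to D: on ]0, T] the derivative at T is
   one-sided. *)
Definition diffquot (E : normedModType R) (v : R -> E) (t : R) : R -> E :=
  fun s => (s - t)^-1 *: (v s - v t).

Definition derivable_within (E : normedModType R) (D : set R) (v : R -> E)
    (t : R) := cvg (diffquot v t @ within D t^').

Definition derive_within (E : normedModType R) (D : set R) (v : R -> E)
    (t : R) : E := lim (diffquot v t @ within D t^').

(* BC^1_{1-mu}([0, T], E) *)
Definition BC1w (E : normedModType R) (mu T : R) (v : R -> E) :=
  [/\ forall t, `]0, T]%classic t -> derivable_within `]0, T] v t,
      {within `]0, T], continuous (derive_within `]0, T] v)},
      BCw mu T v & BCw mu T (derive_within `]0, T] v)].

End weighted_spaces.

Section evolution.
Context {R : realType} {E0 E1 : completeNormedModType R}.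
Variables (e : dense_embedding E0 E1) (mu : R).

(* An element of the space EE_{1,mu}([0, T]) is represented by a function
   u : R -> E1 of which only the values on ]0, T] matter; its value at 0, which
   lies in E0 only, is the limit of e \o u at 0. *)
Definition EE1 (T : R) (u : R -> E1) := BC1w mu T (e \o u) /\ BCw mu T u.

Definition EE1_norm (T : R) (u : R -> E1) : \bar R :=
  ereal_sup [set (t `^ (1 - mu) *
    (`|derive_within `]0, T] (e \o u) t| + `|u t|))%:E | t in `]0, T]%classic].

Definition initial_value (u : R -> E1) (x : cinterp e mu) :=
  (e \o u) t @[t --> 0^'+] --> (\val x : E0).

Definition linear_solution (B : {linear E1 -> E0}) (T : R) (f : R -> E0)
    (x : cinterp e mu) (u : R -> E1) :=
  [/\ EE1 T u,
      forall t, 0 < t <= T ->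
        derive_within `]0, T] (e \o u) t + B (u t) = f t &
      initial_value u x].

(* The class M_mu(E1, E0). *)
Definition maximal_regularity (B : {linear E1 -> E0}) :=
  continuous B /\
  exists2 T : R, 0 < T & forall (f : R -> E0) (x : cinterp e mu),
    BCw mu T f ->
    exists2 u, linear_solution B T f x u &
      forall v, linear_solution B T f x v ->
        forall t, 0 < t <= T -> v t = u t.

(* The solution u with initial value x, as a function with values in E_mu. *)
Definition trajectory (x : cinterp e mu) (u : R -> E1) (t : R) :
    cinterp e mu :=
  if t == 0 then x else to_cinterp e mu (e (u t)).

Section problem.
Context {beta : R}.
Variables (V : set (cinterp e mu)) (A : cinterp e mu -> {linear E1 -> E0}).
Variables (F1 : cinterp e mu -> E0) (F2 : cinterp e beta -> E0).

Definition is_solution (x : cinterp e mu) (T : R) (u : R -> E1) :=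
  [/\ EE1 T u,
      forall t, 0 <= t <= T -> V (trajectory x u t),
      forall t, 0 < t <= T ->
        let w := to_cinterp e mu (e (u t)) in
        derive_within `]0, T] (e \o u) t + A w (u t) =
          F1 w + F2 (to_cinterp e beta (e (u t))) &
      initial_value u x].

(* u solves the problem on [0, tplus[ and cannot be extended to a solution on
   [0, T] with T >= tplus. *)
Definition is_maximal_solution (x : cinterp e mu) (tplus : \bar R)
    (u : R -> E1) :=
  [/\ (0 < tplus)%E,
      forall T : R, 0 < T -> (T%:E < tplus)%E -> is_solution x T u &
      forall (T : R) (v : R -> E1), (tplus <= T%:E)%E -> is_solution x T v ->
        ~ (forall t : R, 0 < t -> (t%:E < tplus)%E -> v t = u t)].

End problem.
End evolution.

Definition opnorm (R : realType) (E F : normedModType R) (B : E -> F) : \bar R :=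
  ereal_sup [set `|B b|%:E | b in [set b | `|b| <= 1]].

Definition boundary (T : topologicalType) (V : set T) : set T :=
  closure V `\` interior V.

(* Boundedness on D of a function with values in E_delta for 0 < delta <= 1,
   where E_delta is the given space E1 if delta = 1. *)
Definition bounded_in (R : realType) (E0 E1 : completeNormedModType R)
    (e : dense_embedding E0 E1) (delta : R) (D : set R) (u : R -> E1) :=
  if delta == 1 then [bounded u t | t in D]
  else [bounded to_cinterp e delta (e (u t)) | t in D].

(* Main.v *)
Require Import Defs.
From mathcomp Require Import all_boot all_order all_algebra.
From mathcomp Require Import all_classical all_reals all_analysis.
From mathcomp Require Import lra ring.

Set Implicit Arguments.
Unset Strict Implicit.
Unset Printing Implicit Defensive.

Import Order.TTheory GRing.Theory Num.Theory.
Import numFieldNormedType.Exports.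

Local Open Scope classical_set_scope.
Local Open Scope ring_scope.

(** The principal part is frozen at x0: the problem becomes
      u' + A(x0) u = rhs x0 u,
      rhs x0 u = (A(x0) u - A(u) u) + F1(u) + F2(u),
    and is solved by successive approximation. Two facts make this a contraction
    on a short interval, with constants that do not depend on its length.

    The linear problem u' + B u = f, u(0) = x, is solved on every interval
    [0, T] with T <= T0 by a solution whose norm is at most M (|f| + |x|), with
    one and the same M [maximal_regularity_bound]. On [0, T0] the norm of the
    solution is a countably subadditive seminorm of the data, hence continuous
    by Baire's argument [zabreiko]. For shorter intervals, data are extended to
    [0, T0] without increase of their norm, and uniqueness is inherited because
    the primitive of a homogeneous solution, preceded by zero, is a solution on
    [0, T0] [lsol_unique0].

    Near x0, and for functions whose weighted norm t^(1 - mu) |u(t)|_(E1) is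
    small, rhs x0 is Lipschitz continuous with an arbitrarily small constant
    [rhs_small]. This is clear for A and F1. For F2, |u(t)|_(E_beta) is
    interpolated between the E_mu-norm and the weighted E1-norm
    [interpolation_le]; the powers of t that arise from the j-th term of the
    growth condition combine to t^(1 - beta_j - rho_j (beta - mu)), whose exponent
    is nonnegative by the subcriticality condition. If the exponent vanishes,
    smallness comes from the weighted norm itself, which tends to 0 at t = 0 for
    elements of EE_(1, mu). The E_mu-norms of u(t), and of the differences of two
    functions, are controlled by the trace estimates [evol_trace] and
    [evol_trace_near], again uniformly in the interval.

    This gives existence for all initial values near x0 [sol_exists] and Lipschitz
    dependence on them [sol_lipschitz], which contains local uniqueness. Two
    solutions then agree on their common interval [sol_unique]. A solution is
    continued by solving the problem again from a time slightly before the end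
    and gluing on the overlap [sol_glue]; as the existence time is uniform for
    initial values near a given point of V, a solution on [0, T[ that has an
    accumulation point in V as t tends to T is not maximal [no_accumulation].
    If u is uniformly continuous, it converges by completeness of E_mu. If E1 is
    compactly embedded, a bounded family in E_delta is, up to a small error in E0,
    a bounded family in E1, so an ultrafilter finer than the left neighbourhoods
    of T makes u Cauchy in E0, and in E_mu by comparison of K-functionals
    [compact_cauchy_interp]. *)

(** * Identities in abelian groups *)

Inductive zexpr := ZAtom of nat | ZZero | ZAdd of zexpr & zexpr | ZOpp of zexpr.

Fixpoint zeval (V : zmodType) (env : seq V) (x : zexpr) : V :=
  match x with
  | ZAtom i => env`_i
  | ZZero => 0
  | ZAdd x y => zeval env x + zeval env y
  | ZOpp x => - zeval env x
  end.

Fixpoint zcoef (x : zexpr) (i : nat) : int :=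
  match x with
  | ZAtom j => (i == j)%:Z
  | ZZero => 0
  | ZAdd x y => zcoef x i + zcoef y i
  | ZOpp x => - zcoef x i
  end.

Fixpoint zclosed (n : nat) (x : zexpr) : bool :=
  match x with
  | ZAtom j => (j < n)%N
  | ZZero => true
  | ZAdd x y => zclosed n x && zclosed n y
  | ZOpp x => zclosed n x
  end.

Lemma zeval_coef (V : zmodType) (env : seq V) x : zclosed (size env) x ->
  zeval env x = \sum_(i < size env) env`_i *~ zcoef x i.
Proof.
elim: x => [j|_|x IHx y IHy|x IHx] /=.
- move=> jn; rewrite (bigD1 (Ordinal jn))//= eqxx mulr1z big1 ?addr0// => i ij.
  by rewrite (_ : (val i == j) = false) ?mulr0z//; apply: contraNF ij => /eqP ij;
    apply/eqP/val_inj.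
- by rewrite big1// => i _; rewrite mulr0z.
- move=> /andP[/IHx-> /IHy->]; rewrite -big_split/=.
  by apply: eq_bigr => i _; rewrite mulrzDr.
- move=> /IHx->; rewrite -sumrN; apply: eq_bigr => i _.
  by rewrite mulrNz.
Qed.

(** Two formal sums with the same coefficients have the same value; [zmod]
    applies this to an equation between sums of arbitrary terms. *)
Lemma zeval_eq (V : zmodType) (env : seq V) x y :
  [&& zclosed (size env) x, zclosed (size env) y &
      all (fun i => zcoef x i == zcoef y i) (iota 0 (size env))] ->
  zeval env x = zeval env y.
Proof.
move=> /and3P[cx cy /allP H]; rewrite !zeval_coef//.
by apply: eq_bigr => i _; rewrite (eqP (H i _))// mem_iota add0n/=.
Qed.

(* Atoms are compared up to conversion: the scalings that occur may differ in the
   path by which the scalar ring is inferred. *)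
Ltac zidx x l :=
  match l with
  | x :: _ => constr:(0%N)
  | ?y :: _ =>
      let _ := match goal with _ => unify x y end in constr:(0%N)
  | _ :: ?l' => let n := zidx x l' in constr:(S n)
  end.

Ltac zatoms t l :=
  lazymatch t with
  | GRing.add ?a ?b => let l' := zatoms a l in zatoms b l'
  | GRing.opp ?a => zatoms a l
  | GRing.zero => l
  | _ => match goal with
         | _ => let _ := zidx t l in l
         | _ => constr:(t :: l)
         end
  end.

Ltac zreify t l :=
  lazymatch t with
  | GRing.add ?a ?b =>
      let x := zreify a l in let y := zreify b l in constr:(ZAdd x y)
  | GRing.opp ?a => let x := zreify a l in constr:(ZOpp x)
  | GRing.zero => constr:(ZZero)
  | _ => let n := zidx t l in constr:(ZAtom n)
  end.

Ltac zmod :=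
  rewrite ?(scalerDl, scalerDr, scaleNr, scalerN);
  lazymatch goal with
  | |- @eq ?T ?x ?y =>
      let l0 := zatoms x (@nil T) in
      let l := zatoms y l0 in
      let a := zreify x l in
      let b := zreify y l in
      apply: (@zeval_eq _ l a b); by vm_compute
  end.

Ltac mulra :=
  lazymatch goal with H : is_true (0 < ?m < 1) |- _ => have ? := H; lra end.

(** * Calculus of Banach-space valued functions *)

Section calculus.
Context {R : realType}.

Lemma pos_lt_all (s : seq R) : all (fun x => 0 < x) s ->
  exists2 r, 0 < r & all (fun x => r < x) s.
Proof.
elim: s => [_|x s IH /= /andP[x0 /IH[r r0 rs]]]; first by exists 1.
exists (Num.min (x / 2) r); first by rewrite lt_min divr_gt0.
rewrite gt_min ltr_pdivrMr// mulr_natr mulr2n ltrDl x0/=.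
by apply: sub_all rs => y ry; rewrite gt_min ry orbT.
Qed.

Lemma closed_ball_normP (E : normedModType R) (x y : E) r : 0 < r ->
  closed_ball x r y <-> `|y - x| <= r.
Proof. by move=> r0; rewrite closed_ballE// /closed_ball_/= distrC. Qed.

Lemma opnorm_le (E F : normedModType R) (B B' : {linear E -> F}) (c : R) :
  (opnorm (fun b => B b - B' b)%R <= c%:E)%E ->
  forall b, `|B b - B' b| <= c * `|b|.
Proof.
move=> Hc b; have [->|b0] := eqVneq b 0.
  by rewrite (linear0 B) (linear0 B') subrr !normr0 mulr0.
have nb : 0 < `|b| by rewrite normr_gt0.
have bE : b = `|b| *: (`|b|^-1 *: b) by rewrite scalerA mulfV ?gt_eqF// scale1r.
have BZ (B0 : {linear E -> F}) k x : B0 (k *: x) = k *: B0 x by exact: linearZ.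
rewrite {1 2}bE !BZ -scalerBr normrZ normr_id mulrC ler_wpM2r//.
rewrite -lee_fin; apply: le_trans Hc; apply: ereal_sup_ubound.
exists (`|b|^-1 *: b); last by rewrite !BZ.
by rewrite /= normrZ gtr0_norm ?invr_gt0// mulVf// gt_eqF.
Qed.

(** The supremum of the t with P a t is b: P holds near it, so that it belongs to
    these t, and could be passed if it were smaller than b. *)
Lemma real_induction (P : R -> R -> Prop) (a b : R) : a <= b ->
  (forall s t u, a <= s -> s <= t -> t <= u -> u <= b ->
     P s t -> P t u -> P s u) ->
  (forall t, a <= t <= b -> exists2 d, 0 < d &
     forall s, a <= s <= b -> (t - d < s <= t -> P s t) /\
                              (t <= s < t + d -> P t s)) ->
  P a b.
Proof.
move=> ab Ptr Ploc; pose S := [set t | a <= t <= b /\ P a t].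
have Sa : S a.
  have aab : a <= a <= b by lra.
  split=> //; have [d d0 /(_ a aab)[_]] := Ploc _ aab.
  by apply; lra.
have Sub : has_ubound S by exists b => t [/andP[]].
have Ss : has_sup S by split=> //; exists a.
have cab : a <= sup S <= b.
  by rewrite ub_le_sup//= ge_sup//; [exists a | move=> t [/andP[]]].
have [d d0 H] := Ploc _ cab.
have [t [tab Pat] ct] := sup_adherent d0 Ss.
have tc : t <= sup S by apply: ub_le_sup.
have Pac : P a (sup S).
  apply: (Ptr a t) => //; try lra.
  by have [+ _] := H t tab; apply; lra.
have [cb|bc] := ltP (sup S) b; last first.
  by have -> : b = sup S by lra.
pose s := Num.min b (sup S + d / 2).
have sab : a <= s <= b by rewrite /s le_min ge_min; lra.
have cs : sup S < s by rewrite /s lt_min; lra.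
have sd : s < sup S + d by rewrite /s gt_min; lra.
have : S s.
  split=> //; apply: (Ptr a (sup S)) => //; try lra.
  by have [_] := H s sab; apply; lra.
by move=> /(ub_le_sup Sub); lra.
Qed.

(** The majorant phi is arbitrary because derivatives here may only be bounded by
    a multiple of t^(mu - 1), which is the slope of a bounded function. *)
Lemma mean_value_le (E : normedModType R) (g : R -> E) (phi : R -> R) (a b : R) :
  a <= b ->
  (forall s t, a <= s -> s <= t -> t <= b -> phi s <= phi t) ->
  (forall t, a <= t <= b -> forall eps, 0 < eps -> exists2 d, 0 < d &
     forall s, a <= s <= b -> `|s - t| < d ->
       `|g s - g t| <= `|phi s - phi t| + eps * `|s - t|) ->
  `|g b - g a| <= phi b - phi a.
Proof.
move=> ab phim gphi.
suff H eps : 0 < eps -> `|g b - g a| <= phi b - phi a + eps * (b - a).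
  apply/ler_addgt0Pr => eps eps0.
  have c0 : 0 < b - a + 1 by lra.
  have := H (eps / (b - a + 1)); rewrite divr_gt0// => /(_ isT).
  move=> /le_trans; apply; rewrite lerD2l -mulrA ler_piMr ?(ltW eps0)//.
  by rewrite mulrC ler_pdivrMr//; lra.
move=> eps0.
apply: (real_induction (P := fun s t =>
  `|g t - g s| <= phi t - phi s + eps * (t - s)) ab) => [s t u _ _ _ _ H1 H2|t tab].
  have -> : g u - g s = (g u - g t) + (g t - g s) by rewrite addrA subrK.
  by apply: le_trans (ler_normD _ _) _; lra.
have [d d0 H] := gphi t tab eps eps0; exists d => // s sab; split=> st.
  have sd : `|s - t| < d by rewrite ltr_distl; lra.
  have := H s sab sd; rewrite distrC => /le_trans; apply.
  rewrite -(distrC (phi t)) -(distrC t).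
  by rewrite !ger0_norm ?subr_ge0 ?phim//; lra.
have sd : `|s - t| < d by rewrite ltr_distl; lra.
have := H s sab sd; move=> /le_trans; apply.
by rewrite !ger0_norm ?subr_ge0 ?phim//; lra.
Qed.

(** Differentiability relative to a set, in the form in which it is used
    throughout: no limit has to be computed, and restriction to a smaller set
    or to a neighbourhood is immediate. *)
Definition has_deriv (E : normedModType R) (D : set R) (v : R -> E) (t : R)
    (d : E) :=
  forall eps, 0 < eps -> exists2 del, 0 < del &
    forall s, D s -> `|s - t| < del ->
      `|v s - v t - (s - t) *: d| <= eps * `|s - t|.

Definition cont_at (E : normedModType R) (D : set R) (v : R -> E) (t : R) :=
  forall eps, 0 < eps -> exists2 del, 0 < del &
    forall s, D s -> `|s - t| < del -> `|v s - v t| <= eps.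

Lemma has_deriv_local (E : normedModType R) (D D' : set R) (v w : R -> E) t d r :
  0 < r -> D t -> (forall s, D' s -> `|s - t| < r -> D s) ->
  (forall s, D s -> `|s - t| < r -> v s = w s) ->
  has_deriv D v t d -> has_deriv D' w t d.
Proof.
move=> r0 Dt DD vw H eps eps0; have [del del0 {}H] := H eps eps0.
exists (Num.min r del) => [|s D's]; rewrite ?lt_min ?r0 ?del0//.
move=> /andP[sr sdel]; have Ds := DD s D's sr.
rewrite -(vw s)// -(vw t) ?subrr ?normr0//.
by apply: H.
Qed.

Lemma cont_at_local (E : normedModType R) (D D' : set R) (v w : R -> E) t r :
  0 < r -> D t -> (forall s, D' s -> `|s - t| < r -> D s) ->
  (forall s, D s -> `|s - t| < r -> v s = w s) ->
  cont_at D v t -> cont_at D' w t.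
Proof.
move=> r0 Dt DD vw H eps eps0; have [del del0 {}H] := H eps eps0.
exists (Num.min r del) => [|s D's]; rewrite ?lt_min ?r0 ?del0//.
move=> /andP[sr sdel]; have Ds := DD s D's sr.
by rewrite -(vw s)// -(vw t) ?subrr ?normr0//; apply: H.
Qed.

Lemma has_derivS (E : normedModType R) (D D' : set R) (v : R -> E) t d :
  (forall s, D' s -> D s) -> has_deriv D v t d -> has_deriv D' v t d.
Proof.
move=> DD H eps /H[del del0 Hd]; exists del => // s /DD; exact: Hd.
Qed.

Lemma has_deriv_lip (E : normedModType R) (D : set R) (v : R -> E) t d :
  has_deriv D v t d -> forall eps, 0 < eps -> exists2 del, 0 < del &
    forall s, D s -> `|s - t| < del -> `|v s - v t| <= (`|d| + eps) * `|s - t|.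
Proof.
move=> H eps eps0; have [del del0 {}H] := H eps eps0.
exists del => // s Ds sd; have H' := H s Ds sd.
have -> : v s - v t = (v s - v t - (s - t) *: d) + (s - t) *: d by rewrite subrK.
apply: le_trans (ler_normD _ _) _.
by rewrite normrZ; lra.
Qed.

Lemma has_deriv_cont (E : normedModType R) (D : set R) (v : R -> E) t d :
  has_deriv D v t d -> cont_at D v t.
Proof.
move=> H eps eps0; have [del del0 {}H] := has_deriv_lip H ltr01.
have c0 : 0 < `|d| + 1 by rewrite ltr_wpDl.
exists (Num.min del (eps / (`|d| + 1))) => [|s Ds].
  by rewrite lt_min del0 divr_gt0.
rewrite lt_min => /andP[s1 s2]; apply: le_trans (H s Ds s1) _.
by rewrite mulrC -ler_pdivlMr// ltW.
Qed.

Lemma has_derivD (E : normedModType R) (D : set R) (v w : R -> E) t d d' :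
  has_deriv D v t d -> has_deriv D w t d' ->
  has_deriv D (fun s => v s + w s) t (d + d').
Proof.
move=> Hv Hw eps eps0; have e20 : 0 < eps / 2 by lra.
have [d1 d10 {}Hv] := Hv _ e20; have [d2 d20 {}Hw] := Hw _ e20.
exists (Num.min d1 d2) => [|s Ds]; rewrite ?lt_min ?d10 ?d20//.
move=> /andP[s1 s2].
have -> : v s + w s - (v t + w t) - (s - t) *: (d + d') =
    (v s - v t - (s - t) *: d) + (w s - w t - (s - t) *: d') by zmod.
apply: le_trans (ler_normD _ _) _.
by have := Hv s Ds s1; have := Hw s Ds s2; lra.
Qed.

Lemma has_deriv_linear (E F : normedModType R) (B : {linear E -> F}) (D : set R)
    (v : R -> E) t d c : (forall x, `|B x| <= c * `|x|) ->
  has_deriv D v t d -> has_deriv D (fun s => B (v s)) t (B d).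
Proof.
move=> Bc Hv eps eps0; have c0 : 0 < `|c| + 1 by rewrite ltr_wpDl.
have [del del0 {}Hv] := Hv (eps / (`|c| + 1)) (divr_gt0 eps0 c0).
exists del => // s Ds sd; rewrite -linearZ -!linearB.
apply: le_trans (Bc _) _; have := Hv s Ds sd => H.
apply: (@le_trans _ _ ((`|c| + 1) * (eps / (`|c| + 1) * `|s - t|))).
  apply: le_trans (ler_wpM2l (ltW c0) H).
  by apply: ler_wpM2r => //; have := ler_norm c; lra.
by rewrite mulrA [_ * (eps / _)]mulrC divfK ?gt_eqF.
Qed.

Lemma has_derivN (E : normedModType R) (D : set R) (v : R -> E) t d :
  has_deriv D v t d -> has_deriv D (fun s => - v s) t (- d).
Proof.
move=> H eps eps0; have [del del0 {}H] := H _ eps0.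
exists del => // s Ds sd; rewrite scalerN -!opprD normrN; exact: H.
Qed.

Lemma has_derivB (E : normedModType R) (D : set R) (v w : R -> E) t d d' :
  has_deriv D v t d -> has_deriv D w t d' ->
  has_deriv D (fun s => v s - w s) t (d - d').
Proof. by move=> Hv /has_derivN; apply: has_derivD. Qed.

Lemma cont_atD (E : normedModType R) (D : set R) (v w : R -> E) t :
  cont_at D v t -> cont_at D w t -> cont_at D (fun s => v s + w s) t.
Proof.
move=> Hv Hw eps eps0; have e20 : 0 < eps / 2 by lra.
have [d1 d10 {}Hv] := Hv _ e20; have [d2 d20 {}Hw] := Hw _ e20.
exists (Num.min d1 d2) => [|s Ds]; rewrite ?lt_min ?d10 ?d20//.
move=> /andP[s1 s2]; rewrite opprD addrACA.
apply: le_trans (ler_normD _ _) _.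
by have := Hv s Ds s1; have := Hw s Ds s2; lra.
Qed.

Lemma cont_at_linear (E F : normedModType R) (B : {linear E -> F}) (D : set R)
    (v : R -> E) t c : (forall x, `|B x| <= c * `|x|) ->
  cont_at D v t -> cont_at D (fun s => B (v s)) t.
Proof.
move=> Bc Hv eps eps0; have c0 : 0 < `|c| + 1 by rewrite ltr_wpDl.
have [del del0 {}Hv] := Hv (eps / (`|c| + 1)) (divr_gt0 eps0 c0).
exists del => // s Ds sd; rewrite -linearB.
apply: le_trans (Bc _) _; have H := Hv s Ds sd.
apply: (@le_trans _ _ ((`|c| + 1) * (eps / (`|c| + 1)))).
  apply: le_trans (ler_wpM2l (ltW c0) H).
  by apply: ler_wpM2r => //; have := ler_norm c; lra.
by rewrite mulrC divfK ?gt_eqF.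
Qed.

Lemma mean_value_deriv (E : normedModType R) (g g' : R -> E) (phi phi' : R -> R)
    (a b : R) : a <= b ->
  (forall s t, a <= s -> s <= t -> t <= b -> phi s <= phi t) ->
  (forall t, a <= t <= b -> [/\ has_deriv [set s | a <= s <= b] g t (g' t),
      has_deriv [set s | a <= s <= b] phi t (phi' t) & `|g' t| <= phi' t]) ->
  `|g b - g a| <= phi b - phi a.
Proof.
move=> ab phim H; apply: mean_value_le => // t tab eps eps0.
have [Hg Hp gp] := H t tab; have e20 : 0 < eps / 2 by lra.
have [d1 d10 {}Hg] := has_deriv_lip Hg e20.
have [d2 d20 {}Hp] := Hp _ e20.
exists (Num.min d1 d2) => [|s sab]; rewrite ?lt_min ?d10 ?d20//.
move=> /andP[s1 s2]; apply: le_trans (Hg s sab s1) _.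
have p0 : 0 <= phi' t by apply: le_trans gp.
have := Hp s sab s2.
have := ler_normB (phi s - phi t) (phi s - phi t - (s - t) *: phi' t).
rewrite opprB addrC subrK normrZ (ger0_norm p0).
have := ler_wpM2r (normr_ge0 (s - t)) gp; lra.
Qed.

Lemma has_deriv_scale (E : normedModType R) (D : set R) (c : E) t :
  has_deriv D (fun s : R => s *: c) t c.
Proof.
move=> eps eps0; exists 1 => // s _ _.
by rewrite -scalerBl subrr normr0 mulr_ge0// ltW.
Qed.

Lemma mean_value_cst (E : normedModType R) (g g' : R -> E) (c a b : R) :
  a <= b ->
  (forall t, a <= t <= b ->
     has_deriv [set s | a <= s <= b] g t (g' t) /\ `|g' t| <= c) ->
  `|g b - g a| <= c * (b - a).
Proof.
move=> ab H; have c0 : 0 <= c.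
  by apply: le_trans (proj2 (H a _)) => //; rewrite lexx ab.
rewrite mulrBr mulrC [c * a]mulrC.
apply: (mean_value_deriv (g' := g') (phi := fun s => s *: (c : R^o)) (phi' := fun=> c)) => //.
  by move=> s t _ st _; apply: ler_wpM2r.
move=> t tab; have [Hg gc] := H t tab; split=> //; exact: has_deriv_scale.
Qed.

(** The rates of all limits below are geometric. *)
Definition halfX (n : nat) : R := 2^-1 ^+ n.

Lemma halfX_gt0 n : 0 < halfX n.
Proof. by rewrite exprn_gt0// invr_gt0. Qed.

Lemma halfXS n : halfX n.+1 = halfX n / 2.
Proof. by rewrite /halfX exprSr. Qed.

Lemma halfX0 : halfX 0 = 1.
Proof. by rewrite /halfX expr0. Qed.

Lemma halfX_mono n m : (n <= m)%N -> halfX m <= halfX n.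
Proof.
by move=> nm; rewrite /halfX ler_wiXn2l// ?invr_ge0// invf_le1//; lra.
Qed.

Lemma halfX_small C eps : 0 < eps -> exists n, C * halfX n <= eps.
Proof.
move=> eps0.
have H n : n%:R * halfX n <= 1.
  elim: n => [|n IH]; first by rewrite mul0r.
  rewrite halfXS -natr1; have := halfX_mono (leq0n n); rewrite halfX0; lra.
have [C0|C0] := leP C 0.
  by exists 0%N; rewrite halfX0; lra.
have [n Cn] : exists n : nat, C / eps <= n%:R.
  by exists (Num.truncn (C / eps)).+1; apply/ltW/truncnS_gt.
exists n; have := H n; have := halfX_gt0 n.
have : C <= n%:R * eps by rewrite -ler_pdivrMr.
move=> C1 h0n Hn; apply: le_trans (ler_wpM2r (ltW h0n) C1) _.
by rewrite mulrAC ler_piMl// ltW.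
Qed.

Lemma lim_rate (E : completeNormedModType R) (x : nat -> E) (C : R) :
  (forall n m, (n <= m)%N -> `|x m - x n| <= C * halfX n) ->
  exists l, forall n, `|l - x n| <= C * halfX n.
Proof.
move=> H; have cx : cvg (x @ \oo).
  apply/cauchy_cvgP/cauchy_exP => eps eps0.
  have e20 : 0 < eps / 2 by lra.
  have [n Cn] := halfX_small C e20.
  exists (x n); rewrite -ball_normE.
  suff : \forall m \near \oo, `|x n - x m| < eps by [].
  near=> m; rewrite distrC; apply: le_lt_trans (H n m _) _; last by lra.
  by near: m; exact: nbhs_infty_ge.
exists (lim (x @ \oo)) => n.
have cv : `|x m - x n| @[m --> \oo] --> `|lim (x @ \oo) - x n|.
  by apply: cvg_norm; apply: cvgB => //; exact: cvg_cst.
have <- : lim (`|x m - x n| @[m --> \oo]) = `|lim (x @ \oo) - x n|.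
  exact: cvg_lim cv.
apply: limr_le; first by apply/cvg_ex; eexists; exact: cv.
by near=> m; apply: H; near: m; exact: nbhs_infty_ge.
Unshelve. all: by end_near.
Qed.

Lemma geometric_steps (E : normedModType R) (x : nat -> E) (C : R) :
  (forall n, `|x n.+1 - x n| <= C * halfX n) ->
  forall n m, (n <= m)%N -> `|x m - x n| <= 2 * C * halfX n.
Proof.
move=> H n m nm.
have C0 : 0 <= C by have := le_trans (normr_ge0 _) (H 0%N); rewrite halfX0 mulr1.
have : `|x m - x n| <= 2 * C * (halfX n - halfX m).
  rewrite -(subnK nm); elim: (m - n)%N => [|k IH].
    by rewrite !subrr normr0 mulr0.
  rewrite addSn halfXS -[x _.+1](subrK (x (k + n)%N)) -addrA.
  apply: le_trans (ler_normD _ _) _; have := H (k + n)%N.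
  move: IH; lra.
by have := mulr_ge0 C0 (ltW (halfX_gt0 m)); lra.
Qed.

Lemma lim_rate_step (E : completeNormedModType R) (x : nat -> E) (C : R) :
  (forall n, `|x n.+1 - x n| <= C * halfX n) ->
  exists l, forall n, `|l - x n| <= 2 * C * halfX n.
Proof. by move=> H; apply: lim_rate; exact: geometric_steps. Qed.

End calculus.

(** * Primitives of continuous functions *)

Section primitive.
Context {R : realType} {E : completeNormedModType R}.
Variable q : R -> E.

(** Up to the error eps, q is the derivative of Q on [a, b]: unlike exact
    primitives, these can be glued from affine pieces. *)
Definition approx_primitive (eps a b : R) (Q : R -> E) :=
  forall t, a <= t <= b -> exists2 d, 0 < d & forall s, a <= s <= b ->
    `|s - t| < d -> `|Q s - Q t - (s - t) *: q t| <= eps * `|s - t|.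

Lemma approx_primitive_cat eps a b c Q Q' : a <= b -> b <= c ->
  approx_primitive eps a b Q -> approx_primitive eps b c Q' ->
  approx_primitive eps a c
    (fun r => if r <= b then Q r else Q' r - Q' b + Q b).
Proof.
move=> ab bc H H' t tac; have [tb|bt|tb] := ltgtP t b.
- have [d d0 {}H] := H t ltac:(lra).
  exists (Num.min d (b - t)) => [|s sac]; rewrite lt_min; first by lra.
  move=> /andP[sd]; rewrite ltr_distl => sb.
  by rewrite ifT; [apply: H => //|]; lra.
- have [d d0 {}H'] := H' t ltac:(lra).
  exists (Num.min d (t - b)) => [|s sac]; rewrite lt_min; first by lra.
  move=> /andP[sd]; rewrite ltr_distl => sb.
  rewrite ifF; last by apply/negbTE; rewrite -ltNge; lra.
  have -> : Q' s - Q' b + Q b - (Q' t - Q' b + Q b) = Q' s - Q' t by zmod.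
  by apply: H' => //; lra.
- rewrite tb; have [d1 d10 {}H] := H b ltac:(lra).
  have [d2 d20 {}H'] := H' b ltac:(lra).
  exists (Num.min d1 d2) => [|s sac]; rewrite lt_min; first by lra.
  move=> /andP[s1 s2]; case: ifPn => [sb|]; first by apply: H => //; lra.
  rewrite -ltNge => bs; rewrite addrK.
  by apply: H' => //; lra.
Qed.

Lemma approx_primitive_exists eps a b : 0 < eps -> a <= b ->
  (forall t, a <= t <= b -> cont_at [set s | a <= s <= b] q t) ->
  exists Q, approx_primitive eps a b Q.
Proof.
move=> eps0 ab qc.
have aff t s u (st : forall r, s <= r <= u -> `|q r - q t| <= eps) :
    approx_primitive eps s u (fun r => r *: q t).
  move=> r rsu; exists 1 => // r' _ _.
  by rewrite -scalerBl -scalerBr normrZ mulrC ler_wpM2r// distrC st.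
apply: (real_induction (P := fun s t => exists Q, approx_primitive eps s t Q) ab).
  move=> s t u _ st tu _ [Q HQ] [Q' HQ']; eexists.
  exact: approx_primitive_cat HQ HQ'.
move=> t tab; have [d d0 H] := qc t tab eps eps0.
exists d => // s sab; split=> std; exists (fun r => r *: q t); apply: aff => r rst;
  by apply: H => /=; rewrite ?ltr_distl; lra.
Qed.

Lemma approx_primitive_unique eps eps' a b Q Q' : a <= b ->
  0 <= eps -> 0 <= eps' ->
  approx_primitive eps a b Q -> approx_primitive eps' a b Q' ->
  forall s t, a <= s -> s <= t -> t <= b ->
    `|(Q t - Q' t) - (Q s - Q' s)| <= (eps + eps') * (t - s).
Proof.
move=> ab e0 e'0 H H' s t as_ st tb; have ee : 0 <= eps + eps' by lra.
rewrite mulrBr.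
apply: (mean_value_le (g := fun r => Q r - Q' r)
  (phi := fun r => (eps + eps') * r)) => //.
  by move=> r r' _ rr' _; apply: ler_wpM2l.
move=> r rst eta eta0; have [d1 d10 {}H] := H r ltac:(lra).
have [d2 d20 {}H'] := H' r ltac:(lra).
exists (Num.min d1 d2) => [|x xst]; rewrite lt_min; first by lra.
move=> /andP[x1 x2]; rewrite -mulrBr normrM (ger0_norm ee).
have -> : Q x - Q' x - (Q r - Q' r) = (Q x - Q r - (x - r) *: q r) -
    (Q' x - Q' r - (x - r) *: q r) by zmod.
apply: le_trans (ler_normB _ _) _.
have h1 := H x ltac:(lra) x1; have h2 := H' x ltac:(lra) x2.
by have := mulr_ge0 (ltW eta0) (normr_ge0 (x - r)); lra.
Qed.

(** The approximate primitives with error 2^-n converge: the difference of two of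
    them, normalised at 0, has slope at most the sum of the errors. *)
Lemma primitive_exists b : 0 <= b ->
  (forall t, 0 <= t <= b -> cont_at [set s | 0 <= s <= b] q t) ->
  exists2 Q : R -> E, Q 0 = 0 &
    forall t, 0 <= t <= b -> has_deriv [set s | 0 <= s <= b] Q t (q t).
Proof.
move=> b0 qc.
have /choice[Q_ HQ_] : forall n, exists Q, approx_primitive (halfX n) 0 b Q.
  by move=> n; exact: approx_primitive_exists (halfX_gt0 n) b0 qc.
pose Q0 n r := Q_ n r - Q_ n 0.
have diffQ n m : (n <= m)%N -> forall s t, 0 <= s <= b -> 0 <= t <= b ->
    `|(Q0 m t - Q0 n t) - (Q0 m s - Q0 n s)| <= 2 * halfX n * `|t - s|.
  move=> nm s t.
  wlog st : s t / s <= t => [hw sb tb|sb tb].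
    have [st|/ltW ts] := leP s t; first exact: hw.
    by rewrite distrC (distrC t); apply: hw.
  have := approx_primitive_unique b0 (ltW (halfX_gt0 m)) (ltW (halfX_gt0 n)) (HQ_ m)
    (HQ_ n) (s := s) (t := t).
  rewrite (ger0_norm (_ : 0 <= t - s)); last by lra.
  have -> : Q0 m t - Q0 n t - (Q0 m s - Q0 n s) =
      Q_ m t - Q_ n t - (Q_ m s - Q_ n s) by rewrite /Q0; zmod.
  move=> /(_ ltac:(lra) st ltac:(lra)) /le_trans; apply.
  have ts : 0 <= t - s by lra.
  by rewrite ler_wpM2r//; have := halfX_mono (R := R) nm; lra.
have Q00 n : Q0 n 0 = 0 by rewrite /Q0 subrr.
have zb : 0 <= (0 : R) <= b by lra.
have lim t : 0 <= t <= b -> exists l, forall n, `|l - Q0 n t| <= 2 * b * halfX n.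
  move=> tb; apply: lim_rate => n m nm.
  have := diffQ n m nm 0 t zb tb.
  rewrite !Q00 !subr0 => /le_trans; apply; rewrite mulrAC ler_wpM2r//.
    by rewrite ltW// halfX_gt0.
  by rewrite ler_wpM2l// ger0_norm; lra.
pose Q t := if pselect (0 <= t <= b) is left tb then projT1 (cid (lim t tb)) else 0.
have QP t : 0 <= t <= b -> forall n, `|Q t - Q0 n t| <= 2 * b * halfX n.
  by rewrite /Q; case: pselect => // tb _; exact: projT2 (cid (lim t tb)).
have QQ n s t : 0 <= s <= b -> 0 <= t <= b ->
    `|(Q t - Q0 n t) - (Q s - Q0 n s)| <= 2 * halfX n * `|t - s|.
  move=> sb tb; apply/ler_addgt0Pr => eps eps0.
  have [m0 Hm0] := @halfX_small _ (2 * b + 2 * b) eps eps0.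
  pose m := maxn n m0; have nm : (n <= m)%N by rewrite leq_maxl.
  have hm : halfX m <= halfX m0 :> R by apply: halfX_mono; rewrite leq_maxr.
  have -> : (Q t - Q0 n t) - (Q s - Q0 n s) =
     (Q0 m t - Q0 n t - (Q0 m s - Q0 n s)) + ((Q t - Q0 m t) - (Q s - Q0 m s)) by zmod.
  apply: le_trans (ler_normD _ _) _; apply: lerD; first exact: diffQ.
  apply: le_trans (ler_normB _ _) _.
  have := QP t tb m; have := QP s sb m; have := ler_wpM2l b0 hm; lra.
exists Q.
  apply/eqP; rewrite -normr_le0; apply/ler_addgt0Pr => eps eps0.
  have [n Hn] := @halfX_small _ (2 * b) eps eps0.
  by rewrite add0r; apply: le_trans Hn; have := QP 0 zb n; rewrite Q00 subr0.
move=> t tb eps eps0; have [n Hn] := @halfX_small R 3 eps eps0.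
have [d d0 Hd] := HQ_ n t tb; exists d => // s sb sd.
have -> : Q s - Q t - (s - t) *: q t = (Q s - Q0 n s - (Q t - Q0 n t)) +
    (Q_ n s - Q_ n t - (s - t) *: q t) by rewrite /Q0; zmod.
apply: le_trans (ler_normD _ _) _.
have := QQ n t s tb sb; have := Hd s sb sd.
by have := ler_wpM2r (normr_ge0 (s - t)) Hn; lra.
Qed.

End primitive.

(** * Weighted spaces of functions on a half-open interval *)

Notation halfopen T := [set s | 0 < s <= T].

Section weighted.
Context {R : realType}.

Lemma diffquot_cvgP (E : normedModType R) (D : set R) (v : R -> E) t d :
  diffquot v t @ within D t^' --> d <-> has_deriv D v t d.
Proof.
have key s : s != t ->
    `|d - diffquot v t s| * `|s - t| = `|v s - v t - (s - t) *: d|.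
  move=> st; rewrite mulrC -normrZ scalerBr /diffquot scalerA divff ?subr_eq0//.
  by rewrite scale1r distrC.
split=> [/cvgrPdist_le H eps eps0|H].
  have := H _ eps0; rewrite !near_withinE => /nbhs_ballP[del del0 {}H].
  exists del => // s Ds sd.
  have [->|st] := eqVneq s t; first by rewrite !subrr scale0r subrr !normr0 mulr0.
  rewrite -key// ler_wpM2r//; apply: H => //=.
  by rewrite -ball_normE /ball_/= distrC.
apply/cvgrPdist_le => eps eps0; have [del del0 {}H] := H _ eps0.
rewrite !near_withinE; apply/nbhs_ballP; exists del => // s.
rewrite -ball_normE /ball_/= distrC => sd st Ds.
have st0 : 0 < `|s - t| by rewrite normr_gt0 subr_eq0.
by rewrite -(ler_pM2r st0) key//; exact: H.
Qed.

Lemma halfopen_proper (T t : R) : 0 < t <= T ->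
  ProperFilter (within (halfopen T) t^').
Proof.
move=> tT; apply: Build_ProperFilter_ex => P.
rewrite /within/= => /nbhs_ballP[del /= del0 H].
pose m := Num.min t del; have m0 : 0 < m by rewrite lt_min; lra.
have mt : m <= t by rewrite ge_min lexx.
have md : m <= del by rewrite ge_min lexx orbT.
exists (t - m / 2); apply: H => /=; last by lra.
  by rewrite -ball_normE /ball_/= opprB addrC subrK gtr0_norm; lra.
by rewrite neq_lt; lra.
Qed.

Lemma derive_withinE (E : normedModType R) (T t : R) (v : R -> E) d :
  0 < t <= T -> has_deriv (halfopen T) v t d ->
  derivable_within `]0, T] v t /\ derive_within `]0, T] v t = d.
Proof.
move=> tT /diffquot_cvgP H; rewrite /derivable_within /derive_within set_itvoc.
by split; [apply/cvg_ex; exists d | exact: (@cvg_lim _ _ _ _ (halfopen_proper tT))].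
Qed.

Lemma derivable_withinP (E : normedModType R) (T t : R) (v : R -> E) :
  derivable_within `]0, T] v t ->
  has_deriv (halfopen T) v t (derive_within `]0, T] v t).
Proof. by rewrite /derivable_within /derive_within set_itvoc => /diffquot_cvgP. Qed.

Lemma has_deriv_unique (E : normedModType R) (T t : R) (v : R -> E) d d' :
  0 < t <= T -> has_deriv (halfopen T) v t d -> has_deriv (halfopen T) v t d' ->
  d = d'.
Proof.
by move=> tT /(derive_withinE tT)[_ <-] /(derive_withinE tT)[_ <-].
Qed.

Lemma cont_at_cvgP (E : normedModType R) (D : set R) (v : R -> E) t :
  v @ within D (nbhs t) --> v t <-> cont_at D v t.
Proof.
split=> [/cvgrPdist_le H eps eps0|H].
  have := H _ eps0; rewrite near_withinE => /nbhs_ballP[del del0 {}H].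
  exists del => // s Ds sd; rewrite distrC; apply: H => //.
  by rewrite -ball_normE /ball_/= distrC.
apply/cvgrPdist_le => eps eps0; have [del del0 {}H] := H _ eps0.
rewrite near_withinE; apply/nbhs_ballP; exists del => // s.
rewrite -ball_normE /ball_/= distrC => sd Ds; rewrite distrC.
exact: H.
Qed.

Lemma within_contP (E : normedModType R) (D : set R) (v : R -> E) :
  {within D, continuous v} <-> forall t, D t -> cont_at D v t.
Proof.
rewrite subspace_continuousP; split=> H t Dt; apply/cont_at_cvgP; exact: H.
Qed.

Lemma is_derive_has_deriv (f : R -> R) (D : set R) t d :
  is_derive t (1 : R) f d -> has_deriv D f t d.
Proof.
move=> [Hf dE] eps eps0.
have {dE}Hf : (x^-1 *: (f (x *: (1 : R) + t) - f t) @[x --> 0^']) --> d.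
  by rewrite -dE; exact: Hf.
move/cvgrPdist_le: Hf => Hf.
have := Hf _ eps0; rewrite near_withinE => /nbhs_ballP[del /= del0 {}Hf].
exists del => // s _ sd.
have [->|st] := eqVneq s t; first by rewrite !subrr scale0r subrr !normr0 mulr0.
have st0 : s - t != 0 by rewrite subr_eq0.
have := Hf (s - t); rewrite -ball_normE /ball_/= sub0r normrN => /(_ sd st0).
move=> /(ler_wpM2r (normr_ge0 (s - t))); rewrite -normrM.
rewrite (_ : (_ - _) * (s - t) = - (f s - f t - (s - t) *: (d : R^o))) ?normrN//.
rewrite mulrBl /GRing.scale/= mulr1 subrK mulrAC mulVf// mul1r.
by rewrite (mulrC d) [RHS]opprB.
Qed.

Lemma powR_has_deriv (a t : R) (D : set R) : 0 < t ->
  has_deriv D (fun s => s `^ a) t (a * t `^ (a - 1)).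
Proof. by move=> t0; apply: is_derive_has_deriv; exact: is_derive1_powR. Qed.

Lemma powR_cont_at (a t : R) (D : set R) : 0 < t ->
  cont_at D (fun s : R => s `^ a : R^o) t.
Proof. move=> t0; apply: has_deriv_cont; exact: powR_has_deriv. Qed.

Lemma powR_small (a eps : R) : 0 < a -> 0 < eps ->
  exists2 d, 0 < d & forall t, 0 < t -> t < d -> t `^ a <= eps.
Proof.
move=> a0 eps0; exists (eps `^ a^-1) => [|t t0 td]; first exact: powR_gt0.
rewrite -[eps](powRr1 (ltW eps0)) -(mulVf (lt0r_neq0 a0)).
by rewrite powRrM ge0_ler_powR ?nnegrE ?powR_ge0 ?ltW.
Qed.

Lemma powRBM (a b t : R) : 0 < t -> t `^ a * t `^ b = t `^ (a + b).
Proof. by move=> t0; rewrite powRD// (gt_eqF t0) implybT. Qed.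

Lemma powR_split (n l : R) : 0 <= n -> n `^ (1 - l) * n `^ l = n.
Proof.
move=> n0; have [->|n00] := eqVneq n 0.
  have [->|ln0] := eqVneq l 0; last by rewrite (powR0 ln0) mulr0.
  by rewrite subr0 powRr1// mul0r.
by rewrite powRBM ?lt_def ?n00// subrK powRr1.
Qed.

Section one_weight.
Variable mu : R.
Hypothesis mu01 : 0 < mu < 1.

Definition wt (t : R) : R := t `^ (1 - mu).

Lemma wt_ge0 t : 0 <= wt t. Proof. exact: powR_ge0. Qed.
Lemma wt_gt0 t : 0 < t -> 0 < wt t. Proof. exact: powR_gt0. Qed.

Lemma wt_mono s t : 0 <= s -> s <= t -> wt s <= wt t.
Proof. by move=> s0 st; rewrite ge0_ler_powR ?nnegrE//; mulra. Qed.

Lemma wt_le1 t : 0 <= t <= 1 -> wt t <= 1.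
Proof.
move=> t01; apply: (@le_trans _ _ (wt 1)); first by apply: wt_mono => //; lra.
by rewrite /wt powR1.
Qed.

Lemma wt_small eps : 0 < eps ->
  exists2 d, 0 < d & forall t, 0 < t -> t < d -> wt t <= eps.
Proof. by move=> eps0; apply: powR_small => //; mulra. Qed.

(** Membership of a function in BC_(1 - mu): boundedness of the weighted function
    follows from the other two requirements, see [BCwP]. *)
Definition wvan (E : normedModType R) (T : R) (v : R -> E) :=
  (forall t, 0 < t <= T -> cont_at (halfopen T) v t) /\
  (forall eps, 0 < eps -> exists2 d, 0 < d & forall t, 0 < t <= T -> t < d ->
     wt t * `|v t| <= eps).

Lemma cont_bounded (E : normedModType R) (v : R -> E) a b : a <= b ->
  (forall t, a <= t <= b -> cont_at [set s | a <= s <= b] v t) ->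
  exists M, forall t, a <= t <= b -> `|v t| <= M.
Proof.
move=> ab H.
apply: (real_induction (P := fun s t => exists M, forall r, s <= r <= t -> `|v r| <= M) ab).
  move=> s t u _ _ _ _ [M HM] [M' HM']; exists (Num.max M M') => r ru.
  rewrite le_max; have [rt|/ltW tr] := leP r t.
    by rewrite HM//; lra.
  by rewrite HM' ?orbT//; lra.
move=> t tab; have [d d0 {}H] := H t tab _ ltr01; exists d => // s sab.
split=> std; exists (`|v t| + 1) => r rst;
  rewrite -[v r](subrK (v t)) addrC; apply: le_trans (ler_normD _ _) _;
  by rewrite lerD2l H//= ?ltr_distl; lra.
Qed.

Lemma wvan_bounded (E : normedModType R) T (v : R -> E) : wvan T v ->
  exists2 M, 0 <= M & forall t, 0 < t <= T -> wt t * `|v t| <= M.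
Proof.
move=> [vc v0]; have [d d0 {}v0] := v0 _ ltr01.
have [Td|dT] := ltP T d.
  by exists 1 => // t tT; apply: v0 => //; lra.
have [M HM] : exists M, forall t, d <= t <= T -> `|v t| <= M.
  apply: cont_bounded dT _ => t tT.
  apply: (cont_at_local (D := halfopen T) ltr01 _ _ _ (vc t _)) => //=; try lra.
  by move=> s /=; lra.
have M0 : 0 <= M by apply: le_trans (HM d _) => //; lra.
exists (1 + wt T * M) => [|t tT]; first by rewrite addr_ge0// mulr_ge0// wt_ge0.
have [td|dt] := ltP t d.
  by apply: le_trans (v0 t tT td) _; rewrite lerDl mulr_ge0// wt_ge0.
apply: (@le_trans _ _ (wt T * M)); last by rewrite lerDr.
by apply: ler_pM => //; [exact: wt_ge0 | apply: wt_mono; lra | apply: HM; lra].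
Qed.

Lemma BCwP (E : normedModType R) T (v : R -> E) : 0 < T ->
  BCw mu T v <-> wvan T v.
Proof.
move=> T0; rewrite /BCw /BC set_itvoc; split=> [[vc [_ _] v0]|v0].
  split; first exact/within_contP.
  move=> eps eps0; move/cvgrPdist_le: v0 => /(_ _ eps0).
  rewrite near_withinE => /nbhs_ballP[d /= d0 H]; exists d => // t tT td.
  have := H t; rewrite -ball_normE /ball_/= !sub0r !normrN normr_id.
  by rewrite normrZ (ger0_norm (wt_ge0 t)) gtr0_norm; [apply; lra|lra].
have [M M0 HM] := wvan_bounded v0; case: v0 => vc v0.
split; first exact/within_contP.
  split.
    rewrite subspace_continuousP => t tT; rewrite /weight.
    apply: (@cvgZ _ _ _ (within (halfopen T) (nbhs t)) _ (fun s : R => s `^ (1 - mu)) v).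
      by apply/cont_at_cvgP; apply: powR_cont_at; case/andP: tT.
    by apply/cont_at_cvgP; exact: vc.
  exists M; split; first exact: num_real.
  move=> N MN t /= tT; apply: le_trans (ltW MN); rewrite normrZ (ger0_norm (wt_ge0 t)).
  exact: HM.
apply/cvgrPdist_le => eps eps0; have [d d0 {}v0] := v0 _ eps0.
rewrite near_withinE; apply/nbhs_ballP; exists (Num.min d T) => /=.
  by rewrite lt_min d0.
move=> t; rewrite -ball_normE /ball_/= !sub0r !normrN normr_id => + t0.
rewrite normrZ (ger0_norm (wt_ge0 t)) gtr0_norm// lt_min => /andP[td tT].
by apply: v0 => //; lra.
Qed.

End one_weight.
End weighted.

Section weighted_algebra.
Context {R : realType}.
Variable mu : R.
Hypothesis mu01 : 0 < mu < 1.

Lemma wvan_ext (E : normedModType R) T (v w : R -> E) :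
  (forall t, 0 < t <= T -> v t = w t) -> wvan mu T v -> wvan mu T w.
Proof.
move=> vw [vc v0]; split=> [t tT|eps eps0].
  apply: (cont_at_local (D := halfopen T) ltr01 _ _ _ (vc t tT)) => //.
  by move=> s sT _; exact: vw.
have [d d0 {}v0] := v0 eps eps0; exists d => // t tT td.
by rewrite -vw//; exact: v0.
Qed.

Lemma wvan_restrict (E : normedModType R) T T' (v : R -> E) : T' <= T ->
  wvan mu T v -> wvan mu T' v.
Proof.
move=> TT [vc v0]; split=> [t tT|eps eps0].
  apply: (cont_at_local (D := halfopen T) ltr01 _ _ _ (vc t _)) => //=; try lra.
  by move=> s /=; lra.
have [d d0 {}v0] := v0 eps eps0; exists d => // t tT td.
by apply: v0 => //; lra.
Qed.

Lemma wvanD (E : normedModType R) T (v w : R -> E) :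
  wvan mu T v -> wvan mu T w -> wvan mu T (fun t => v t + w t).
Proof.
move=> [vc v0] [wc w0]; split=> [t tT|eps eps0].
  by apply: cont_atD; [exact: vc | exact: wc].
have e20 : 0 < eps / 2 by lra.
have [d1 d10 {}v0] := v0 _ e20; have [d2 d20 {}w0] := w0 _ e20.
exists (Num.min d1 d2) => [|t tT]; rewrite lt_min ?d10// => /andP[t1 t2].
apply: le_trans (ler_wpM2l (wt_ge0 mu t) (ler_normD _ _)) _.
by have := v0 t tT t1; have := w0 t tT t2; lra.
Qed.

Lemma wvan_linear (E F : normedModType R) (B : {linear E -> F}) T (v : R -> E) c :
  (forall x, `|B x| <= c * `|x|) -> wvan mu T v -> wvan mu T (fun t => B (v t)).
Proof.
move=> Bc [vc v0]; split=> [t tT|eps eps0].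
  by apply: cont_at_linear Bc _; exact: vc.
have c0 : 0 < `|c| + 1 by rewrite ltr_wpDl.
have [d d0 {}v0] := v0 _ (divr_gt0 eps0 c0); exists d => // t tT td.
apply: le_trans (ler_wpM2l (wt_ge0 mu t) (Bc _)) _.
have := v0 t tT td; rewrite ler_pdivlMr//.
have := mulr_ge0 (wt_ge0 mu t) (normr_ge0 (v t)).
have := ler_wpM2l (mulr_ge0 (wt_ge0 mu t) (normr_ge0 (v t))) (ler_norm c); lra.
Qed.

Lemma wvanZ (E : normedModType R) T (v : R -> E) (k : R) :
  wvan mu T v -> wvan mu T (fun t => k *: v t).
Proof.
move=> H; apply: (wvan_linear (B := *:%R k) (c := `|k|)) H => x.
by rewrite normrZ.
Qed.

Lemma wvanB (E : normedModType R) T (v w : R -> E) :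
  wvan mu T v -> wvan mu T w -> wvan mu T (fun t => v t - w t).
Proof.
move=> Hv /(wvanZ (-1))/(wvanD Hv); apply: wvan_ext => t _.
by rewrite scaleN1r.
Qed.

Lemma wvan_cst (E : normedModType R) T (c : E) : wvan mu T (fun=> c).
Proof.
split=> [t tT eps eps0|eps eps0].
  by exists 1 => // s _ _; rewrite subrr normr0 ltW.
have c0 : 0 < `|c| + 1 by rewrite ltr_wpDl.
have [d d0 H] := wt_small mu01 (divr_gt0 eps0 c0).
exists d => // t /andP[t0 _] td; have := H t t0 td; rewrite ler_pdivlMr//.
have := wt_ge0 mu t; lra.
Qed.

Definition wbd (E : normedModType R) T (v : R -> E) N :=
  forall t, 0 < t <= T -> wt mu t * `|v t| <= N.

Lemma wbd_restrict (E : normedModType R) T T' (v : R -> E) N : T' <= T ->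
  wbd T v N -> wbd T' v N.
Proof. by move=> TT H t tT; apply: H; lra. Qed.

Lemma wbd_le (E : normedModType R) T (v : R -> E) N N' : N <= N' ->
  wbd T v N -> wbd T v N'.
Proof. by move=> NN H t tT; apply: le_trans NN; exact: H. Qed.

Lemma wbdD (E : normedModType R) T (v w : R -> E) N N' :
  wbd T v N -> wbd T w N' -> wbd T (fun t => v t + w t) (N + N').
Proof.
move=> H H' t tT; have := H t tT; have := H' t tT.
have := ler_wpM2l (wt_ge0 mu t) (ler_normD (v t) (w t)); lra.
Qed.

Lemma wbdB (E : normedModType R) T (v w : R -> E) N N' :
  wbd T v N -> wbd T w N' -> wbd T (fun t => v t - w t) (N + N').
Proof.
move=> H H' t tT; have := H t tT; have := H' t tT.
have := ler_wpM2l (wt_ge0 mu t) (ler_normB (v t) (w t)); lra.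
Qed.

Lemma wvan_wbd_small (E : normedModType R) T (v : R -> E) eps : 0 < eps ->
  wvan mu T v -> exists2 d, 0 < d & forall T', T' <= T -> T' < d -> wbd T' v eps.
Proof.
move=> eps0 [_ /(_ eps eps0)[d d0 H]]; exists d => // T' TT Td t tT.
by apply: H; lra.
Qed.

Lemma wvan_lim (E : completeNormedModType R) T (v_ : nat -> R -> E) C :
  (forall n, wvan mu T (v_ n)) ->
  (forall n, wbd T (fun t => v_ n.+1 t - v_ n t) (C * halfX n)) ->
  exists2 v, wvan mu T v & forall n, wbd T (fun t => v t - v_ n t) (2 * C * halfX n).
Proof.
move=> Hv HC.
have lim t : 0 < t <= T -> exists l, forall n, wt mu t * `|l - v_ n t| <= 2 * C * halfX n.
  move=> tT; have w0 : 0 < wt mu t by apply: wt_gt0; lra.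
  have [l Hl] : exists l, forall n, `|l - v_ n t| <= 2 * (C / wt mu t) * halfX n.
    apply: lim_rate_step => n; rewrite mulrAC ler_pdivlMr// mulrC.
    exact: HC.
  exists l => n; rewrite mulrC -ler_pdivlMr//; apply: le_trans (Hl n) _.
  by rewrite le_eqVlt; apply/orP; left; apply/eqP; ring.
pose v t := if pselect (0 < t <= T) is left tT then projT1 (cid (lim t tT)) else 0.
have vP n : wbd T (fun t => v t - v_ n t) (2 * C * halfX n).
  move=> t tT; rewrite /v; case: pselect => // tT'.
  exact: (projT2 (cid (lim t tT')) n).
exists v => //; split=> [t tT eps eps0|eps eps0].
  have t20 : 0 < t / 2 by lra.
  have w0 : 0 < wt mu (t / 2) by apply: wt_gt0.
  have e40 : 0 < eps / 4 * wt mu (t / 2) by apply: mulr_gt0 => //; lra.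
  have [n Hn] := halfX_small (2 * C) e40.
  have near s : 0 < s <= T -> t / 2 <= s -> `|v s - v_ n s| <= eps / 4.
    move=> sT ts; rewrite -(ler_pM2r w0); apply: le_trans Hn.
    apply: le_trans (vP n s sT); rewrite mulrC ler_wpM2r//.
    by apply: wt_mono => //; lra.
  have [d d0 Hd] := (Hv n).1 t tT (eps / 4) ltac:(lra).
  exists (Num.min d (t / 2)) => [|s /= sT]; rewrite lt_min ?d0// => /andP[sd st].
  have ts : t / 2 <= s by move: st; rewrite ltr_distl; lra.
  have -> : v s - v t = (v s - v_ n s) - (v t - v_ n t) + (v_ n s - v_ n t) by zmod.
  apply: le_trans (ler_normD _ _) _.
  have := ler_normB (v s - v_ n s) (v t - v_ n t).
  have := near s sT ts; have := near t tT ltac:(lra); have := Hd s sT sd; lra.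
have e20 : 0 < eps / 2 by lra.
have [n Hn] := halfX_small (2 * C) e20.
have [d d0 Hd] := (Hv n).2 _ e20; exists d => // t tT td.
rewrite -[v t](subrK (v_ n t)).
apply: le_trans (ler_wpM2l (wt_ge0 mu t) (ler_normD _ _)) _.
by have := vP n t tT; have := Hd t tT td; lra.
Qed.

End weighted_algebra.

(** * The solution space EE_(1, mu) *)

Section evolution.
Context {R : realType} {E0 E1 : completeNormedModType R}.
Variables (e : dense_embedding E0 E1) (mu : R).
Hypothesis mu01 : 0 < mu < 1.

(** The element u of EE_(1, mu) together with its derivative u' and its initial
    value x. *)
Definition evol (T : R) (u : R -> E1) (u' : R -> E0) (x : E0) :=
  [/\ wvan mu T u, wvan mu T u',
      forall t, 0 < t <= T -> has_deriv (halfopen T) (e \o u) t (u' t) &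
      forall eps, 0 < eps -> exists2 d, 0 < d & forall t, 0 < t <= T ->
        t < d -> `|e (u t) - x| <= eps].

Lemma evol_restrict T T' u u' x : T' <= T -> evol T u u' x -> evol T' u u' x.
Proof.
move=> TT [uc uc' ud u0]; split.
- exact: wvan_restrict TT uc.
- exact: wvan_restrict TT uc'.
- move=> t tT.
  by apply: (has_derivS (D := halfopen T)) => [s /=|]; [|apply: ud]; lra.
- move=> eps eps0; have [d d0 {}u0] := u0 eps eps0; exists d => // t tT td.
  by apply: u0 => //; lra.
Qed.

Lemma evol_ext T u u' x v v' : (forall t, 0 < t <= T -> u t = v t) ->
  (forall t, 0 < t <= T -> u' t = v' t) -> evol T u u' x -> evol T v v' x.
Proof.
move=> uv uv' [uc uc' ud u0]; split.
- exact: wvan_ext uv uc.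
- exact: wvan_ext uv' uc'.
- move=> t tT; rewrite -uv'//.
  apply: (has_deriv_local (D := halfopen T) ltr01 _ _ _ (ud t _)) => //=.
  by move=> s sT _; rewrite uv.
- move=> eps eps0; have [d d0 {}u0] := u0 eps eps0; exists d => // t tT td.
  by rewrite -uv//; exact: u0.
Qed.

Lemma evolD T u u' x v v' y : evol T u u' x -> evol T v v' y ->
  evol T (fun t => u t + v t) (fun t => u' t + v' t) (x + y).
Proof.
move=> [uc uc' ud u0] [vc vc' vd v0]; split; [exact: wvanD | exact: wvanD | |].
- move=> t tT; have := has_derivD (ud t tT) (vd t tT).
  by apply: has_deriv_local ltr01 tT _ _ => // s _ _; rewrite /= linearD.
- move=> eps eps0; have e20 : 0 < eps / 2 by lra.
  have [d1 d10 {}u0] := u0 _ e20; have [d2 d20 {}v0] := v0 _ e20.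
  exists (Num.min d1 d2) => [|t tT]; rewrite lt_min ?d10// => /andP[t1 t2].
  rewrite linearD (_ : _ - _ = (e (u t) - x) + (e (v t) - y)); last by zmod.
  apply: le_trans (ler_normD _ _) _.
  by have := u0 t tT t1; have := v0 t tT t2; lra.
Qed.

Lemma has_derivZ (E : normedModType R) (D : set R) (v : R -> E) t d (k : R) :
  has_deriv D v t d -> has_deriv D (fun s => k *: v s) t (k *: d).
Proof.
by apply: (has_deriv_linear (B := *:%R k) (c := `|k|)) => x; rewrite normrZ.
Qed.

Lemma evolZ T u u' x (k : R) : evol T u u' x ->
  evol T (fun t => k *: u t) (fun t => k *: u' t) (k *: x).
Proof.
move=> [uc uc' ud u0]; split; [exact: wvanZ | exact: wvanZ | |].
- move=> t tT; have := has_derivZ k (ud t tT).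
  by apply: has_deriv_local ltr01 tT _ _ => // s _ _; rewrite /= linearZ.
- move=> eps eps0; have c0 : 0 < `|k| + 1 by rewrite ltr_wpDl.
  have [d d0 {}u0] := u0 _ (divr_gt0 eps0 c0); exists d => // t tT td.
  rewrite linearZ -scalerBr normrZ; have := u0 t tT td.
  rewrite ler_pdivlMr//; have := normr_ge0 (e (u t) - x); lra.
Qed.

Lemma evolB T u u' x v v' y : evol T u u' x -> evol T v v' y ->
  evol T (fun t => u t - v t) (fun t => u' t - v' t) (x - y).
Proof.
move=> Hu /(evolZ (-1)) /(evolD Hu); rewrite scaleN1r; apply: evol_ext => t _;
  by rewrite scaleN1r.
Qed.

Lemma evol_cst T b : evol T (fun=> b) (fun=> 0) (e b).
Proof.
split; [exact: wvan_cst | exact: wvan_cst | |].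
- move=> t tT eps eps0; exists 1 => // s _ _.
  by rewrite /= subrr scaler0 subrr normr0 mulr_ge0// ltW.
- by move=> eps eps0; exists 1 => // t _ _; rewrite subrr normr0 ltW.
Qed.

(** The weight t^(mu - 1) of u' is integrable at 0, with integral t^mu / mu. *)
Lemma evol_drift T u u' x N t : evol T u u' x -> 0 < t <= T -> wbd mu t u' N ->
  `|e (u t) - x| <= N / mu * t `^ mu.
Proof.
move=> [uc uc' ud u0] tT HN; have mu0 : 0 < mu by mulra.
have N0 : 0 <= N.
  by have := HN t ltac:(lra); apply: le_trans; rewrite mulr_ge0// wt_ge0.
have Nm : 0 <= N / mu by rewrite divr_ge0// ltW.
have slope r : 0 < r <= t -> `|e (u t) - e (u r)| <= N / mu * t `^ mu.
  move=> rt; apply: (@le_trans _ _ (N / mu * t `^ mu - N / mu * r `^ mu)); last first.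
    by rewrite gerBl mulr_ge0// powR_ge0.
  apply: (mean_value_deriv (g := e \o u) (g' := u')
    (phi := fun s => N / mu * s `^ mu) (phi' := fun s => N / mu * (mu * s `^ (mu - 1)))).
  - by lra.
  - move=> s s' rs ss' st; apply: ler_wpM2l => //.
    by rewrite ge0_ler_powR ?nnegrE//; lra.
  - move=> s sr; split.
    + by apply: (has_derivS (D := halfopen T)) => [s' /=|]; [|apply: ud]; lra.
    + apply: (has_derivZ (E := R^o)); apply: powR_has_deriv; lra.
    + have s0 : 0 < s by lra.
      rewrite mulrA divfK ?gt_eqF// -(ler_pM2l (wt_gt0 mu s0)).
      apply: le_trans (HN s ltac:(lra)) _.
      rewrite mulrCA powRBM// (_ : 1 - mu + _ = 0); last by ring.
      by rewrite powRr0 mulr1.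
apply/ler_addgt0Pr => eps eps0; have [d d0 {}u0] := u0 eps eps0.
pose r := Num.min t (d / 2).
have r0 : 0 < r by rewrite lt_min; lra.
have rt : r <= t by rewrite ge_min lexx.
have rd : r < d by rewrite gt_min; lra.
rewrite -[e (u t)](subrK (e (u r))) -addrA; apply: le_trans (ler_normD _ _) _.
by apply: lerD; [apply: slope | apply: u0]; lra.
Qed.

(** Completeness of EE_(1, mu). Away from 0 the mean value inequality for the
    differences of two approximants identifies the derivative of the limit; at 0
    the uniform drift estimate for the approximants identifies its trace. *)
Lemma evol_lim T (u_ : nat -> R -> E1) (u'_ : nat -> R -> E0) (x_ : nat -> E0) x C :
  (forall n, evol T (u_ n) (u'_ n) (x_ n)) ->
  (forall n, wbd mu T (fun t => u_ n.+1 t - u_ n t) (C * halfX n)) ->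
  (forall n, wbd mu T (fun t => u'_ n.+1 t - u'_ n t) (C * halfX n)) ->
  (forall eps, 0 < eps -> exists n0, forall n, (n0 <= n)%N -> `|x_ n - x| <= eps) ->
  exists u u', [/\ evol T u u' x,
    forall n, wbd mu T (fun t => u t - u_ n t) (2 * C * halfX n) &
    forall n, wbd mu T (fun t => u' t - u'_ n t) (2 * C * halfX n)].
Proof.
move=> Hu HC HC' Hx.
have [u uc ulim] := wvan_lim mu01 (fun n => let: And4 uc _ _ _ := Hu n in uc) HC.
have [u' uc' ulim'] := wvan_lim mu01 (fun n => let: And4 _ uc' _ _ := Hu n in uc') HC'.
exists u, u'; split=> //; split=> //; have [c c0 ec] := embed_bound e.
  move=> t tT eps eps0.
  have t20 : 0 < t / 2 by lra.
  have w0 : 0 < wt mu (t / 2) by apply: wt_gt0.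
  have C0 : 0 <= C.
    have := HC 0%N t tT; rewrite halfX0 mulr1; apply: le_trans.
    by rewrite mulr_ge0// wt_ge0.
  pose K := C / wt mu (t / 2).
  have K0 : 0 <= K by rewrite divr_ge0// wt_ge0.
  have close m r : 0 < r <= T -> t / 2 <= r -> `|u' r - u'_ m r| <= 2 * K * halfX m.
    move=> rT tr; have -> : 2 * K * halfX m = 2 * C * halfX m / wt mu (t / 2) by rewrite /K; ring.
    rewrite ler_pdivlMr// mulrC; apply: le_trans (ulim' m r rT).
    by rewrite ler_wpM2r//; apply: wt_mono => //; lra.
  have incr n m a b : (n <= m)%N -> t / 2 <= a -> a <= b -> b <= T ->
      `|e (u_ m b) - e (u_ n b) - (e (u_ m a) - e (u_ n a))| <= 4 * K * halfX n * (b - a).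
    move=> nm ta ab bT.
    apply: (mean_value_cst (g := fun r => e (u_ m r) - e (u_ n r))
      (g' := fun r => u'_ m r - u'_ n r)) => // r rab; split.
      apply: (has_deriv_local (D := halfopen T) ltr01); last first.
      + case: (Hu m) => _ _ /(_ r) Hm _; case: (Hu n) => _ _ /(_ r) Hn _.
        by apply: has_derivB; [apply: Hm | apply: Hn]; lra.
      + by [].
      + by move=> s /=; lra.
      + by move=> /=; lra.
    have -> : u'_ m r - u'_ n r = (u' r - u'_ n r) - (u' r - u'_ m r) by zmod.
    apply: le_trans (ler_normB _ _) _.
    have := close m r ltac:(lra) ltac:(lra); have := close n r ltac:(lra) ltac:(lra).
    by have := ler_wpM2l K0 (halfX_mono (R := R) nm); lra.
  have incrl n a b : t / 2 <= a -> a <= b -> b <= T ->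
      `|e (u b) - e (u_ n b) - (e (u a) - e (u_ n a))| <= 4 * K * halfX n * (b - a).
    move=> ta ab bT; apply/ler_addgt0Pr => eta eta0.
    have c20 : 0 < eta / 2 by lra.
    have [m0 Hm0] := halfX_small (c * (2 * K)) c20.
    pose m := maxn n m0; have nm : (n <= m)%N by rewrite leq_maxl.
    have hm : halfX m <= halfX m0 :> R by apply: halfX_mono; rewrite leq_maxr.
    have elim r : 0 < r <= T -> t / 2 <= r -> `|e (u r) - e (u_ m r)| <= eta / 2.
      move=> rT tr; rewrite -linearB; apply: le_trans (ec _) _.
      apply: le_trans Hm0; rewrite -mulrA ler_wpM2l ?(ltW c0)//.
      apply: (@le_trans _ _ (2 * K * halfX m)); last by rewrite ler_wpM2l// mulr_ge0.
      have -> : 2 * K * halfX m = 2 * C * halfX m / wt mu (t / 2) by rewrite /K; ring.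
      rewrite ler_pdivlMr// mulrC; apply: le_trans (ulim m r rT).
      by rewrite ler_wpM2r//; apply: wt_mono => //; lra.
    have -> : e (u b) - e (u_ n b) - (e (u a) - e (u_ n a)) =
      (e (u_ m b) - e (u_ n b) - (e (u_ m a) - e (u_ n a))) +
      ((e (u b) - e (u_ m b)) - (e (u a) - e (u_ m a))) by zmod.
    apply: le_trans (ler_normD _ _) _; apply: lerD; first exact: incr.
    apply: le_trans (ler_normB _ _) _.
    by have := elim a ltac:(lra) ta; have := elim b ltac:(lra) ltac:(lra); lra.
  have e20 : 0 < eps / 2 by lra.
  have [n Hn] := halfX_small (6 * K) e20.
  have [_ _ /(_ t tT _ e20)[d d0 Hd] _] := Hu n.
  exists (Num.min d (t / 2)) => [|s /= sT]; rewrite lt_min ?d0// => /andP[sd st].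
  have ts : t / 2 <= s by move: st; rewrite ltr_distl; lra.
  have -> : e (u s) - e (u t) - (s - t) *: u' t =
    (e (u s) - e (u_ n s) - (e (u t) - e (u_ n t))) +
    (e (u_ n s) - e (u_ n t) - (s - t) *: u'_ n t) - (s - t) *: (u' t - u'_ n t).
    by rewrite scalerBr; zmod.
  apply: le_trans (ler_normB _ _) _; rewrite normrZ.
  have := ler_normD (e (u s) - e (u_ n s) - (e (u t) - e (u_ n t)))
     (e (u_ n s) - e (u_ n t) - (s - t) *: u'_ n t).
  have := Hd s sT sd => /=.
  have := ler_wpM2l (normr_ge0 (s - t)) (close n t tT ltac:(lra)).
  have := ler_wpM2r (normr_ge0 (s - t)) Hn.
  have [st'|/ltW ts'] := leP t s.
    have := incrl n t s ltac:(lra) st' ltac:(lra).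
    by rewrite (ger0_norm (_ : 0 <= s - t)) ?subr_ge0//; lra.
  have := incrl n s t ts ts' ltac:(lra).
  rewrite distrC (ler0_norm (_ : s - t <= 0)) ?subr_le0// opprB; lra.
move=> eps eps0; have mu0 : 0 < mu by mulra.
have [N0 N00 HN0] := wvan_bounded mu01 (let: And4 _ uc' _ _ := Hu 0%N in uc').
have [T0|T0] := ltP 0 T; last by exists 1 => // t; lra.
have C0 : 0 <= C.
  have := HC 0%N T ltac:(lra); rewrite halfX0 mulr1; apply: le_trans.
  by rewrite mulr_ge0// wt_ge0.
pose N := N0 + 4 * C; have N0' : 0 <= N by rewrite /N; lra.
have HN m : wbd mu T (u'_ m) N.
  move=> t tT; have -> : u'_ m t = u'_ 0%N t + ((u' t - u'_ 0%N t) - (u' t - u'_ m t)).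
    by zmod.
  apply: le_trans (ler_wpM2l (wt_ge0 mu t) (ler_normD _ _)) _.
  have := ler_wpM2l (wt_ge0 mu t) (ler_normB (u' t - u'_ 0%N t) (u' t - u'_ m t)).
  have := HN0 t tT; have := ulim' 0%N t tT; have := ulim' m t tT.
  have := ler_wpM2l C0 (halfX_mono (R := R) (leq0n m)); rewrite halfX0 /N; lra.
have eN : 0 < eps / 2 / (N / mu + 1).
  by rewrite !divr_gt0//; have := divr_ge0 N0' (ltW mu0); lra.
have [d d0 Hd] := powR_small mu0 eN.
exists d => // t tT td; apply/ler_addgt0Pr => eta eta0.
have w0 : 0 < wt mu t by apply: wt_gt0; lra.
have [n1 Hn1] := Hx (eta / 2) ltac:(lra).
have eta20 : 0 < eta / 2 by lra.
have [n2 Hn2] := halfX_small (c * (2 * (C / wt mu t))) eta20.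
pose m := maxn n1 n2.
have h2 : halfX m <= halfX n2 :> R by apply: halfX_mono; rewrite leq_maxr.
have -> : e (u t) - x = (e (u t) - e (u_ m t)) + (e (u_ m t) - x_ m) + (x_ m - x) by zmod.
apply: le_trans (ler_normD _ _) _.
have := Hn1 m (leq_maxl _ _).
have := ler_normD (e (u t) - e (u_ m t)) (e (u_ m t) - x_ m).
have := evol_drift (Hu m) tT (wbd_restrict (T := T) (T' := t) ltac:(lra) (HN m)).
have : N / mu * t `^ mu <= eps / 2.
  have := Hd t ltac:(lra) td; rewrite ler_pdivlMr; last first.
    by have := divr_ge0 N0' (ltW mu0); lra.
  by have := powR_ge0 t mu; lra.
have : `|e (u t) - e (u_ m t)| <= eta / 2.
  rewrite -linearB; apply: le_trans (ec _) _.
  apply: le_trans Hn2; rewrite -mulrA ler_wpM2l ?(ltW c0)//.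
  apply: (@le_trans _ _ (2 * (C / wt mu t) * halfX m)); last first.
    by rewrite ler_wpM2l// mulr_ge0// divr_ge0// wt_ge0.
  have -> : 2 * (C / wt mu t) * halfX m = 2 * C * halfX m / wt mu t by ring.
  by rewrite ler_pdivlMr// mulrC; exact: ulim m t tT.
lra.
Qed.

End evolution.

(** * Continuous interpolation spaces *)

Section interpolation_spaces.
Context {R : realType} {E0 E1 : completeNormedModType R}.
Variable e : dense_embedding E0 E1.

Definition emb (theta : R) (b : E1) : cinterp e theta := to_cinterp e theta (e b).

Lemma embE theta b : to_cinterp e theta (e b) = emb theta b.
Proof. by []. Qed.

Lemma val_emb theta b : 0 <= theta <= 1 -> \val (emb theta b) = e b.
Proof. by move=> th; rewrite to_cinterpK// embed_cinterp. Qed.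

Lemma cinterp_norm_le theta (x : cinterp e theta) c :
  (forall t, 0 < t -> Kfun e t (\val x) <= t `^ theta * c) -> `|x| <= c.
Proof.
move=> H; rewrite -lee_fin [(`|x|)%:E]cinterp_normE.
apply: Knorm_le => t t0; rewrite lee_fin powRN mulrC ler_pdivrMr ?powR_gt0//.
by rewrite mulrC H.
Qed.

Lemma Kfun_le_cinterp theta (x : cinterp e theta) t : 0 < t ->
  Kfun e t (\val x) <= t `^ theta * `|x|.
Proof.
move=> t0; have := Knorm_ub e theta (\val x) t0.
rewrite -cinterp_normE lee_fin powRN mulrC ler_pdivrMr ?powR_gt0//.
by rewrite mulrC.
Qed.

Lemma Kfun_embed_cinterp theta b t : 0 <= theta <= 1 -> 0 < t ->
  Kfun e t (e b) <= t `^ theta * `|emb theta b|.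
Proof. by move=> th t0; rewrite -(val_emb b th) Kfun_le_cinterp. Qed.

Lemma KfunN t x : 0 <= t -> Kfun e t (- x) = Kfun e t x.
Proof.
move=> t0; apply/eqP; rewrite eq_le; apply/andP; split.
  by have := KfunZ_le e (-1) x t0; rewrite scaleN1r normrN1 mul1r.
by have := KfunZ_le e (-1) (- x) t0; rewrite scaleN1r opprK normrN1 mul1r.
Qed.

Lemma valB theta (x y : cinterp e theta) : \val (x - y) = \val x - \val y.
Proof. exact: raddfB. Qed.

Lemma embB theta a b : 0 <= theta <= 1 ->
  emb theta (a - b) = emb theta a - emb theta b.
Proof.
move=> th; apply: val_inj.
by rewrite valB !val_emb// linearB.
Qed.

Lemma emb_bounded theta : 0 <= theta <= 1 ->
  exists2 c, 0 < c & forall b, `|emb theta b| <= c * `|b|.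
Proof.
move=> th; have [c c0 ec] := embed_bound e; exists (1 + c) => [|b]; first lra.
apply: cinterp_norm_le => t t0; rewrite val_emb//.
have b0 := normr_ge0 b; have cb0 : 0 <= c * `|b| by rewrite mulr_ge0// ltW.
have [t1|/ltW t1] := leP t 1.
  apply: le_trans (Kfun_embed_le e b (ltW t0)) _.
  apply: (@le_trans _ _ (t `^ theta * `|b|)); last first.
    by rewrite ler_wpM2l ?powR_ge0//; lra.
  rewrite ler_wpM2r// -[leLHS](powRr1 (ltW t0)) ger_powR ?t0//.
  by case/andP: th.
apply: le_trans (Kfun_le_norm e (e b) (ltW t0)) _.
apply: le_trans (ec b) _; apply: (@le_trans _ _ (1 * ((1 + c) * `|b|))); first lra.
rewrite ler_wpM2r//; first by lra.
by rewrite -[leLHS](powRr0 t) ler_powR//; case/andP: th.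
Qed.

Lemma cinterp_norm_val theta :
  exists2 c, 0 < c & forall x : cinterp e theta, `|\val x| <= c * `|x|.
Proof.
have [c c0 H] := norm_le_Knorm e; exists c => // x.
by have := H theta (\val x); rewrite -cinterp_normE -EFinM lee_fin.
Qed.

Lemma emb_dense theta (x : cinterp e theta) eps : 0 <= theta <= 1 -> 0 < eps ->
  exists b, `|emb theta b - x| <= eps.
Proof.
move=> th eps0; have [_ /(_ eps eps0)[b Hb]] := set_mem (valP x).
exists b; rewrite distrC ltW// -lte_fin [(`|_|)%:E]cinterp_normE.
by rewrite valB val_emb.
Qed.

(** The K-functional of an element of E_theta is o(t^theta) at 0, because it is
    O(t) on the dense subspace E1. *)
Lemma Kfun_vanish theta (x : cinterp e theta) eps : 0 <= theta < 1 -> 0 < eps ->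
  exists2 d, 0 < d & forall t, 0 < t -> t < d -> Kfun e t (\val x) <= t `^ theta * eps.
Proof.
move=> th eps0; have e20 : 0 < eps / 2 by lra.
have th1 : 0 <= theta <= 1 by lra.
have [b Hb] := emb_dense x th1 e20.
have b1 : 0 < `|b| + 1 by rewrite ltr_wpDl.
have [d d0 Hd] := @powR_small R (1 - theta) (eps / 2 / (`|b| + 1)) ltac:(lra)
  (divr_gt0 e20 b1).
exists d => // t t0 td.
have -> : \val x = - \val (emb theta b - x) + e b.
  by rewrite valB val_emb// opprB subrK.
apply: le_trans (KfunD e _ _ (ltW t0)) _; rewrite KfunN ?(ltW t0)//.
have H1 := le_trans (Kfun_le_cinterp (emb theta b - x) t0)
   (ler_wpM2l (powR_ge0 t theta) Hb).
have H2 : Kfun e t (e b) <= t `^ theta * (eps / 2).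
  apply: le_trans (Kfun_embed_le e b (ltW t0)) _.
  have -> : t * `|b| = t `^ theta * (t `^ (1 - theta) * `|b|).
    by rewrite mulrA powRBM// addrC subrK powRr1// ltW.
  rewrite ler_wpM2l ?powR_ge0//; have := Hd t t0 td; rewrite ler_pdivlMr//.
  by have := powR_ge0 t (1 - theta); lra.
lra.
Qed.

(** Completeness, for arbitrary filters: the limit in E0 of a Cauchy filter is its
    limit in E_theta because the K-functional is continuous in E0. *)
Lemma cinterp_complete (theta : R) (T : Type) (F : set_system T)
    (u : T -> cinterp e theta) : ProperFilter F ->
  (forall eps, 0 < eps -> exists A, F A /\ forall s t, A s -> A t -> `|u s - u t| <= eps) ->
  exists x, forall eps, 0 < eps -> F [set s | `|u s - x| <= eps].
Proof.
move=> FF cu; have [c c0 Hc] := cinterp_norm_val theta.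
have cvu : cvg (\val (u s) @[s --> F]).
  apply/cauchy_cvgP/cauchyP => eps eps0.
  have ec0 : 0 < eps / 2 / c by rewrite !divr_gt0.
  have [A [FA HA]] := cu _ ec0; have [s As] := filter_ex FA.
  exists (\val (u s)); rewrite /=; apply: filterS FA => t At.
  rewrite -ball_normE /ball_/= -valB; apply: le_lt_trans (Hc _) _.
  have := HA s t As At; rewrite ler_pdivlMr//; lra.
pose y := lim (\val (u s) @[s --> F]).
have yP eps : 0 < eps -> F [set s | `|\val (u s) - y| <= eps].
  move=> eps0; move/cvgrPdist_le: cvu => /(_ _ eps0).
  by apply: filterS => s; rewrite distrC.
have key A eps : F A -> (forall s t, A s -> A t -> `|u s - u t| <= eps) ->
    forall s, A s -> (Knorm e theta (\val (u s) - y)%R <= eps%:E)%E.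
  move=> FA HA s As; apply: Knorm_le => t t0; rewrite lee_fin.
  rewrite powRN mulrC ler_pdivrMr ?powR_gt0//; apply/ler_addgt0Pr => eta eta0.
  have [s' [As' Hs']] := filter_ex (filterI FA (yP _ eta0)).
  have -> : \val (u s) - y = \val (u s - u s') + (\val (u s') - y).
    by rewrite valB addrA subrK.
  apply: le_trans (KfunD e _ _ (ltW t0)) _; apply: lerD; last first.
    exact: le_trans (Kfun_le_norm e _ (ltW t0)) Hs'.
  apply: le_trans (Kfun_le_cinterp _ t0) _; rewrite mulrC ler_wpM2r ?powR_ge0//.
  exact: HA.
have yin : y \in cinterp_pred e theta.
  have [A [FA HA]] := cu 1 ltr01; have [s As] := filter_ex FA.
  apply/mem_set; split=> [|eps eps0] /=.
    have -> : y = - (\val (u s) - y) + \val (u s) by rewrite opprB subrK.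
    apply: le_lt_trans (KnormD _ _ _ _) _; rewrite lte_add_pinfty//.
      rewrite -scaleN1r KnormZ normrN1 mul1e.
      exact: le_lt_trans (key _ _ FA HA s As) (ltry _).
    by rewrite -cinterp_normE ltry.
  have e20 : 0 < eps / 2 by lra.
  have [A' [FA' HA']] := cu _ e20; have [s' As'] := filter_ex FA'.
  have [_ /(_ _ e20)[b Hb]] := set_mem (valP (u s')).
  exists b; have -> : y - e b = (-1) *: (\val (u s') - y) + (\val (u s') - e b).
    by rewrite scaleN1r; zmod.
  apply: le_lt_trans (KnormD _ _ _ _) _; rewrite KnormZ normrN1 mul1e.
  rewrite [eps]splitr EFinD; apply: lee_ltD => //.
    by rewrite ge0_fin_numE ?Knorm_ge0//; apply: le_lt_trans (key _ _ FA' HA' s' As') (ltry _).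
  exact: (key _ _ FA' HA' s' As').
exists (exist _ y yin) => eps eps0; have [A [FA HA]] := cu _ eps0.
apply: filterS (FA) => s As /=; rewrite -lee_fin [(`|_|)%:E]cinterp_normE valB.
exact: (key A eps FA HA s As).
Qed.

Lemma cinterp_lim_rate (theta : R) (x : nat -> cinterp e theta) C :
  (forall n, `|x n.+1 - x n| <= C * halfX n) ->
  exists l, forall n, `|l - x n| <= 2 * C * halfX n.
Proof.
move=> Hx; have tail := geometric_steps Hx.
have [|l Hl] := @cinterp_complete theta nat \oo x _.
  move=> eps eps0; have e20 : 0 < eps / 2 by lra.
  have [n Hn] := halfX_small (2 * C) e20.
  exists [set m | (n <= m)%N]; split; first exact: nbhs_infty_ge.
  move=> s t ns nt; rewrite -[x s](subrK (x n)) -addrA.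
  apply: le_trans (ler_normD _ _) _; rewrite (distrC (x n)).
  by have := tail n s ns; have := tail n t nt; lra.
exists l => n; apply/ler_addgt0Pr => eps eps0.
have [m [Hm nm]] : exists m, `|x m - l| <= eps /\ (n <= m)%N.
  have [m [Hm nm]] := filter_ex (filterI (Hl _ eps0) (nbhs_infty_ge n)).
  by exists m.
rewrite -[l](subrK (x m)) -addrA; apply: le_trans (ler_normD _ _) _.
rewrite [leRHS]addrC; apply: lerD; last exact: tail.
by rewrite distrC; exact: Hm.
Qed.

Section interpolation_inequality.
Variable mu : R.
Hypothesis mu01 : 0 < mu < 1.

Lemma Kfun_embed_wt b s t N : 0 < s -> s <= t -> wt mu t * `|b| <= N ->
  Kfun e s (e b) <= s `^ mu * N.
Proof.
move=> s0 st bN; apply: le_trans (Kfun_embed_le e b (ltW s0)) _.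
have -> : s * `|b| = s `^ mu * (wt mu s * `|b|).
  by rewrite mulrA powRBM// addrC subrK powRr1// ltW.
rewrite ler_wpM2l ?powR_ge0//; apply: le_trans bN.
by rewrite ler_wpM2r//; apply: wt_mono => //; exact: ltW.
Qed.

(** At parameters s <= t the K-functional of b is bounded by means of |b|_(E1), at
    s >= t by means of the distance from b to x in E0. *)
Lemma trace_le (x : cinterp e mu) b t N : 0 < t -> wt mu t * `|b| <= N ->
  `|e b - \val x| <= N / mu * t `^ mu -> `|emb mu b| <= N / mu + `|x|.
Proof.
move=> t0 bN bx; have mu0 : 0 < mu by mulra.
have N0 : 0 <= N by apply: le_trans bN; rewrite mulr_ge0// wt_ge0.
have NN : N <= N / mu by rewrite ler_pdivlMr// ler_piMr//; mulra.
apply: cinterp_norm_le => s s0; rewrite val_emb; last by mulra.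
rewrite mulrDr; have [st|/ltW ts] := leP s t.
  apply: (@le_trans _ _ (s `^ mu * N)); last first.
    apply: (@le_trans _ _ (s `^ mu * (N / mu))); first by rewrite ler_wpM2l ?powR_ge0.
    by rewrite lerDl mulr_ge0// powR_ge0.
  exact: Kfun_embed_wt st bN.
rewrite -[e b](subrK (\val x)); apply: le_trans (KfunD e _ _ (ltW s0)) _.
apply: lerD; last exact: Kfun_le_cinterp.
apply: le_trans (Kfun_le_norm e _ (ltW s0)) _; apply: le_trans bx _.
rewrite mulrC ler_wpM2r ?divr_ge0 ?(ltW mu0)//.
by rewrite ge0_ler_powR ?nnegrE ?(ltW mu0)// ?(ltW t0) ?(ltW s0).
Qed.

(** The same splitting for b - x; the part of x at parameters s <= t is bounded by
    w, which is small for small t by [Kfun_vanish]. *)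
Lemma trace_dist (x : cinterp e mu) b t N w : 0 < t -> wt mu t * `|b| <= N ->
  `|e b - \val x| <= N / mu * t `^ mu ->
  (forall s, 0 < s <= t -> Kfun e s (\val x) <= s `^ mu * w) -> 0 <= w ->
  `|emb mu b - x| <= N / mu + w.
Proof.
move=> t0 bN bx Hw w0; have mu0 : 0 < mu by mulra.
have N0 : 0 <= N by apply: le_trans bN; rewrite mulr_ge0// wt_ge0.
have NN : N <= N / mu by rewrite ler_pdivlMr// ler_piMr//; mulra.
apply: cinterp_norm_le => s s0; rewrite valB val_emb; last by mulra.
have [st|/ltW ts] := leP s t.
  apply: le_trans (KfunD e _ _ (ltW s0)) _; rewrite KfunN ?(ltW s0)//.
  rewrite mulrDr; apply: lerD; last by apply: Hw; rewrite s0.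
  apply: (@le_trans _ _ (s `^ mu * N)); last by rewrite ler_wpM2l ?powR_ge0.
  exact: Kfun_embed_wt st bN.
apply: le_trans (Kfun_le_norm e _ (ltW s0)) _; apply: le_trans bx _.
rewrite mulrC; apply: ler_pM; rewrite ?powR_ge0 ?divr_ge0 ?(ltW mu0)//; last by lra.
by rewrite ge0_ler_powR ?nnegrE ?(ltW mu0)// ?(ltW t0) ?(ltW s0).
Qed.

(** Interpolation between E_mu and E_1, with the weights that make both sides
    homogeneous in t. *)
Lemma interpolation_le theta b t p q : mu <= theta <= 1 -> 0 < t ->
  0 <= p -> 0 <= q -> `|emb mu b| <= p -> wt mu t * `|b| <= q ->
  t `^ (theta - mu) * `|emb theta b| <=
    p `^ (1 - (theta - mu) / (1 - mu)) * q `^ ((theta - mu) / (1 - mu)).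
Proof.
move=> th t0 p0 q0 bp bq; set l := (theta - mu) / (1 - mu).
have mu1 : 0 < 1 - mu by mulra.
have l0 : 0 <= l by rewrite divr_ge0//; lra.
have l1 : l <= 1 by rewrite ler_pdivrMr// mul1r; lra.
have lE : l * (1 - mu) = theta - mu by rewrite divfK// gt_eqF.
rewrite mulrC -ler_pdivlMr ?powR_gt0//; apply: cinterp_norm_le => s s0.
rewrite val_emb; last by mulra.
set K := Kfun e s (e b); have K0 : 0 <= K by rewrite Kfun_ge0// ltW.
have Kp : K <= s `^ mu * p.
  have mu01' : 0 <= mu <= 1 by mulra.
  apply: le_trans (Kfun_embed_cinterp b mu01' s0) _.
  by rewrite ler_wpM2l ?powR_ge0.
have Kq : K <= s * (t `^ (mu - 1) * q).
  apply: le_trans (Kfun_embed_le e b (ltW s0)) _; rewrite ler_wpM2l ?(ltW s0)//.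
  rewrite -(ler_pM2l (wt_gt0 mu t0)); apply: le_trans bq _.
  rewrite mulrA powRBM// (_ : 1 - mu + _ = 0); last by ring.
  by rewrite powRr0 mul1r.
rewrite -[leLHS](powR_split l K0).
apply: (@le_trans _ _ ((s `^ mu * p) `^ (1 - l) * (s * (t `^ (mu - 1) * q)) `^ l)).
  have ql0 : 0 <= s * (t `^ (mu - 1) * q) by apply: le_trans K0 Kq.
  have pl0 : 0 <= s `^ mu * p by apply: le_trans K0 Kp.
  apply: ler_pM; rewrite ?powR_ge0//; apply: ge0_ler_powR; rewrite ?nnegrE//.
  by lra.
rewrite !powRM ?powR_ge0 ?(ltW s0) ?mulr_ge0 ?powR_ge0// -!powRrM.
have -> : s `^ (mu * (1 - l)) * p `^ (1 - l) * (s `^ l * (t `^ ((mu - 1) * l) * q `^ l)) =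
  s `^ (mu * (1 - l)) * s `^ l * (p `^ (1 - l) * q `^ l * t `^ ((mu - 1) * l)) by ring.
rewrite powRBM// (_ : mu * (1 - l) + l = theta); last by rewrite -[theta](subrK mu) -lE; ring.
rewrite (_ : (mu - 1) * l = - (theta - mu)); last by rewrite -lE; ring.
by rewrite powRN.
Qed.

End interpolation_inequality.
End interpolation_spaces.

(* The hypotheses on points of an interpolation space are left out: deciding
   whether two of their norms agree would unfold the K-functional. *)
Ltac clra :=
  repeat match goal with
    H : is_true ?P |- _ => match P with context [emb] => clear H end
  end; lra.

(** * Uniqueness for the linear problem on short intervals *)

Section shift.
Context {R : realType}.

Lemma has_deriv_comp (E : normedModType R) (D D' : set R) (Q : R -> E)
    (phi : R -> R) t c d : (forall s, D s -> D' (phi s)) -> D t ->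
  has_deriv D (phi : R -> R^o) t c -> has_deriv D' Q (phi t) d ->
  has_deriv D (Q \o phi) t (c *: d).
Proof.
move=> DD Dt Hp HQ eps eps0.
pose M := `|c| + 1 + `|d|; have M0 : 0 < M.
  by rewrite /M; have := normr_ge0 c; have := normr_ge0 d; lra.
have eM : 0 < eps / M by rewrite divr_gt0.
have [d1 d10 {}HQ] := HQ _ eM.
have [d2 d20 H2] := has_deriv_lip Hp ltr01.
have [d3 d30 H3] := Hp _ eM.
have d120 : 0 < d1 / 2 by lra.
have [d4 d40 H4] := has_deriv_cont Hp d120.
exists (Num.min d2 (Num.min d3 d4)) => [|s Ds]; rewrite !lt_min ?d20 ?d30//.
move=> /and3P[s2 s3 s4] /=.
have -> : Q (phi s) - Q (phi t) - (s - t) *: (c *: d) =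
  (Q (phi s) - Q (phi t) - (phi s - phi t) *: d) +
  (phi s - phi t - (s - t) * c) *: d by rewrite scalerA !scalerBl; zmod.
apply: le_trans (ler_normD _ _) _; rewrite normrZ.
have h1 : `|phi s - phi t| < d1 by apply: le_lt_trans (H4 s Ds s4) _; lra.
have k1 := HQ _ (DD s Ds) h1.
have {H3} : `|phi s - phi t - (s - t) * c| <= eps / M * `|s - t| := H3 s Ds s3.
move=> /(ler_wpM2r (normr_ge0 d)) k3.
have k2 := ler_wpM2l (ltW eM) (H2 s Ds s2).
have -> : eps * `|s - t| = eps / M * ((`|c| + 1) * `|s - t|) + eps / M * `|s - t| * `|d|.
  have -> : eps = eps / M * M by rewrite divfK ?gt_eqF.
  by rewrite mulfK ?gt_eqF// /M; ring.
by apply: lerD => //; apply: le_trans k1 k2.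
Qed.

Definition shift_ext (E : normedModType R) (a : R) (v : R -> E) (t : R) : E :=
  if t <= a then 0 else v (t - a).

Lemma shift_ext_cont (E : normedModType R) T a (v : R -> E) : 0 < a ->
  (forall t, 0 < t <= T -> cont_at (halfopen T) v t) ->
  (forall eps, 0 < eps -> exists2 d, 0 < d &
     forall t, 0 < t <= T -> t < d -> `|v t| <= eps) ->
  forall t, 0 < t <= a + T -> cont_at (halfopen (a + T)) (shift_ext a v) t.
Proof.
move=> a0 vc v0 t tT eps eps0; rewrite /shift_ext.
have [ta|at_|->] := ltgtP t a.
- exists (a - t) => [|s sT]; first by lra.
  by rewrite ltr_distl => st; rewrite ifT ?subrr ?normr0 ?ltW//; lra.
- have [d d0 Hd] := vc (t - a) ltac:(lra) eps eps0.
  exists (Num.min d (t - a)) => [|s /= sT]; rewrite lt_min; first by lra.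
  move=> /andP[sd]; rewrite ltr_distl => st.
  rewrite ifF; last by apply/negbTE; rewrite -ltNge; lra.
  by apply: Hd => /=; [lra|rewrite (_ : s - a - (t - a) = s - t)//; ring].
- have [d d0 Hd] := v0 eps eps0; exists d => // s /= sT.
  rewrite ltr_distl => sd; rewrite subr0.
  by case: (leP s a) => sa; [rewrite normr0 ltW|apply: Hd; lra].
Qed.

Lemma shift_ext_wvan (mu : R) (E : normedModType R) T a (v : R -> E) : 0 < a ->
  (forall t, 0 < t <= T -> cont_at (halfopen T) v t) ->
  (forall eps, 0 < eps -> exists2 d, 0 < d &
     forall t, 0 < t <= T -> t < d -> `|v t| <= eps) ->
  wvan mu (a + T) (shift_ext a v).
Proof.
move=> a0 vc v0; split; first exact: shift_ext_cont.
move=> eps eps0; exists a => // t tT ta.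
by rewrite /shift_ext (ltW ta) normr0 mulr0 ltW.
Qed.

Lemma shift_ext_deriv (E : normedModType R) T a (v v' : R -> E) : 0 < a ->
  (forall t, 0 < t <= T -> has_deriv (halfopen T) v t (v' t)) ->
  (forall eps, 0 < eps -> exists2 d, 0 < d &
     forall t, 0 < t <= T -> t < d -> `|v t| <= eps) ->
  (forall eps, 0 < eps -> exists2 d, 0 < d &
     forall t, 0 < t <= T -> t < d -> `|v' t| <= eps) ->
  forall t, 0 < t <= a + T ->
    has_deriv (halfopen (a + T)) (shift_ext a v) t (shift_ext a v' t).
Proof.
move=> a0 vd v0 v'0 t tT eps eps0; rewrite /shift_ext.
have [ta|at_|->] := ltgtP t a.
- exists (a - t) => [|s sT]; first by lra.
  rewrite ltr_distl => st; rewrite ifT; last by lra.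
  by rewrite scaler0 !subr0 normr0 mulr_ge0// ltW.
- have [d d0 Hd] := vd (t - a) ltac:(lra) eps eps0.
  exists (Num.min d (t - a)) => [|s /= sT]; rewrite lt_min; first by lra.
  move=> /andP[sd]; rewrite ltr_distl => st.
  rewrite ifF; last by apply/negbTE; rewrite -ltNge; lra.
  have ss : s - a - (t - a) = s - t by ring.
  by have := Hd (s - a); rewrite /= ss; apply => //; lra.
- have [d d0 Hd] := v'0 eps eps0; exists d => // s /= sT.
  rewrite ltr_distl => sd; rewrite scaler0 !subr0.
  case: (leP s a) => sa; first by rewrite normr0 mulr_ge0// ltW.
  rewrite (gtr0_norm (_ : 0 < s - a)); last by lra.
  (* v vanishes at 0, so that the mean value inequality bounds it by its slope *)
  apply/ler_addgt0Pr => eta eta0; have [d' d'0 Hd'] := v0 eta eta0.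
  pose r := Num.min (s - a) (d' / 2).
  have r0 : 0 < r by rewrite lt_min; lra.
  have rs : r <= s - a by rewrite ge_min lexx.
  have rd : r < d' by rewrite gt_min; lra.
  rewrite -[v (s - a)](subrK (v r)); apply: le_trans (ler_normD _ _) _.
  apply: lerD; last by apply: Hd' => //; lra.
  apply: (@le_trans _ _ (eps * (s - a - r))); last by rewrite ler_wpM2l ?(ltW eps0)//; lra.
  apply: (mean_value_cst (g' := v')) => // x xr; split; last by apply: Hd; lra.
  by apply: (has_derivS (D := halfopen T)) => [y /=|]; [|apply: vd]; lra.
Qed.

End shift.

Section linear.
Context {R : realType} {E0 E1 : completeNormedModType R}.
Variables (e : dense_embedding E0 E1) (mu : R).
Hypothesis mu01 : 0 < mu < 1.

Definition lsol (B : E1 -> E0) T (f : R -> E0) x (u : R -> E1) (u' : R -> E0) :=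
  evol e mu T u u' x /\ forall t, 0 < t <= T -> u' t + B (u t) = f t.

(** The substitution t = r^(1/mu) turns the integrable singularity at 0 of an
    element of BC_(1-mu) into a continuous function vanishing at 0. *)
Lemma wvan_primitive (E : completeNormedModType R) T (v : R -> E) : 0 < T ->
  wvan mu T v -> exists V : R -> E,
    (forall t, 0 < t <= T -> has_deriv (halfopen T) V t (v t)) /\
    (forall eps, 0 < eps -> exists2 d, 0 < d &
       forall t, 0 < t <= T -> t < d -> `|V t| <= eps).
Proof.
move=> T0 [vc v0]; have mu0 : 0 < mu by mulra.
have k0 : 0 < mu^-1 by rewrite invr_gt0.
pose q (r : R) := if r <= 0 then 0 else
  mu^-1 *: (wt mu (r `^ mu^-1) *: v (r `^ mu^-1)).
pose b := T `^ mu; have b0 : 0 < b by apply: powR_gt0.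
have root r : 0 < r <= b -> 0 < r `^ mu^-1 <= T.
  move=> rb; rewrite powR_gt0/=; last by lra.
  rewrite -[leRHS](powRr1 (ltW T0)) -(divff (lt0r_neq0 mu0)) powRrM.
  by rewrite ge0_ler_powR ?nnegrE ?powR_ge0 ?(ltW k0)// -/b; lra.
have qc t : 0 <= t <= b -> cont_at [set s | 0 <= s <= b] q t.
  move=> tb; have [t0|t0] := ltP 0 t; last first.
    have -> : t = 0 by lra.
    move=> eps eps0; have [d d0 Hd] := v0 (eps * mu) (mulr_gt0 eps0 mu0).
    exists (d `^ mu) => [|s /= sb]; first exact: powR_gt0.
    rewrite subr0 => sd; rewrite /q lexx subr0; case: (leP s 0) => s0.
      by rewrite normr0 ltW.
    rewrite !normrZ (gtr0_norm k0) (ger0_norm (wt_ge0 _ _)) mulrC ler_pdivrMr//.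
    apply: Hd; first by apply: root; lra.
    rewrite -[ltRHS](powRr1 (ltW d0)) -(divff (lt0r_neq0 mu0)) powRrM.
    move: sd; rewrite gtr0_norm// => sd.
    by rewrite gt0_ltr_powR ?nnegrE ?powR_ge0//; lra.
  apply: (cont_at_local (D := [set s | 0 < s <= b]) (r := t)
    (v := fun r => mu^-1 *: (wt mu (r `^ mu^-1) *: v (r `^ mu^-1)))) => //=.
  - by lra.
  - by move=> s sb; rewrite ltr_distl; lra.
  - by move=> s sb _; rewrite /q ifF//; apply/negbTE; rewrite -ltNge; lra.
  apply: (cont_at_linear (B := *:%R mu^-1) (c := `|mu^-1|)) => [x|].
    by rewrite normrZ.
  have tT := root t ltac:(lra).
  have wc : cont_at (halfopen T) (fun s => wt mu s *: v s) (t `^ mu^-1).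
    apply/cont_at_cvgP.
    apply: (@cvgZ _ _ _ (within (halfopen T) (nbhs (t `^ mu^-1))) _
      (fun s : R => s `^ (1 - mu)) v).
      by apply/cont_at_cvgP; apply: powR_cont_at; lra.
    by apply/cont_at_cvgP; exact: vc.
  move=> eps eps0; have [d d0 Hd] := wc eps eps0.
  have d20 : 0 < d / 2 by lra.
  have [d' d'0 Hd'] := powR_cont_at mu^-1 [set s | 0 < s <= b] t0 d20.
  exists d' => // s sb sd; apply: Hd => /=; first exact: root.
  by apply: le_lt_trans (Hd' s sb sd) _; lra.
have [Q Q0 HQ] := primitive_exists (ltW b0) qc.
exists (fun t => Q (t `^ mu)); split=> [t tT|eps eps0].
  have t0 : 0 < t by lra.
  have pb s : halfopen T s -> 0 <= s `^ mu <= b.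
    move=> /= sT; rewrite powR_ge0 ge0_ler_powR ?nnegrE//; lra.
  have := has_deriv_comp (D := halfopen T) pb tT (powR_has_deriv mu (halfopen T) t0)
     (HQ _ (pb t tT)).
  rewrite /q ifF; last by apply/negbTE; rewrite -ltNge powR_gt0.
  rewrite -powRrM divff ?gt_eqF// powRr1 ?(ltW t0)// !scalerA.
  rewrite (_ : mu * t `^ (mu - 1) * mu^-1 * wt mu t = 1) ?scale1r//.
  rewrite (mulrAC mu) mulfV ?gt_eqF// mul1r powRBM// (_ : mu - 1 + _ = 0) ?powRr0//.
  by ring.
have b00 : 0 <= (0 : R) <= b by lra.
have [d d0 Hd] := has_deriv_cont (HQ 0 b00) eps0.
have d20 : 0 < d / 2 by lra.
have [d' d'0 Hd'] := powR_small mu0 d20.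
exists d' => // t tT td; have := Hd (t `^ mu); rewrite Q0 !subr0; apply => /=.
  by rewrite powR_ge0 ge0_ler_powR ?nnegrE//; lra.
by rewrite ger0_norm ?powR_ge0//; have := Hd' t ltac:(lra) td; lra.
Qed.

Lemma lsolB (B : {linear E1 -> E0}) T f g x y u u' v v' :
  lsol B T f x u u' -> lsol B T g y v v' ->
  lsol B T (fun t => f t - g t) (x - y) (fun t => u t - v t) (fun t => u' t - v' t).
Proof.
move=> [uE uf] [vE vg]; split; first exact: evolB.
by move=> t tT; rewrite -uf// -vg// linearB; zmod.
Qed.

Lemma lsolD (B : {linear E1 -> E0}) T f g x y u u' v v' :
  lsol B T f x u u' -> lsol B T g y v v' ->
  lsol B T (fun t => f t + g t) (x + y) (fun t => u t + v t) (fun t => u' t + v' t).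
Proof.
move=> [uE uf] [vE vg]; split; first exact: evolD.
by move=> t tT; rewrite -uf// -vg// linearD; zmod.
Qed.

Lemma lsolZ (B : {linear E1 -> E0}) T f x u u' (k : R) :
  lsol B T f x u u' ->
  lsol B T (fun t => k *: f t) (k *: x) (fun t => k *: u t) (fun t => k *: u' t).
Proof.
move=> [uE uf]; split; first exact: evolZ.
by move=> t tT; rewrite -uf// linearZ scalerDr.
Qed.

Lemma lsol_restrict (B : {linear E1 -> E0}) T T' f x u u' : T' <= T ->
  lsol B T f x u u' -> lsol B T' f x u u'.
Proof.
move=> TT [uE uf]; split; first exact: evol_restrict TT uE.
by move=> t tT; apply: uf; lra.
Qed.

Lemma lsol0 (B : {linear E1 -> E0}) T : lsol B T (fun=> 0) 0 (fun=> 0) (fun=> 0).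
Proof.
split=> [|t _]; last by rewrite linear0 addr0.
by have := evol_cst e mu01 T 0; rewrite linear0.
Qed.

(** The primitive V of a solution of the homogeneous problem that starts at 0
    solves the homogeneous problem as well, and vanishes at 0 in the norm of E1;
    preceded by zero, it is a solution on a longer interval. *)
Lemma lsol_unique0 (B : {linear E1 -> E0}) c T0 :
  (forall b, `|B b| <= c * `|b|) ->
  (forall u u', lsol B T0 (fun=> 0) 0 u u' -> forall t, 0 < t <= T0 -> u t = 0) ->
  forall T u u', 0 < T <= T0 -> lsol B T (fun=> 0) 0 u u' ->
  forall t, 0 < t <= T -> u t = 0.
Proof.
move=> Bc uniq T u u' TT0 uS.
have [TE|TE] := eqVneq T T0; first by rewrite TE in uS *; exact: uniq uS.
have [[uc uc' ud u0] uB] := uS.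
have a0 : 0 < T0 - T by have : T != T0 := TE; rewrite neq_lt; lra.
have T1 : 0 < T by lra.
have [V [Vd V0]] := wvan_primitive T1 uc.
have [ce ce0 ec] := embed_bound e.
have eu0 eps : 0 < eps -> exists2 d, 0 < d & forall t, 0 < t <= T -> t < d ->
    `|e (u t)| <= eps.
  by move=> /u0[d d0 Hd]; exists d => // t tT td; have := Hd t tT td; rewrite subr0.
have BVu t : 0 < t <= T -> e (u t) + B (V t) = 0.
  move=> tT; apply/eqP; rewrite -normr_le0; apply/ler_addgt0Pr => eps eps0.
  have e20 : 0 < eps / 2 by lra.
  have [d1 d10 H1] := eu0 _ e20.
  have cc : 0 < `|c| + 1 by rewrite ltr_wpDl.
  have [d2 d20 H2] := V0 _ (divr_gt0 e20 cc).
  pose r := Num.min t (Num.min (d1 / 2) (d2 / 2)).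
  have r0 : 0 < r by rewrite !lt_min; lra.
  have rt : r <= t by rewrite ge_min lexx.
  have r1 : r < d1 by rewrite !gt_min; lra.
  have r2 : r < d2 by rewrite !gt_min; lra.
  rewrite add0r -[e (u t) + _](subrK (e (u r) + B (V r))).
  apply: le_trans (ler_normD _ _) _.
  have -> : `|e (u t) + B (V t) - (e (u r) + B (V r))| = 0.
    apply/eqP; rewrite -normr_le0 normr_id -[leRHS](mul0r (t - r)).
    apply: (mean_value_cst (g := fun t => e (u t) + B (V t))
      (g' := fun t => u' t + B (u t))) => // s sr.
    split; last by rewrite uB ?normr0//; lra.
    apply: has_derivD.
      by apply: (has_derivS (D := halfopen T)) => [y /=|]; [|apply: ud]; lra.
    apply: (has_deriv_linear (B := B) Bc).
    by apply: (has_derivS (D := halfopen T)) => [y /=|]; [|apply: Vd]; lra.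
  rewrite add0r; apply: le_trans (ler_normD _ _) _.
  have := H1 r ltac:(lra) r1; have := H2 r ltac:(lra) r2; rewrite ler_pdivlMr//.
  have := Bc (V r); have := ler_wpM2r (normr_ge0 (V r)) (ler_norm c).
  have := normr_ge0 (V r); lra.
pose Y := shift_ext (T0 - T) V; pose Y' := shift_ext (T0 - T) (e \o u).
have TT : T0 - T + T = T0 by rewrite subrK.
have YS : lsol B T0 (fun=> 0) 0 Y Y'.
  split; last first.
    move=> t tT; rewrite /Y /Y' /shift_ext; case: (leP t (T0 - T)) => ta.
      by rewrite linear0 addr0.
    by rewrite /= BVu//; lra.
  rewrite -[X in evol _ _ X]TT; split.
  - apply: shift_ext_wvan a0 _ V0 => t tT; exact: has_deriv_cont (Vd t tT).
  - apply: shift_ext_wvan a0 _ eu0 => t tT; exact: has_deriv_cont (ud t tT).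
  - move=> t tT; have eVd s : 0 < s <= T -> has_deriv (halfopen T) (e \o V) s ((e \o u) s).
      by move=> sT; apply: has_deriv_linear ec _; exact: Vd.
    have eV0 eps : 0 < eps -> exists2 d, 0 < d & forall t, 0 < t <= T -> t < d ->
        `|(e \o V) t| <= eps.
      move=> eps0; have [d d0 Hd] := V0 (eps / ce) (divr_gt0 eps0 ce0).
      exists d => // s sT sd; apply: le_trans (ec _) _.
      by rewrite mulrC -ler_pdivlMr//; exact: Hd.
    have := shift_ext_deriv a0 eVd eV0 eu0 tT.
    apply: has_deriv_local ltr01 tT _ _ => // s _ _.
    by rewrite /Y /shift_ext /=; case: ifP => // _; rewrite linear0.
  - move=> eps eps0; exists (T0 - T) => // t _ ta.
    by rewrite /Y /shift_ext (ltW ta) linear0 subr0 normr0 ltW.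
have V00 t : 0 < t <= T -> V t = 0.
  move=> tT; have := uniq Y Y' YS (t + (T0 - T)) ltac:(lra).
  by rewrite /Y /shift_ext ifF ?addrK//; apply/negbTE; rewrite -ltNge; lra.
move=> t tT; apply: (has_deriv_unique tT (Vd t tT)).
apply: (has_deriv_local (D := halfopen T) (v := fun=> 0) ltr01) => //.
  by move=> s sT _; rewrite V00.
by move=> eps eps0; exists 1 => // s _ _; rewrite subrr scaler0 subrr normr0 mulr_ge0// ltW.
Qed.

End linear.

(** * Boundedness of the solution operator *)

Lemma dependent_choice_nat (T : Type) (P : nat -> T -> Prop)
    (S : nat -> T -> T -> Prop) (x0 : T) : P 0%N x0 ->
  (forall n x, P n x -> exists2 y, P n.+1 y & S n x y) ->
  exists f : nat -> T, f 0%N = x0 /\ forall n, P n (f n) /\ S n (f n) (f n.+1).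
Proof.
move=> P0 PS.
have /choice[g Hg] : forall nx : nat * T, exists y, P nx.1 nx.2 ->
    P nx.1.+1 y /\ S nx.1 nx.2 y.
  move=> [n x]; have [/= /PS[y Py Sy]|nP] := pselect (P n x); first by exists y.
  by exists x0.
pose f := fix f n := if n is n'.+1 then g (n', f n') else x0.
have Pf n : P n (f n) by elim: n => //= n IH; have [] := Hg (n, f n) IH.
by exists f; split=> // n; split=> //; have [] := Hg (n, f n) (Pf n).
Qed.

(** q is the norm of a Banach space D, and p a seminorm on it that is subadditive
    for the q-convergent series whose p-values decay geometrically. *)
Section zabreiko.
Context {R : realType} {Y : lmodType R}.
Variables (D : set Y) (q p : Y -> R).
Hypotheses (DD : forall x y, D x -> D y -> D (x + y))
  (DZ : forall k x, D x -> D (k *: x))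
  (q0 : forall x, D x -> 0 <= q x)
  (qD : forall x y, D x -> D y -> q (x + y) <= q x + q y)
  (qZ : forall k x, D x -> q (k *: x) <= `|k| * q x)
  (pD : forall x y, D x -> D y -> p (x + y) <= p x + p y)
  (pZ : forall k x, D x -> p (k *: x) <= `|k| * p x).
Hypothesis q_complete : forall (s : nat -> Y) C, (forall n, D (s n)) ->
  (forall n, q (s n.+1 - s n) <= C * halfX n) ->
  exists2 y, D y & forall n, q (y - s n) <= 4 * C * halfX n.
Hypothesis p_countably_subadditive : forall (s : nat -> Y) y C C',
  s 0%N = 0 -> (forall n, D (s n)) -> D y ->
  (forall n, q (y - s n) <= C' * halfX n) ->
  (forall n, p (s n.+1 - s n) <= C * halfX n) -> p y <= 4 * C.

Let DB x y : D x -> D y -> D (x - y).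
Proof. by move=> Dx Dy; apply: DD => //; rewrite -scaleN1r; exact: DZ. Qed.

Let qB x y : D x -> D y -> q (x - y) <= q x + q y.
Proof.
move=> Dx Dy; rewrite -scaleN1r; apply: le_trans (qD Dx (DZ _ Dy)) _.
by rewrite lerD2l; apply: le_trans (qZ _ Dy) _; rewrite normrN1 mul1r.
Qed.

Let pB x y : D x -> D y -> p (x - y) <= p x + p y.
Proof.
move=> Dx Dy; rewrite -scaleN1r; apply: le_trans (pD Dx (DZ _ Dy)) _.
by rewrite lerD2l; apply: le_trans (pZ _ Dy) _; rewrite normrN1 mul1r.
Qed.

(** Baire's argument: if no sublevel set of p were dense in a ball, nested balls
    would shrink to a point at which p exceeds every integer. *)
Lemma sublevel_dense_in_ball : D 0 -> exists (N : nat) a r, [/\ 0 < r, D a &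
  forall y, D y -> q (y - a) <= r -> forall eta, 0 < eta ->
    exists z, [/\ D z, q (y - z) <= eta & p z <= N%:R]].
Proof.
move=> D0; apply: contrapT => H.
have step (N : nat) a r : 0 < r -> D a -> exists y, [/\ D y, q (y - a) <= r &
    exists2 eta, 0 < eta & forall z, D z -> q (y - z) <= eta -> N%:R < p z].
  move=> r0 Da; apply: contrapT => H1; apply: H; exists N, a, r; split=> //.
  move=> y Dy yr eta eta0; apply: contrapT => H2; apply: H1; exists y; split=> //.
  exists eta => // z Dz yz; rewrite ltNge; apply/negP => pz.
  by apply: H2; exists z.
have [f [f0 Hf]] := @dependent_choice_nat (Y * R)
  (fun n ar => [/\ D ar.1, 0 < ar.2 & ar.2 <= halfX n])
  (fun n ar ar' => [/\ q (ar'.1 - ar.1) <= ar.2 / 2, ar'.2 <= ar.2 / 2 &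
     forall z, D z -> q (ar'.1 - z) <= 2 * ar'.2 -> n%:R < p z]) (0, 1)
  ltac:(by split=> //=; rewrite halfX0) ltac:(
    move=> n [a r] [/= Da r0 rh];
    have [y [Dy yr [eta eta0 Hy]]] := step n a (r / 2) ltac:(lra) Da;
    exists (y, Num.min (r / 2) (eta / 2)); split=> //=;
    [by rewrite lt_min; lra|by rewrite halfXS ge_min; lra|by rewrite ge_min lexx|];
    move=> z Dz yz; apply: Hy => //; apply: le_trans yz _;
    rewrite mulrC -ler_pdivlMr// ge_min lexx orbT//).
pose a n := (f n).1; pose r n := (f n).2.
have Da n : D (a n) by have [[]] := Hf n.
have r0 n : 0 < r n by have [[]] := Hf n.
have rh n : r n <= halfX n by have [[]] := Hf n.
have aS n : q (a n.+1 - a n) <= r n / 2 by have [_ []] := Hf n.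
have rS n : r n.+1 <= r n / 2 by have [_ []] := Hf n.
have aS1 n : q (a n.+1 - a n) <= 1 * halfX n.
  by apply: le_trans (aS n) _; have := rh n; have := r0 n; lra.
have [y Dy Hy] := q_complete Da aS1.
have sum k n : q (a (n + k)%N - a k) <= r k - r (n + k)%N.
  elim: n => [|n IH].
    by rewrite !subrr; have := qZ 0 D0; rewrite scale0r normr0 mul0r.
  have -> : a (n.+1 + k)%N - a k = (a (n + k).+1 - a (n + k)%N) + (a (n + k)%N - a k).
    by rewrite addSn; zmod.
  apply: le_trans (qD _ _) _; [exact: DB|exact: DB|].
  by have := aS (n + k)%N; have := rS (n + k)%N; have := r0 (n + k)%N; rewrite addSn; lra.
have pk k : k%:R < p y.
  have [_ [_ _ Hk]] := Hf k; apply: Hk => //; rewrite -/(a k.+1) -/(r k.+1).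
  have [n Hn] := halfX_small (4 * 1) (r0 k.+1).
  have -> : a k.+1 - y = - 1 *: (a (n + k.+1)%N - a k.+1) - (y - a (n + k.+1)%N).
    by rewrite scaleN1r; zmod.
  apply: le_trans (qB _ _) _; [by apply: DZ; exact: DB|exact: DB|].
  have := qZ (-1) (DB (Da (n + k.+1)%N) (Da k.+1)); rewrite normrN1 mul1r.
  have := sum k.+1 n; have := Hy (n + k.+1)%N; have := r0 (n + k.+1)%N.
  have := halfX_mono (R := R) (leq_addr k.+1 n); lra.
have := pk (Num.truncn (p y)).+1; have := Num.Theory.truncnS_gt (p y); lra.
Qed.

(** Zabreiko's lemma: every y is the sum of a series of elements of a sublevel
    set, scaled geometrically, and p is bounded along this series. *)
Lemma zabreiko : D 0 -> exists2 M, 0 < M & forall y, D y -> p y <= M * q y.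
Proof.
move=> D0; have [N [a [r [r0 Da H]]]] := sublevel_dense_in_ball D0.
pose C : R := 2 * N%:R / r + 1.
have C0 : 0 < C by rewrite ltr_wpDl// divr_ge0 ?mulr_ge0// ltW.
have q00 : q 0 <= 0 by have := qZ 0 D0; rewrite scale0r normr0 mul0r.
have appr c y : 0 < c -> D y -> q y <= c -> forall eta, 0 < eta ->
    exists z, [/\ D z, q (y - z) <= eta & p z <= C * c].
  move=> c0 Dy yc eta eta0; pose k := c / r; have k0 : 0 < k by rewrite divr_gt0.
  have ek : 0 < eta / 2 / k by rewrite !divr_gt0.
  have Dy' : D (k^-1 *: y) by exact: DZ.
  have [||z1 [Dz1 qz1 pz1]] := H (k^-1 *: y + a) _ _ _ ek; first exact: DD.
    rewrite addrK; apply: le_trans (qZ _ Dy) _.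
    rewrite gtr0_norm ?invr_gt0// mulrC ler_pdivrMr// /k mulrC divfK ?gt_eqF//.
  have [||z2 [Dz2 qz2 pz2]] := H a _ _ _ ek => //; first by rewrite subrr; lra.
  exists (k *: (z1 - z2)); split; first by apply: DZ; exact: DB.
    have -> : y - k *: (z1 - z2) = k *: ((k^-1 *: y + a - z1) - (a - z2)).
      rewrite -[in LHS](scale1r y) -(divff (lt0r_neq0 k0)) -scalerA -scalerBr.
      by congr (_ *: _); zmod.
    apply: le_trans (qZ _ _) _; first by apply: DB; apply: DB => //; exact: DD.
    rewrite gtr0_norm// mulrC -ler_pdivlMr//.
    apply: le_trans (qB _ _) _; [by apply: DB => //; exact: DD|exact: DB|].
    by have -> : eta / k = eta / 2 / k + eta / 2 / k; [field; rewrite gt_eqF|lra].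
  apply: le_trans (pZ _ _) _; first exact: DB.
  rewrite gtr0_norm//; apply: (@le_trans _ _ (k * (2 * N%:R))).
    rewrite ler_wpM2l ?(ltW k0)//; apply: le_trans (pB Dz1 Dz2) _; lra.
  have -> : k * (2 * N%:R) = 2 * N%:R / r * c by rewrite /k; ring.
  by rewrite ler_wpM2r ?(ltW c0)// lerDl.
have main c y : 0 < c -> D y -> q y <= c -> p y <= 4 * (C * c).
  move=> c0 Dy yc.
  have [s [s0 Hs]] := @dependent_choice_nat Y
    (fun n s => D s /\ q (y - s) <= c * halfX n)
    (fun n s s' => p (s' - s) <= C * c * halfX n) 0
    ltac:(by split=> //; rewrite subr0 halfX0 mulr1) ltac:(
      move=> n s [Ds qs];
      have cn : 0 < c * halfX n by [rewrite mulr_gt0// halfX_gt0];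
      have cn' : 0 < c * halfX n.+1 by [rewrite mulr_gt0// halfX_gt0];
      have [z [Dz qz pz]] := appr _ _ cn (DB Dy Ds) qs _ cn';
      exists (s + z); [split; [exact: DD|by rewrite opprD addrA]|];
      by rewrite addrC addKr -mulrA).
  apply: (p_countably_subadditive (s := s) (C' := c)) => // n.
  - by have [[]] := Hs n.
  - by have [[]] := Hs n.
  - by have [] := Hs n.
exists (4 * C) => [|y Dy]; first by rewrite mulr_gt0.
have [qy|qy] := ltP 0 (q y); first by rewrite -mulrA; exact: main.
have -> : q y = 0 by apply/eqP; rewrite eq_le qy q0.
rewrite mulr0; apply/ler_addgt0Pr => eps eps0; rewrite add0r.
have e4 : 0 < eps / (4 * C) by rewrite divr_gt0// mulr_gt0.
apply: le_trans (main _ _ e4 Dy _) _; first by lra.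
by rewrite mulrA mulrC divfK// gt_eqF// mulr_gt0.
Qed.

End zabreiko.

Section weighted_norm.
Context {R : realType} {E : completeNormedModType R}.
Variable mu : R.
Hypothesis mu01 : 0 < mu < 1.
Variable T : R.
Hypothesis T0 : 0 < T.

Definition wnorm (v : R -> E) : R := sup [set wt mu t * `|v t| | t in halfopen T].

Let TT : 0 < T <= T. Proof. by rewrite T0 lexx. Qed.

Lemma wnorm_ub v : wvan mu T v -> wbd mu T v (wnorm v).
Proof.
move=> Hv t tT; apply: ub_le_sup; last by exists t.
by have [M _ HM] := wvan_bounded mu01 Hv; exists M => _ [s sT <-]; exact: HM.
Qed.

Lemma wnorm_le v N : wbd mu T v N -> wnorm v <= N.
Proof.
move=> Hv; apply: ge_sup; first by exists (wt mu T * `|v T|), T.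
by move=> _ [s sT <-]; exact: Hv.
Qed.

Lemma wnorm_ge0 v : wvan mu T v -> 0 <= wnorm v.
Proof.
by move=> Hv; apply: le_trans (wnorm_ub Hv TT); rewrite mulr_ge0// wt_ge0.
Qed.

Lemma wnormD v w : wvan mu T v -> wvan mu T w ->
  wnorm (fun t => v t + w t) <= wnorm v + wnorm w.
Proof. by move=> Hv Hw; apply: wnorm_le; apply: wbdD; exact: wnorm_ub. Qed.

Lemma wnormZ v k : wvan mu T v -> wnorm (fun t => k *: v t) <= `|k| * wnorm v.
Proof.
move=> Hv; apply: wnorm_le => t tT; rewrite normrZ mulrCA ler_wpM2l//.
exact: wnorm_ub.
Qed.

Lemma wnorm_ext v w : (forall t, 0 < t <= T -> v t = w t) -> wnorm v = wnorm w.
Proof.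
move=> vw; rewrite /wnorm; congr (sup _); apply/seteqP.
by split=> _ [t tT <-]; exists t; rewrite ?vw.
Qed.

End weighted_norm.

Section maximal_regularity.
Context {R : realType} {E0 E1 : completeNormedModType R}.
Variables (e : dense_embedding E0 E1) (mu : R).
Hypothesis mu01 : 0 < mu < 1.

Lemma initial_valueP T (u : R -> E1) (x : cinterp e mu) : 0 < T ->
  initial_value u x <-> forall eps, 0 < eps -> exists2 d, 0 < d &
    forall t, 0 < t <= T -> t < d -> `|e (u t) - \val x| <= eps.
Proof.
move=> T0; rewrite /initial_value; split=> [/cvgrPdist_le H eps eps0|H].
  have := H _ eps0; rewrite near_withinE => /nbhs_ballP[d /= d0 {}H].
  exists d => // t tT td; rewrite distrC; apply: H; last by lra.
  by rewrite -ball_normE /ball_/= sub0r normrN gtr0_norm; lra.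
apply/cvgrPdist_le => eps eps0; have [d d0 {}H] := H _ eps0.
rewrite near_withinE; apply/nbhs_ballP; exists (Num.min d T) => /=.
  by rewrite lt_min d0.
move=> t; rewrite -ball_normE /ball_/= sub0r normrN => + t0.
rewrite gtr0_norm// lt_min distrC => /andP[td tT]; apply: H => //; lra.
Qed.

Lemma EE1_evol T u (x : cinterp e mu) : 0 < T -> EE1 e mu T u ->
  initial_value u x -> evol e mu T u (derive_within `]0, T] (e \o u)) (\val x).
Proof.
move=> T0 [[ud _ _ du0] uw] /(initial_valueP _ _ T0) ux; split=> //.
- exact/(BCwP mu01 _ T0).
- exact/(BCwP mu01 _ T0).
- by move=> t tT; apply: derivable_withinP; apply: ud; rewrite set_itvoc.
Qed.

Lemma evol_EE1 T u u' (x : cinterp e mu) : 0 < T -> evol e mu T u u' (\val x) ->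
  [/\ EE1 e mu T u, initial_value u x &
    forall t, 0 < t <= T -> derive_within `]0, T] (e \o u) t = u' t].
Proof.
move=> T0 [uc uc' ud ux].
have uE t : 0 < t <= T -> derive_within `]0, T] (e \o u) t = u' t.
  by move=> tT; have [] := derive_withinE tT (ud t tT).
have duw : wvan mu T (derive_within `]0, T] (e \o u)).
  by apply: wvan_ext uc' => t tT; rewrite uE.
split=> //; last by apply/(initial_valueP _ _ T0).
split; last exact/BCwP.
have [c c0 ec] := embed_bound e.
split.
- move=> t; rewrite set_itvoc => tT.
  by have [] := derive_withinE tT (ud t tT).
- by rewrite set_itvoc; apply/within_contP; case: duw.
- by apply/BCwP => //; exact: wvan_linear ec uc.
- exact/BCwP.
Qed.

Lemma linear_solutionP (B : {linear E1 -> E0}) T f (x : cinterp e mu) u : 0 < T ->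
  linear_solution B T f x u <-> exists u', lsol e mu B T f (\val x) u u'.
Proof.
move=> T0; split=> [[uE uf ux]|[u' [/(evol_EE1 T0)[uE ux du] uf]]].
  by exists (derive_within `]0, T] (e \o u)); split=> //; exact: EE1_evol.
by split=> // t tT; rewrite du// uf.
Qed.

Lemma lsol_deriv_unique (B : {linear E1 -> E0}) T f x u u' v v' :
  (forall t, 0 < t <= T -> u t = v t) ->
  lsol e mu B T f x u u' -> lsol e mu B T f x v v' ->
  forall t, 0 < t <= T -> u' t = v' t.
Proof.
move=> uv [_ uf] [_ vf] t tT; have := uf t tT; rewrite -(vf t tT) uv//.
by move/addIr.
Qed.

Section solution_operator.
Variables (B : {linear E1 -> E0}) (c T : R).
Hypothesis Bc : forall b, `|B b| <= c * `|b|.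
Hypothesis T0 : 0 < T.
Hypothesis solvable : forall f (x : cinterp e mu), wvan mu T f ->
  exists uu : (R -> E1) * (R -> E0), lsol e mu B T f (\val x) uu.1 uu.2.
Hypothesis unique : forall f (x : cinterp e mu) u u' v v',
  lsol e mu B T f (\val x) u u' -> lsol e mu B T f (\val x) v v' ->
  forall t, 0 < t <= T -> u t = v t.

(** The norm p of the solution is countably subadditive with respect to the norm q
    of the data: solutions of a series of data with summable norms converge in
    EE_(1, mu), and the limit is the solution by uniqueness. *)
Lemma lsol_bounded : exists2 M, 0 < M & forall f (x : cinterp e mu) u u' N,
  lsol e mu B T f (\val x) u u' -> wbd mu T f N ->
  wbd mu T u (M * (N + `|x|)) /\ wbd mu T u' (M * (N + `|x|)).
Proof.
have /choice[S HS] : forall y : (R -> E0) * cinterp e mu,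
    exists uu : (R -> E1) * (R -> E0), wvan mu T y.1 ->
      lsol e mu B T y.1 (\val y.2) uu.1 uu.2.
  move=> [f x]; have [wf|nf] := pselect (wvan mu T f).
    by have [uu Huu] := solvable x wf; exists uu.
  by exists (fun=> 0, fun=> 0).
pose q (y : (R -> E0) * cinterp e mu) := wnorm mu T y.1 + `|y.2|.
pose p y := wnorm mu T (S y).1 + wnorm mu T (S y).2.
pose D (y : (R -> E0) * cinterp e mu) := wvan mu T y.1.
have Su y u u' : D y -> lsol e mu B T y.1 (\val y.2) u u' ->
    (forall t, 0 < t <= T -> (S y).1 t = u t) /\
    (forall t, 0 < t <= T -> (S y).2 t = u' t).
  move=> Dy uS; have HSy := HS y Dy.
  have uE := unique HSy uS; split=> //.
  exact: lsol_deriv_unique uE HSy uS.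
have pE y u u' : D y -> lsol e mu B T y.1 (\val y.2) u u' ->
    p y = wnorm mu T u + wnorm mu T u'.
  by move=> Dy /(Su y _ _ Dy)[/wnorm_ext uE /wnorm_ext u'E]; rewrite /p uE u'E.
have SC y : D y -> wvan mu T (S y).1 /\ wvan mu T (S y).2.
  by move=> /HS[[]].
have valD (x y : cinterp e mu) : \val (x + y) = \val x + \val y by exact: raddfD.
have valZ k (x : cinterp e mu) : \val (k *: x) = k *: \val x by exact: linearZ.
have DD x y : D x -> D y -> D (x + y) by move=> Dx Dy; exact: wvanD.
have DZ k x : D x -> D (k *: x) by move=> Dx; exact: wvanZ.
have D0 : D 0 by exact: wvan_cst.
have DB x y : D x -> D y -> D (x - y) by move=> Dx Dy; exact: wvanB.
have q0 x : D x -> 0 <= q x by move=> Dx; rewrite addr_ge0// wnorm_ge0.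
have qD x y : D x -> D y -> q (x + y) <= q x + q y.
  move=> Dx Dy; rewrite /q addrACA; apply: lerD; last exact: ler_normD.
  exact: wnormD.
have qZ k x : D x -> q (k *: x) <= `|k| * q x.
  move=> Dx; rewrite /q mulrDr -normrZ; apply: lerD => //; exact: wnormZ.
have pD x y : D x -> D y -> p (x + y) <= p x + p y.
  move=> Dx Dy.
  have xyS : lsol e mu B T (x + y).1 (\val (x + y).2)
      (fun t => (S x).1 t + (S y).1 t) (fun t => (S x).2 t + (S y).2 t).
    by rewrite valD; exact: lsolD (HS _ Dx) (HS _ Dy).
  rewrite (pE _ _ _ (DD _ _ Dx Dy) xyS) /p addrACA.
  have [? ?] := SC x Dx; have [? ?] := SC y Dy.
  by apply: lerD; exact: wnormD.
have pZ k x : D x -> p (k *: x) <= `|k| * p x.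
  move=> Dx.
  have xS : lsol e mu B T (k *: x).1 (\val (k *: x).2)
      (fun t => k *: (S x).1 t) (fun t => k *: (S x).2 t).
    by rewrite valZ; exact: lsolZ (HS _ Dx).
  rewrite (pE _ _ _ (DZ k _ Dx) xS) /p mulrDr.
  by have [? ?] := SC x Dx; apply: lerD; exact: wnormZ.
have qcomplete (s : nat -> (R -> E0) * cinterp e mu) C : (forall n, D (s n)) ->
    (forall n, q (s n.+1 - s n) <= C * halfX n) ->
    exists2 y, D y & forall n, q (y - s n) <= 4 * C * halfX n.
  move=> Ds qs; have Dd n : D (s n.+1 - s n) by exact: DB.
  have [f fw Hf] : exists2 f, wvan mu T f &
      forall n, wbd mu T (fun t => f t - (s n).1 t) (2 * C * halfX n).
    apply: wvan_lim => // n; apply: wbd_le (wnorm_ub mu01 (Dd n)).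
    by apply: le_trans (qs n); rewrite lerDl.
  have [x Hx] : exists x, forall n, `|x - (s n).2| <= 2 * C * halfX n.
    apply: cinterp_lim_rate => n; apply: le_trans (qs n).
    by rewrite lerDr wnorm_ge0//; exact: Dd.
  exists (f, x) => // n; rewrite /q.
  have := wnorm_le T0 (Hf n); have := Hx n => /=; lra.
have pcs (s : nat -> (R -> E0) * cinterp e mu) y C C' : s 0%N = 0 ->
    (forall n, D (s n)) -> D y -> (forall n, q (y - s n) <= C' * halfX n) ->
    (forall n, p (s n.+1 - s n) <= C * halfX n) -> p y <= 4 * C.
  move=> s0 Ds Dy qs ps.
  have Dd n : D (s n.+1 - s n) by exact: DB.
  have Sd n : lsol e mu B T (s n.+1 - s n).1 (\val (s n.+1 - s n).2)
      (fun t => (S (s n.+1)).1 t - (S (s n)).1 t)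
      (fun t => (S (s n.+1)).2 t - (S (s n)).2 t).
    by rewrite valB; exact: lsolB (HS _ (Ds _)) (HS _ (Ds _)).
  have wd n : wvan mu T (fun t => (S (s n.+1)).1 t - (S (s n)).1 t) by case: (Sd n) => -[].
  have wd' n : wvan mu T (fun t => (S (s n.+1)).2 t - (S (s n)).2 t) by case: (Sd n) => -[].
  have pd n := ps n.
  have {}pd n : wnorm mu T (fun t => (S (s n.+1)).1 t - (S (s n)).1 t) +
      wnorm mu T (fun t => (S (s n.+1)).2 t - (S (s n)).2 t) <= C * halfX n.
    by rewrite -(pE _ _ _ (Dd n) (Sd n)); exact: ps.
  have w0 n := wnorm_ge0 mu01 T0 (wd n); have w0' n := wnorm_ge0 mu01 T0 (wd' n).
  have C0 : 0 <= C.
    by have := pd 0%N; rewrite halfX0 mulr1; apply: le_trans; exact: addr_ge0.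
  have bd n : wbd mu T (fun t => (S (s n.+1)).1 t - (S (s n)).1 t) (C * halfX n).
    apply: wbd_le (wnorm_ub mu01 (wd n)); have := pd n; have := w0' n; lra.
  have bd' n : wbd mu T (fun t => (S (s n.+1)).2 t - (S (s n)).2 t) (C * halfX n).
    apply: wbd_le (wnorm_ub mu01 (wd' n)); have := pd n; have := w0 n; lra.
  have [c' c'0 Hc'] := cinterp_norm_val e mu.
  have qx n : `|y.2 - (s n).2| <= C' * halfX n.
    by apply: le_trans (qs n); rewrite lerDr wnorm_ge0//; exact: DB.
  have qf n : wbd mu T (fun t => y.1 t - (s n).1 t) (C' * halfX n).
    by apply: wbd_le (wnorm_ub mu01 (DB _ _ Dy (Ds n))); apply: le_trans (qs n); rewrite lerDl.
  have [u [u' [uE ulim ulim']]] : exists u u', [/\ evol e mu T u u' (\val y.2),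
      forall n, wbd mu T (fun t => u t - (S (s n)).1 t) (2 * C * halfX n) &
      forall n, wbd mu T (fun t => u' t - (S (s n)).2 t) (2 * C * halfX n)].
    apply: (evol_lim mu01 (fun n => (HS _ (Ds n)).1) bd bd') => eps eps0.
    have [n0 Hn0] := halfX_small (c' * `|C'|) eps0; exists n0 => n nn.
    rewrite distrC -valB; apply: le_trans (Hc' _) _; apply: le_trans Hn0.
    rewrite -mulrA ler_wpM2l ?(ltW c'0)//; apply: le_trans (qx n) _.
    apply: (@le_trans _ _ (`|C'| * halfX n)).
      by rewrite ler_wpM2r ?ler_norm// ltW// halfX_gt0.
    by rewrite ler_wpM2l//; exact: halfX_mono.
  have yS : lsol e mu B T y.1 (\val y.2) u u'.
    split=> // t tT; have wt0 : 0 < wt mu t by apply: wt_gt0; lra.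
    apply/eqP; rewrite -subr_eq0 -normr_le0 -(pmulr_rle0 _ wt0).
    apply/ler_addgt0Pr => eps eps0; rewrite add0r.
    have [n Hn] := halfX_small (2 * C + `|c| * (2 * C) + C') eps0.
    have -> : u' t + B (u t) - y.1 t = (u' t - (S (s n)).2 t) +
       B (u t - (S (s n)).1 t) - (y.1 t - (s n).1 t).
      by have [_ <-//] := HS _ (Ds n); rewrite linearB; zmod.
    apply: le_trans (ler_wpM2l (ltW wt0) (ler_normB _ _)) _.
    have := ler_wpM2l (ltW wt0) (ler_normD (u' t - (S (s n)).2 t) (B (u t - (S (s n)).1 t))).
    have := ulim' n t tT; have := qf n t tT.
    have := ler_wpM2l (normr_ge0 c) (ulim n t tT).
    have := ler_wpM2l (ltW wt0) (Bc (u t - (S (s n)).1 t)).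
    have := ler_wpM2r (mulr_ge0 (ltW wt0) (normr_ge0 (u t - (S (s n)).1 t))) (ler_norm c).
    lra.
  rewrite (pE _ _ _ Dy yS).
  have [z z'] : (forall t, 0 < t <= T -> (S (s 0%N)).1 t = 0) /\
      (forall t, 0 < t <= T -> (S (s 0%N)).2 t = 0).
    by rewrite s0; apply: Su => //; exact: lsol0.
  have uC : wnorm mu T u <= 2 * C.
    apply: wnorm_le => // t tT; have := ulim 0%N t tT.
    by rewrite z// subr0 halfX0 mulr1.
  have uC' : wnorm mu T u' <= 2 * C.
    apply: wnorm_le => // t tT; have := ulim' 0%N t tT.
    by rewrite z'// subr0 halfX0 mulr1.
  lra.
have [M M0 HM] := zabreiko DD DZ q0 qD qZ pD pZ qcomplete pcs D0.
exists (2 * M) => [|f x u u' N uS fN]; first lra.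
have Df : D (f, x).
  case: (uS) => -[uc uc' _ _] uf; apply: (wvan_ext uf).
  by apply: wvanD => //; exact: wvan_linear Bc uc.
have := HM _ Df; rewrite (pE _ _ _ Df uS).
have uc : wvan mu T u by case: uS => -[].
have uc' : wvan mu T u' by case: uS => -[].
have := wnorm_ge0 mu01 T0 uc; have := wnorm_ge0 mu01 T0 uc'.
have := wnorm_le T0 fN; rewrite /q /= => h1 h2 h3 h4.
have h5 := ler_wpM2l (ltW M0) h1.
have h6 : 0 <= M * (N + `|x|).
  rewrite mulr_ge0 ?(ltW M0)// addr_ge0//.
  by apply: le_trans h1; exact: wnorm_ge0.
split=> t tT.
  by apply: le_trans (wnorm_ub mu01 uc tT) _; lra.
by apply: le_trans (wnorm_ub mu01 uc' tT) _; lra.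
Qed.

End solution_operator.

(** Maximal regularity on every short interval, with a constant that does not
    depend on its length. *)
Theorem maximal_regularity_bound (B : {linear E1 -> E0}) :
  maximal_regularity e mu B -> exists M T0 c : R, [/\ 0 < M, 0 < T0,
    forall b, `|B b| <= c * `|b|,
    forall T f (x : cinterp e mu), 0 < T <= T0 -> wvan mu T f ->
      exists u u', lsol e mu B T f (\val x) u u' &
    forall T f (x : cinterp e mu) u u' N, 0 < T <= T0 ->
      lsol e mu B T f (\val x) u u' -> wbd mu T f N ->
      wbd mu T u (M * (N + `|x|)) /\ wbd mu T u' (M * (N + `|x|))].
Proof.
move=> [Bcont [T0 T00 HB]].
have [c c0 Bc] : exists2 c : R, 0 < c & forall b, `|B b| <= c * `|b|.
  have /linear_bounded_continuous/linear_boundedP := Bcont.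
  by move=> /pinfty_ex_gt0[c c0 H]; exists c.
have solvable f (x : cinterp e mu) : wvan mu T0 f ->
    exists uu : (R -> E1) * (R -> E0), lsol e mu B T0 f (\val x) uu.1 uu.2.
  move=> /(BCwP mu01 _ T00)/HB-/(_ x)[u /(linear_solutionP _ _ _ _ T00)[u' uS] _].
  by exists (u, u').
have unique f (x : cinterp e mu) u u' v v' : lsol e mu B T0 f (\val x) u u' ->
    lsol e mu B T0 f (\val x) v v' -> forall t, 0 < t <= T0 -> u t = v t.
  move=> uS vS t tT.
  have fw : BCw mu T0 f.
    apply/BCwP => //; case: (uS) => -[uc uc' _ _] uf; apply: (wvan_ext uf).
    by apply: wvanD => //; exact: wvan_linear Bc uc.
  have [w _ Hw] := HB f x fw.
  by rewrite !(Hw _ _ t tT)//; apply/linear_solutionP => //; [exists v'|exists u'].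
have [M M0 HM] := lsol_bounded Bc T00 solvable unique.
have unique0 T u u' : 0 < T <= T0 -> lsol e mu B T (fun=> 0) 0 u u' ->
    forall t, 0 < t <= T -> u t = 0.
  move=> TT uS; apply: lsol_unique0 Bc _ _ _ _ TT uS => // v v' vS.
  have v0 : \val (0 : cinterp e mu) = 0 :> E0 by exact: raddf0.
  rewrite -v0 in vS; apply: unique vS _; rewrite v0; exact: lsol0.
(* f is extended beyond T without increase of its weighted norm *)
pose ext T (f : R -> E0) t := t `^ (mu - 1) *: (wt mu (Num.min t T) *: f (Num.min t T)).
have extE T f t : 0 < t <= T -> ext T f t = f t.
  move=> tT; rewrite /ext; have -> : Num.min t T = t by apply/min_idPl; lra.
  rewrite scalerA /wt powRBM; last by lra.
  by rewrite (_ : mu - 1 + _ = 0) ?powRr0 ?scale1r//; ring.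
have extN T f t : 0 < t -> wt mu t * `|ext T f t| =
    wt mu (Num.min t T) * `|f (Num.min t T)|.
  move=> t0; rewrite /ext !normrZ (ger0_norm (powR_ge0 t _)) (ger0_norm (wt_ge0 _ _)).
  rewrite {1}/wt !mulrA powRBM// (_ : 1 - mu + _ = 0) ?powRr0 ?mul1r//.
  by ring.
have minT (T t : R) : 0 < T -> 0 < t -> 0 < Num.min t T <= T.
  by move=> *; rewrite lt_min ge_min lexx orbT; lra.
have extw T f : 0 < T <= T0 -> wvan mu T f -> wvan mu T0 (ext T f).
  move=> TT [fc f0]; split=> [t tT|eps eps0].
    apply/cont_at_cvgP; rewrite /ext.
    apply: (@cvgZ _ _ _ (within (halfopen T0) (nbhs t)) _ (fun s : R => s `^ (mu - 1))).
      by apply/cont_at_cvgP; apply: powR_cont_at; lra.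
    have minc s : `|Num.min s T - Num.min t T| <= `|s - t|.
      by rewrite !minElt; case: (ltP s T) => ?; case: (ltP t T) => ?; rewrite ?subrr ?normr0//;
        have := ler_norm (s - t); have := ler_norm (t - s); rewrite (distrC t) ler_norml; lra.
    apply: (@cvgZ _ _ _ (within (halfopen T0) (nbhs t)) _ (fun s : R => wt mu (Num.min s T))).
      apply/cont_at_cvgP => eps eps0.
      have [d d0 Hd] := @powR_cont_at R (1 - mu) (Num.min t T) setT
        (proj1 (andP (minT T t ltac:(lra) ltac:(lra)))) eps eps0.
      exists d => // s sT sd; apply: Hd => //.
      exact: le_lt_trans (minc s) sd.
    apply/cont_at_cvgP => eps eps0.
    have [d d0 Hd] := fc _ (minT T t ltac:(lra) ltac:(lra)) eps eps0.
    exists d => // s /= sT sd; apply: Hd => /=; first by apply: minT; lra.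
    exact: le_lt_trans (minc s) sd.
  have [d d0 Hd] := f0 eps eps0; exists (Num.min d T) => [|t tT].
    by rewrite lt_min d0; lra.
  rewrite lt_min => /andP[td tT']; rewrite extN; last by lra.
  have -> : Num.min t T = t by apply/min_idPl; lra.
  by apply: Hd => //; lra.
exists M, T0, c; split=> //.
  move=> T f x TT fw; have [[u u'] /= uS] := solvable _ x (extw T f TT fw).
  exists u, u'; have [uE uf] := lsol_restrict (proj2 (andP TT)) uS.
  by split=> // t tT; rewrite uf// extE.
move=> T f x u u' N TT uS fN.
have fw : wvan mu T f.
  case: (uS) => -[uc uc' _ _] uf; apply: (wvan_ext uf).
  by apply: wvanD => //; exact: wvan_linear Bc uc.
have [[v v'] /= vS] := solvable _ x (extw T f TT fw).
have extfN : wbd mu T0 (ext T f) N.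
  move=> t tT; rewrite extN; last by lra.
  by apply: fN; apply: minT; lra.
have [vN v'N] := HM _ _ _ _ N vS extfN.
have vS' : lsol e mu B T f (\val x) v v'.
  have [vE vf] := lsol_restrict (proj2 (andP TT)) vS.
  by split=> // t tT; rewrite vf// extE.
have uv t : 0 < t <= T -> u t = v t.
  have [wE wf] := lsolB uS vS'.
  move=> tT; apply/eqP; rewrite -subr_eq0; apply/eqP; move: t tT.
  apply: (unique0 _ _ (fun t => u' t - v' t)) => //; split.
    by move: wE; rewrite subrr.
  by move=> t tT; rewrite wf// subrr.
have u'v := lsol_deriv_unique uv uS vS'.
split=> t tT; first by rewrite uv//; apply: vN; lra.
by rewrite u'v//; apply: v'N; lra.
Qed.

End maximal_regularity.

(** * Translation and concatenation in time *)

Section translation.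
Context {R : realType}.

Lemma cont_at_shift (E : normedModType R) (D D' : set R) (v : R -> E) a t :
  (forall s, D' s -> D (s + a)) -> cont_at D v (t + a) ->
  cont_at D' (fun s => v (s + a)) t.
Proof.
move=> DD vc eps eps0; have [d d0 Hd] := vc eps eps0; exists d => // s Ds sd.
by apply: Hd; [exact: DD | rewrite (_ : s + a - (t + a) = s - t)//; ring].
Qed.

Lemma has_deriv_shift (E : normedModType R) (D D' : set R) (v : R -> E) a t d :
  (forall s, D' s -> D (s + a)) -> has_deriv D v (t + a) d ->
  has_deriv D' (fun s => v (s + a)) t d.
Proof.
move=> DD vd eps eps0; have [del d0 Hd] := vd eps eps0; exists del => // s Ds sd.
have ss : s + a - (t + a) = s - t by ring.
by have := Hd (s + a) (DD s Ds); rewrite ss; apply.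
Qed.

Lemma wvan_shift (mu : R) (E : normedModType R) T a (v : R -> E) : 0 < mu < 1 ->
  0 < a < T -> (forall t, 0 < t <= T -> cont_at (halfopen T) v t) ->
  wvan mu (T - a) (fun t => v (t + a)).
Proof.
move=> mu01 aT vc; split=> [t tT|eps eps0].
  apply: (cont_at_shift (D := halfopen T)) => [s /=|]; first by lra.
  by apply: vc; lra.
have [d d0 Hd] := vc a ltac:(lra) _ ltr01.
have c0 : 0 < `|v a| + 1 by rewrite ltr_wpDl.
have [d' d'0 Hd'] := wt_small mu01 (divr_gt0 eps0 c0).
exists (Num.min d d') => [|t tT]; rewrite lt_min ?d0// => /andP[td td'].
have t0 : 0 < t by lra.
have vt : `|v (t + a)| <= `|v a| + 1.
  rewrite -[v (t + a)](subrK (v a)) addrC; apply: le_trans (ler_normD _ _) _.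
  by rewrite lerD2l; apply: Hd => /=; [lra|rewrite addrK gtr0_norm].
have := Hd' t t0 td'; rewrite ler_pdivlMr//; apply: le_trans.
by rewrite ler_wpM2l ?wt_ge0.
Qed.

End translation.

Section concatenation.
Context {R : realType} {E0 E1 : completeNormedModType R}.
Variables (e : dense_embedding E0 E1) (mu : R).
Hypothesis mu01 : 0 < mu < 1.

Lemma evol_shift T a u u' x : 0 < a < T -> evol e mu T u u' x ->
  evol e mu (T - a) (fun t => u (t + a)) (fun t => u' (t + a)) (e (u a)).
Proof.
move=> aT [[uc _] [uc' _] ud _].
split; [exact: wvan_shift|exact: wvan_shift| |].
  move=> t tT; apply: (has_deriv_shift (D := halfopen T) (v := e \o u)) => [s /=|].
    by lra.
  by apply: ud; lra.
move=> eps eps0; have [c c0 ec] := embed_bound e.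
have [d d0 Hd] := uc a ltac:(lra) _ (divr_gt0 eps0 c0).
exists d => // t tT td; rewrite -linearB; apply: le_trans (ec _) _.
rewrite mulrC -ler_pdivlMr//; apply: Hd => /=; first by lra.
by rewrite addrK gtr0_norm//; lra.
Qed.

(** Since the two pieces agree on the overlap ]a, T], continuity and
    differentiability of the whole are local properties of either piece. *)
Lemma evol_glue x T a S u u' w w' G G' : 0 < a < T -> T <= a + S ->
  evol e mu T u u' x -> evol e mu S w w' (e (u a)) ->
  (forall t, 0 < t <= T -> G t = u t) -> (forall t, 0 < t <= T -> G' t = u' t) ->
  (forall t, a < t <= a + S -> G t = w (t - a)) ->
  (forall t, a < t <= a + S -> G' t = w' (t - a)) ->
  evol e mu (a + S) G G' x.
Proof.
move=> aT TS [uw uw' ud u0] [ww ww' wd _] Gu Gu' Gw Gw'.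
have glue_cont (E : normedModType R) (v z H : R -> E) :
    (forall t, 0 < t <= T -> H t = v t) -> (forall t, a < t <= a + S -> H t = z (t - a)) ->
    wvan mu T v -> wvan mu S z -> wvan mu (a + S) H.
  move=> Hv Hz [vc v0] [zc _]; split=> [t tS|eps eps0].
    have [tT|Tt] := ltP t T.
      apply: (cont_at_local (D := halfopen T) (v := v) (r := T - t)) => [||s /=|s /=|].
      - by rewrite subr_gt0.
      - by rewrite /=; lra.
      - by rewrite ltr_distl; lra.
      - by move=> sT _; rewrite Hv.
      - by apply: vc; lra.
    apply: (cont_at_local (D := [set s | a < s <= a + S]) (v := fun s => z (s + - a))
      (r := t - a)) => [||s /=|s /=|].
    - by lra.
    - by rewrite /=; lra.
    - by rewrite ltr_distl; lra.
    - by move=> sT _; rewrite Hz.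
    apply: (cont_at_shift (D := halfopen S)) => [s /=|]; first by lra.
    by apply: zc; lra.
  have [d d0 Hd] := v0 eps eps0; exists (Num.min d T) => [|t tS].
    by rewrite lt_min d0; lra.
  by rewrite lt_min => /andP[td tT]; rewrite Hv; [apply: Hd => //|]; lra.
split.
- exact: glue_cont Gu Gw uw ww.
- exact: glue_cont Gu' Gw' uw' ww'.
- move=> t tS; have [tT|Tt] := ltP t T.
    rewrite Gu'; last by lra.
    apply: (has_deriv_local (D := halfopen T) (v := e \o u) (r := T - t)) => [||s /=|s /=|].
    + by rewrite subr_gt0.
    + by rewrite /=; lra.
    + by rewrite ltr_distl; lra.
    + by move=> sT _; rewrite Gu.
    + by apply: ud; lra.
  rewrite Gw'; last by lra.
  apply: (has_deriv_local (D := [set s | a < s <= a + S]) (v := fun s => (e \o w) (s + - a))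
    (r := t - a)) => [||s /=|s /=|].
  + by lra.
  + by rewrite /=; lra.
  + by rewrite ltr_distl; lra.
  + by move=> sT _; rewrite Gw.
  apply: (has_deriv_shift (D := halfopen S)) => [s /=|]; first by lra.
  by apply: wd; lra.
- move=> eps eps0; have [d d0 Hd] := u0 eps eps0; exists (Num.min d T) => [|t tS].
    by rewrite lt_min d0; lra.
  by rewrite lt_min => /andP[td tT]; rewrite Gu; [apply: Hd => //|]; lra.
Qed.

End concatenation.

(* From here on, norms in the interpolation spaces are compared as they stand. *)
Opaque emb cinterp_norm Knorm.

(** * Elements of the solution space as curves in E_mu *)

Section curves.
Context {R : realType} {E0 E1 : completeNormedModType R}.
Variables (e : dense_embedding E0 E1) (mu : R).
Hypothesis mu01 : 0 < mu < 1.
Local Notation io := (emb e mu).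

Lemma evol_trace T t u u' (x : cinterp e mu) N : evol e mu T u u' (\val x) ->
  0 < t <= T -> wbd mu t u N -> wbd mu t u' N ->
  `|io (u t)| <= N / mu + `|x|.
Proof.
move=> uE tT uN u'N; have t0 : 0 < t by case/andP: tT.
apply: (trace_le mu01 t0); first by apply: uN; rewrite t0 lexx.
exact: evol_drift uE tT u'N.
Qed.

Lemma evol_trace_near (x0 : cinterp e mu) w : 0 < w -> exists2 d, 0 < d &
  forall T t u u' x N, evol e mu T u u' (\val x) -> 0 < t <= T -> t < d ->
  wbd mu t u N -> wbd mu t u' N ->
  `|io (u t) - x| <= N / mu + (w + `|x - x0|).
Proof.
move=> w0; have mu0 : 0 <= mu < 1 by mulra.
have [d d0 Hd] := Kfun_vanish x0 mu0 w0; exists d => // T t u u' x N uE tT td uN u'N.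
have t0 : 0 < t by case/andP: tT.
apply: (trace_dist mu01 t0).
- by apply: uN; rewrite t0 lexx.
- exact: evol_drift uE tT u'N.
- move=> s /andP[s0 st].
  have -> : \val x = \val x0 + \val (x - x0) by rewrite valB addrC subrK.
  apply: le_trans (KfunD e _ _ (ltW s0)) _; rewrite mulrDr; apply: lerD.
    by apply: Hd => //; exact: le_lt_trans td.
  exact: Kfun_le_cinterp.
- by apply: addr_ge0 (ltW w0) _.
Qed.

End curves.

(** * Compact embeddings *)

Section compactness.
Context {R : realType} {E0 E1 : completeNormedModType R}.
Variable e : dense_embedding E0 E1.

Lemma Kfun_attained_lt t x c : 0 <= t -> Kfun e t x < c ->
  exists a b, x = a + e b /\ `|a| + t * `|b| < c.
Proof.
move=> t0 Kc; have Kc0 : 0 < c - Kfun e t x by rewrite subr_gt0.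
have [_ [[a b] /= xab <-]] := inf_adherent Kc0 (Kfun_has_inf e x t0).
move=> H; exists a, b; split=> //; move: H; rewrite [X in _ < X](_ : _ = c)//.
by rewrite addrC; exact: subrK.
Qed.

Lemma bounded_setP (E : normedModType R) (B : set E) M :
  (forall b, B b -> `|b| <= M) -> bounded_set B.
Proof.
move=> H; exists M; split; first exact: num_real.
by move=> N MN b /= /H /le_trans; apply; exact: ltW.
Qed.

(** Compactness of E1 in E0 is inherited by E_theta: the K-functional at s splits a
    bounded family in E_theta into an error of order s^theta in E0 and a bounded
    family in E1, whose image in E0 converges along the ultrafilter. *)
Lemma compact_cauchy_E0 (T : Type) (U : set_system T) (D : set T) (u : T -> E1)
    theta K : compact_embedding e -> UltraFilter U -> U D -> 0 < theta <= 1 ->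
  (forall t, D t -> `|emb e theta (u t)| <= K) ->
  forall eps, 0 < eps -> exists A, [/\ U A, A `<=` D &
    forall s t, A s -> A t -> `|e (u s) - e (u t)| <= eps].
Proof.
move=> cpt UU UD th HK eps eps0.
have [t0 Dt0] := filter_ex UD.
have K0 : 0 <= K by apply: le_trans (HK t0 Dt0).
have th0 : 0 < theta by case/andP: th.
have th01 : 0 <= theta <= 1 by rewrite (ltW th0); case/andP: th.
have K2 : 0 < 2 * (K + 2) by apply: mulr_gt0 => //; apply: ltr_wpDl.
have [d d0 Hd] := powR_small th0 (divr_gt0 eps0 K2).
pose s := d / 2; have s0 : 0 < s by rewrite divr_gt0.
have sd : s < d by rewrite /s ltr_pdivrMr// mulr_natr mulr2n ltrDl.
have st0 : 0 < s `^ theta by apply: powR_gt0.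
have sK : 2 * (K + 2) * s `^ theta <= eps.
  by have := Hd s s0 sd; rewrite ler_pdivlMr// mulrC.
clearbody s.
have /choice[b Hb] : forall t, exists b, D t ->
    `|e (u t) - e b| <= (K + 1) * s `^ theta /\ s * `|b| <= (K + 1) * s `^ theta.
  move=> t; have [Dt|nD] := pselect (D t); last by exists 0.
  have : Kfun e s (e (u t)) < (K + 1) * s `^ theta.
    apply: (le_lt_trans (Kfun_embed_cinterp e (u t) th01 s0)).
    rewrite [ltRHS]mulrC ltr_pM2l//.
    apply: le_lt_trans (HK t Dt) _.
    by rewrite ltrDl.
  move=> /(Kfun_attained_lt (ltW s0))[a [b [-> ab]]]; exists b => _.
  rewrite addrK; split.
    by apply: le_trans (ltW ab); rewrite lerDl mulr_ge0// ltW.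
  by apply: le_trans (ltW ab); rewrite lerDr.
have bB : bounded_set (b @` D).
  apply: (bounded_setP (M := (K + 1) * s `^ theta / s)) => _ [t Dt <-].
  by rewrite ler_pdivlMr// mulrC; have [] := Hb t Dt.
have := cpt _ bB; rewrite precompactE => cB.
have GF : ProperFilter (e (b t) @[t --> U]) by apply: fmap_proper_filter.
have GB : (e (b t) @[t --> U]) (closure (e @` (b @` D))).
  suff : U [set t | closure (e @` (b @` D)) (e (b t))] by [].
  apply: filterS UD => t Dt; apply: subset_closure.
  by exists (b t) => //; exists t.
have [y [_ yG]] := cB _ GF GB.
have UW : U [set t | `|e (b t) - y| <= s `^ theta].
  have [//|UnW] := @in_ultra_setVsetC T U [set t : T | `|e (b t) - y| <= s `^ theta] UU.
  have nb : nbhs y (ball y (s `^ theta)) by exact: nbhsx_ballx.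
  have UnW' : (e (b t) @[t --> U]) [set z | ~ `|z - y| <= s `^ theta] by exact: UnW.
  have [z [nz]] := yG _ _ UnW' nb.
  by rewrite -ball_normE /ball_/= distrC => /ltW.
exists (D `&` [set t | `|e (b t) - y| <= s `^ theta]); split.
- exact: filterI.
- by move=> t [].
move=> r t [Dr Wr] [Dt Wt]; have [hr _] := Hb r Dr; have [ht _] := Hb t Dt.
apply: le_trans sK.
have -> : e (u r) - e (u t) = (e (u r) - e (b r)) - (e (u t) - e (b t)) +
  ((e (b r) - y) - (e (b t) - y)) by zmod.
apply: le_trans (ler_normD _ _) _.
have := ler_normB (e (u r) - e (b r)) (e (u t) - e (b t)).
have := ler_normB (e (b r) - y) (e (b t) - y).
move: Wr Wt hr ht => /=.
move: (`|e (b r) - y|) (`|e (b t) - y|) (`|e (u r) - e (b r)|) (`|e (u t) - e (b t)|).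
move: (`|_ - _ - _|) (`|_ - _ - _|) (s `^ theta) => *; clra.
Qed.

(** The K-functional at small s is bounded by the E_theta-norm times s^theta, which
    is o(s^mu), and elsewhere by the norm of E0. *)
Lemma compact_cauchy_interp (T : Type) (U : set_system T) (D : set T) (u : T -> E1)
    mu theta K : compact_embedding e -> UltraFilter U -> U D ->
  0 < mu -> mu < theta -> theta <= 1 ->
  (forall t, D t -> `|emb e theta (u t)| <= K) ->
  forall eps, 0 < eps -> exists A, U A /\
    forall s t, A s -> A t -> `|emb e mu (u s) - emb e mu (u t)| <= eps.
Proof.
move=> cpt UU UD mu0 muth th1 HK eps eps0.
have [t0 Dt0] := filter_ex UD.
have K0 : 0 <= K by apply: le_trans (HK t0 Dt0).
have mu01 : 0 <= mu <= 1 by rewrite (ltW mu0) (le_trans (ltW muth)).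
have th0 : 0 < theta by apply: lt_trans muth.
have th01 : 0 < theta <= 1 by rewrite th0.
have th01' : 0 <= theta <= 1 by rewrite ltW.
have K2 : 0 < 2 * K + 1 by rewrite ltr_wpDl// mulr_ge0.
have tm : 0 < theta - mu by rewrite subr_gt0.
have [d d0 Hd] := powR_small tm (divr_gt0 eps0 K2).
have d20 : 0 < d / 2 by rewrite divr_gt0.
have eta0 : 0 < (d / 2) `^ mu * eps by rewrite mulr_gt0// powR_gt0.
have [A [UA AD HA]] := compact_cauchy_E0 cpt UU UD th01 HK eta0.
exists A; split=> // r t Ar At; rewrite -embB//.
apply: cinterp_norm_le => s s0; rewrite (val_emb _ _ mu01).
have [sd|ds] := ltP s d.
  have -> : s `^ mu * eps = s `^ mu * (eps / (2 * K + 1) * (2 * K + 1)).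
    by rewrite divfK// gt_eqF.
  apply: le_trans (Kfun_embed_cinterp e _ th01' s0) _.
  rewrite -{1}(subrK mu theta) addrC -powRBM// -mulrA ler_wpM2l ?powR_ge0//.
  apply: ler_pM; rewrite ?powR_ge0//; first exact: Hd.
  rewrite embB//; apply: le_trans (ler_normB _ _) _.
  rewrite mulr_natl mulr2n -addrA; apply: lerD; first exact: HK (AD _ Ar).
  by apply: le_trans (HK _ (AD _ At)) _; rewrite lerDl.
apply: le_trans (Kfun_le_norm e _ (ltW s0)) _; rewrite linearB.
apply: le_trans (HA r t Ar At) _; rewrite ler_wpM2r ?(ltW eps0)//.
rewrite ge0_ler_powR ?nnegrE ?(ltW mu0) ?(ltW d20) ?(ltW s0)//.
by apply: le_trans ds; rewrite ler_pdivrMr// mulr_natr mulr2n lerDl ltW.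
Qed.

End compactness.

(** * Estimates of the nonlinearities *)

Section powers.
Context {R : realType}.

(** Smallness in the critical case a' = 0 comes from the size r' of the
    solution, and in the case rho = 0 from the length t of the interval. *)
Lemma critical_small (rho a a' K l eta : R) : 0 <= rho -> 0 < a -> 0 <= a' ->
  (rho = 0 -> a' = a) -> 0 < l -> 0 < eta ->
  exists2 r, 0 < r & forall t r', 0 < t <= r -> 0 <= r' <= r ->
    t `^ a + 2 * ((K `^ (1 - l) * r' `^ l) `^ rho * t `^ a') <= eta.
Proof.
move=> rho0 a0 a'0 aa l0 eta0; have e20 : 0 < eta / 2 by lra.
have e80 : 0 < eta / 8 by lra.
have [d1 d10 H1] := powR_small a0 e20; have [d2 d20 H2] := powR_small a0 e80.
have [rhoE|rhon] := eqVneq rho 0.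
  exists (Num.min (d1 / 2) (d2 / 2)) => [|t r' tr _]; first by rewrite lt_min; lra.
  rewrite le_min in tr; have := H1 t ltac:(lra) ltac:(lra).
  have := H2 t ltac:(lra) ltac:(lra); rewrite rhoE powRr0 (aa rhoE); lra.
have lr0 : 0 < l * rho by rewrite mulr_gt0// lt_def rhon.
pose Q := (K `^ (1 - l)) `^ rho; have Q0 : 0 < Q + 1 by rewrite ltr_wpDl// powR_ge0.
have [d3 d30 H3] := powR_small lr0 (divr_gt0 e80 Q0).
exists (Num.min 1 (Num.min (d1 / 2) (d3 / 2))) => [|t r' tr r'r].
  by rewrite !lt_min; lra.
rewrite !le_min in tr r'r; have h1 := H1 t ltac:(lra) ltac:(lra).
have h2 : t `^ a' <= 1.
  by rewrite -(powRr0 t) ger_powR//; lra.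
have h3 : (K `^ (1 - l) * r' `^ l) `^ rho <= eta / 8.
  rewrite powRM ?powR_ge0// -(powRrM r') -/Q.
  have [r'0|r'0] := ltP 0 r'; last first.
    have -> : r' = 0 by lra.
    by rewrite powR0 ?gt_eqF// mulr0; lra.
  have := H3 r' r'0 ltac:(lra); rewrite ler_pdivlMr//.
  by have := powR_ge0 r' (l * rho); lra.
have h4 : (K `^ (1 - l) * r' `^ l) `^ rho * t `^ a' <= eta / 8.
  by apply: le_trans (ler_wpM2l (powR_ge0 _ _) h2) _; rewrite mulr1.
lra.
Qed.

Lemma finite_min (m : nat) (P : 'I_m -> R -> Prop) :
  (forall j, exists2 r, 0 < r & forall r', 0 < r' -> r' <= r -> P j r') ->
  exists2 r, 0 < r & forall j r', 0 < r' -> r' <= r -> P j r'.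
Proof.
move=> H; have /choice[r Hr] : forall j, exists r, 0 < r /\
    forall r', 0 < r' -> r' <= r -> P j r'.
  by move=> j; have [r r0 Hr] := H j; exists r.
have s0 : 0 < 1 + \sum_j (r j)^-1.
  by rewrite ltr_pwDl// sumr_ge0// => j _; rewrite invr_ge0 ltW// (Hr j).1.
exists (1 + \sum_j (r j)^-1)^-1 => [|j r' r'0 r'r]; first by rewrite invr_gt0.
have rj := (Hr j).1; apply: (Hr j).2 => //; apply: le_trans r'r _.
rewrite -[leRHS]invrK lef_pV2 ?posrE ?invr_gt0//.
rewrite (bigD1 j)//= addrCA lerDl addr_ge0// sumr_ge0// => i _.
by rewrite invr_ge0 ltW// (Hr i).1.
Qed.

End powers.

Section nonlinearity.
Context {R : realType} {E0 E1 : completeNormedModType R}.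
Variables (e : dense_embedding E0 E1) (mu : R).
Hypothesis mu01 : 0 < mu < 1.
Variable V : set (cinterp e mu).
Hypothesis Vopen : open V.
Variables (A : cinterp e mu -> {linear E1 -> E0}) (F1 : cinterp e mu -> E0).
Hypothesis A_maxreg : forall x, V x -> maximal_regularity e mu (A x).
Hypothesis AF1_lipschitz : forall x0, V x0 -> exists r L : R, 0 < r /\
    forall x y, V x -> V y -> ball x0 r x -> ball x0 r y ->
      (opnorm (fun b => A x b - A y b)%R <= (L * `|x - y|)%:E)%E /\
      `|F1 x - F1 y| <= L * `|x - y|.
Variable beta : R.
Hypothesis mu_beta : mu < beta < 1.
Variables (F2 : cinterp e beta -> E0) (m : nat) (betas rhos : 'I_m -> R).
Hypotheses (betas_itv : forall j, mu <= betas j <= beta)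
  (rhos_ge0 : forall j, 0 <= rhos j)
  (subcritical : forall j,
    (rhos j * (beta - mu) + (betas j - mu)) / (1 - mu) <= 1)
  (F2_growth : forall x0, V x0 -> forall r : R, 0 < r ->
    exists2 C : R, 0 < C & forall x1 x2 : cinterp e beta,
      let y1 := to_cinterp e mu (\val x1) in
      let y2 := to_cinterp e mu (\val x2) in
      V y1 -> V y2 -> closed_ball x0 r y1 -> closed_ball x0 r y2 ->
      `|F2 x1 - F2 x2| <=
        C * \sum_(j < m) (1 + `|x1| `^ rhos j + `|x2| `^ rhos j) *
              `|to_cinterp e (betas j) (\val x1 - \val x2)|).

Local Notation io := (emb e mu).
Local Notation iob := (emb e beta).

Let mu01' : 0 <= mu <= 1. Proof. by mulra. Qed.
Let beta01 : 0 <= beta <= 1. Proof. by have ? := mu_beta; mulra. Qed.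

(** By interpolation, t^(1 - mu) times the j-th term of the growth condition is at
    most n times t^(1 - betas j) + 2 c t^(1 - betas j - rhos j (beta - mu)), where
    c is small with the weighted E1-norms of b1 and b2 unless rhos j = 0. *)
Lemma F2_small x0 (eta : R) : V x0 -> 0 < eta ->
  exists2 r, 0 < r & forall t b1 b2 n, 0 < t <= r ->
    V (io b1) -> V (io b2) -> `|io b1 - x0| <= 1 -> `|io b2 - x0| <= 1 ->
    wt mu t * `|b1| <= r -> wt mu t * `|b2| <= r ->
    `|io (b1 - b2)| <= n -> wt mu t * `|b1 - b2| <= n ->
    wt mu t * `|F2 (iob b1) - F2 (iob b2)| <= eta * n.
Proof.
move=> Vx0 eta0; have [C C0 HC] := F2_growth Vx0 ltr01.
have mub := mu_beta; have mu1 : 0 < 1 - mu by mulra.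
have mb1 : mu <= beta <= 1 by lra.
have mbj j : mu <= betas j <= 1 by have := betas_itv j; lra.
pose K := `|x0| + 1; have K0 : 0 <= K by rewrite addr_ge0.
pose l := (beta - mu) / (1 - mu).
have l0 : 0 < l by rewrite divr_gt0//; lra.
pose eta' := eta / C / m.+1%:R.
have eta'0 : 0 < eta' by rewrite !divr_gt0.
have [r r0 Hr] : exists2 r, 0 < r & forall j r', 0 < r' -> r' <= r ->
    forall t, 0 < t <= r' -> t `^ (1 - betas j) +
      2 * ((K `^ (1 - l) * r' `^ l) `^ rhos j *
           t `^ (1 - betas j - rhos j * (beta - mu))) <= eta'.
  apply: (finite_min (P := fun j r' => forall t, 0 < t <= r' -> t `^ (1 - betas j) +
      2 * ((K `^ (1 - l) * r' `^ l) `^ rhos j *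
           t `^ (1 - betas j - rhos j * (beta - mu))) <= eta')) => j.
  have bj := betas_itv j; have := subcritical j; rewrite ler_pdivrMr// mul1r => sj.
  have [r r0 Hr] := @critical_small R (rhos j) (1 - betas j)
    (1 - betas j - rhos j * (beta - mu)) K l eta' (rhos_ge0 j) ltac:(lra) ltac:(lra)
    ltac:(by move=> ->; rewrite mul0r subr0) l0 eta'0.
  by exists r => // r' r'0 r'r t tr'; apply: Hr; lra.
exists (Num.min r 1) => [|t b1 b2 n]; first by rewrite lt_min r0/=.
set r' := Num.min r 1; have r'0 : 0 < r' by rewrite lt_min r0/=.
have r'r : r' <= r by rewrite ge_min lexx.
move=> tr' V1 V2 x1 x2 b1r b2r bn bn'.
have n0 : 0 <= n by apply: le_trans bn.
have toE b : to_cinterp e mu (\val (iob b)) = io b by rewrite (val_emb _ _ beta01).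
have cb b : `|io b - x0| <= 1 -> closed_ball x0 1 (io b).
  by rewrite closed_ballE// /closed_ball_/= distrC.
have := HC (iob b1) (iob b2); rewrite /= !toE => /(_ V1 V2 (cb _ x1) (cb _ x2)).
move=> /(ler_wpM2l (wt_ge0 mu t)) /le_trans; apply.
have aux (a : R) : 0 < a -> eta * n = C * (a * (eta / C / a * n)).
  by move=> a0; field; rewrite !gt_eqF.
rewrite mulrCA mulr_sumr (aux m.+1%:R)// -/eta'.
rewrite ler_wpM2l ?(ltW C0)//.
apply: (@le_trans _ _ (\sum_(j < m) eta' * n)); last first.
  by rewrite sumr_const card_ord mulr_natl mulrS lerDr mulr_ge0// ltW.
apply: ler_sum => j _.
have bj := betas_itv j; have := subcritical j; rewrite ler_pdivrMr// mul1r => sj.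
have t0 : 0 < t by case/andP: tr'.
have ioK b : `|io b - x0| <= 1 -> `|io b| <= K.
  move=> ib; rewrite -[io b](subrK x0) addrC; apply: le_trans (ler_normD _ _) _.
  by rewrite /K lerD2l.
have bnd b : `|io b - x0| <= 1 -> wt mu t * `|b| <= r' ->
    `|iob b| `^ rhos j <= (K `^ (1 - l) * r' `^ l) `^ rhos j * t `^ (- (rhos j * (beta - mu))).
  move=> ib br.
  have := @interpolation_le _ _ _ e mu mu01 beta b t K r' mb1 t0 K0 (ltW r'0)
    (ioK b ib) br.
  rewrite -/l => H.
  have {}H : `|iob b| <= K `^ (1 - l) * r' `^ l * t `^ (- (beta - mu)).
    by rewrite powRN ler_pdivlMr ?powR_gt0// mulrC.
  have := ge0_ler_powR (rhos_ge0 j) _ _ H; rewrite !nnegrE => /(_ (normr_ge0 _)).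
  rewrite !mulr_ge0 ?powR_ge0// => /(_ isT); rewrite powRM ?mulr_ge0 ?powR_ge0//.
  by rewrite -powRrM mulNr (mulrC (beta - mu)).
have d1 := bnd _ x1 b1r; have d2 := bnd _ x2 b2r.
have dj : `|to_cinterp e (betas j) (\val (iob b1) - \val (iob b2))| <= n * t `^ (mu - betas j).
  have -> : to_cinterp e (betas j) (\val (iob b1) - \val (iob b2)) = emb e (betas j) (b1 - b2).
    by rewrite !(val_emb _ _ beta01) -linearB.
  have := @interpolation_le _ _ _ e mu mu01 (betas j) (b1 - b2) t n n (mbj j) t0 n0 n0 bn bn'.
  rewrite powR_split// => H.
  by rewrite -(opprB (betas j) mu) powRN ler_pdivlMr ?powR_gt0// mulrC.
pose P := (K `^ (1 - l) * r' `^ l) `^ rhos j.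
apply: (@le_trans _ _ (wt mu t * ((1 + 2 * (P * t `^ (- (rhos j * (beta - mu))))) *
    (n * t `^ (mu - betas j))))).
  rewrite ler_wpM2l ?wt_ge0//; apply: ler_pM => //.
  by rewrite -addrA lerD2l mulr_natl mulr2n; exact: lerD d1 d2.
have -> : wt mu t * ((1 + 2 * (P * t `^ (- (rhos j * (beta - mu))))) *
    (n * t `^ (mu - betas j))) = (wt mu t * t `^ (mu - betas j) +
      2 * (P * (wt mu t * t `^ (mu - betas j) * t `^ (- (rhos j * (beta - mu)))))) * n by ring.
rewrite /wt !powRBM// (_ : 1 - mu + (mu - betas j) = 1 - betas j); last by ring.
by rewrite ler_wpM2r//; apply: Hr.
Qed.

Lemma local_lipschitz x0 : V x0 -> exists r L, [/\ 0 < r, 0 <= L,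
  forall x, `|x - x0| <= r -> V x &
  forall x y, `|x - x0| <= r -> `|y - x0| <= r ->
    (forall b, `|A x b - A y b| <= L * `|x - y| * `|b|) /\
    `|F1 x - F1 y| <= L * `|x - y|].
Proof.
move=> Vx0; have [r [L [r0 HL]]] := AF1_lipschitz Vx0.
have /nbhs_ballP[d /= d0 Hd] : nbhs x0 V by apply: open_nbhs_nbhs.
pose r1 := Num.min (r / 2) (d / 2); have r10 : 0 < r1 by rewrite lt_min; lra.
have r1r : r1 < r by rewrite gt_min; lra.
have r1d : r1 < d by rewrite gt_min; lra.
have Vr x : `|x - x0| <= r1 -> V x.
  move=> xr; apply: Hd; rewrite -ball_normE /ball_/= distrC.
  exact: le_lt_trans r1d.
have Br x : `|x - x0| <= r1 -> ball x0 r x.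
  by move=> xr; rewrite -ball_normE /ball_/= distrC; exact: le_lt_trans r1r.
exists r1, `|L|; split=> [//|//|//|x y xr yr].
have [HA HF] := HL x y (Vr x xr) (Vr y yr) (Br x xr) (Br y yr).
have LL : L * `|x - y| <= `|L| * `|x - y| by rewrite ler_wpM2r// ler_norm.
split=> [b|]; last exact: le_trans LL.
by apply: le_trans (opnorm_le HA b) _; rewrite ler_wpM2r.
Qed.

(** The right-hand side of the problem, with the principal part frozen at x0. *)
Definition rhs (x0 : cinterp e mu) (b : E1) : E0 :=
  (A x0 b - A (io b) b) + F1 (io b) + F2 (iob b).

Lemma rhs_small x0 (eta : R) : V x0 -> 0 < eta ->
  exists r, [/\ 0 < r, forall x, `|x - x0| <= r -> V x &
   forall t b1 b2 n, 0 < t <= r -> `|io b1 - x0| <= r -> `|io b2 - x0| <= r ->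
    wt mu t * `|b1| <= r -> wt mu t * `|b2| <= r ->
    `|io (b1 - b2)| <= n -> wt mu t * `|b1 - b2| <= n ->
    wt mu t * `|rhs x0 b1 - rhs x0 b2| <= eta * n].
Proof.
move=> Vx0 eta0; have [rL [L [rL0 L0 VL HL]]] := local_lipschitz Vx0.
have e20 : 0 < eta / 2 by lra.
have [r2 r20 H2] := F2_small Vx0 e20.
have L1 : 0 < L + 1 by lra.
have e80 : 0 < eta / 8 / (L + 1) by rewrite divr_gt0//; lra.
have [d d0 Hd] := wt_small mu01 e80.
have [r [r0 rrL rr2 r_1 [rd re]]] : exists r, [/\ 0 < r, r <= rL, r <= r2, r <= 1 &
    r <= d / 2 /\ r <= eta / 8 / (L + 1)].
  exists (Num.min (Num.min rL r2) (Num.min (Num.min 1 (d / 2)) (eta / 8 / (L + 1)))).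
  by split; last split;
    rewrite ?lt_min ?ge_min ?lexx ?rL0 ?r20 ?e80 ?ltr01 ?divr_gt0 ?orbT.
exists r; split=> [//|x xr|t b1 b2 n tr x1 x2 b1r b2r bn bn'].
  exact: VL (le_trans xr rrL).
have n0 : 0 <= n by apply: le_trans bn.
have w0 := wt_ge0 mu t.
have tr2 : 0 < t <= r2 by clra.
have dF2 := H2 t b1 b2 n tr2 (VL _ (le_trans x1 rrL)) (VL _ (le_trans x2 rrL))
  (le_trans x1 r_1) (le_trans x2 r_1) (le_trans b1r rr2) (le_trans b2r rr2) bn bn'.
have [A12 F12] := HL _ _ (le_trans x1 rrL) (le_trans x2 rrL).
have x00 : `|x0 - x0| <= rL by rewrite subrr normr0 ltW.
have [A10 _] := HL _ _ x00 (le_trans x1 rrL).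
rewrite -embB// in F12 A12.
have -> : rhs x0 b1 - rhs x0 b2 =
    (A x0 (b1 - b2) - A (io b1) (b1 - b2)) - (A (io b1) b2 - A (io b2) b2) +
    (F1 (io b1) - F1 (io b2)) + (F2 (iob b1) - F2 (iob b2)).
  by rewrite /rhs (linearB (A x0)) (linearB (A (io b1))); zmod.
have h1 : `|A x0 (b1 - b2) - A (io b1) (b1 - b2)| <= L * r * `|b1 - b2|.
  apply: le_trans (A10 _) _; rewrite ler_wpM2r// ler_wpM2l// distrC.
  exact: x1.
have h2 : `|A (io b1) b2 - A (io b2) b2| <= L * n * `|b2|.
  by apply: le_trans (A12 _) _; rewrite ler_wpM2r// ler_wpM2l.
have h3 : `|F1 (io b1) - F1 (io b2)| <= L * n by apply: le_trans F12 _; rewrite ler_wpM2l.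
have Lr : L * r <= eta / 8.
  by move: re; rewrite ler_pdivlMr// mulrDr mulr1 mulrC; clra.
have Lw : L * wt mu t <= eta / 8.
  have td : 0 < t /\ t < d by clra.
  have := Hd t td.1 td.2; rewrite ler_pdivlMr// mulrDr mulr1 (mulrC L).
  by clra.
have k1 : wt mu t * (L * r * `|b1 - b2|) <= eta / 8 * n.
  rewrite mulrCA; apply: ler_pM => //; first by rewrite mulr_ge0// ltW.
  by rewrite mulr_ge0.
have k2 : wt mu t * (L * n * `|b2|) <= eta / 8 * n.
  have -> : wt mu t * (L * n * `|b2|) = L * (wt mu t * `|b2|) * n by ring.
  by rewrite ler_wpM2r//; apply: le_trans Lr; rewrite ler_wpM2l.
have k3 : wt mu t * (L * n) <= eta / 8 * n.
  by rewrite mulrA (mulrC (wt mu t)) ler_wpM2r.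
have := ler_wpM2l w0 h1; have := ler_wpM2l w0 h2; have := ler_wpM2l w0 h3.
set a1 := A x0 _ - _ in h1 *; set a2 := A (io b1) b2 - _ in h2 *.
set a3 := F1 _ - _ in h3 *; set a4 := F2 _ - _ in dF2 *.
have := ler_wpM2l w0 (ler_normD (a1 - a2 + a3) a4).
have := ler_wpM2l w0 (ler_normD (a1 - a2) a3).
have := ler_wpM2l w0 (ler_normB a1 a2).
have := mulr_ge0 (ltW eta0) n0.
clearbody a1 a2 a3 a4; clra.
Qed.

(** Continuity at positive times follows from [rhs_small]. At 0, F2 is compared
    with its value at a fixed element b0 of E1 near x0, because F2 need not be
    defined at x0. *)
Lemma rhs_wvan x0 : V x0 -> exists2 r, 0 < r & forall T (v : R -> E1), T <= r ->
  wvan mu T v ->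
  (forall t, 0 < t <= T -> `|io (v t) - x0| <= r /\ wt mu t * `|v t| <= r) ->
  wvan mu T (fun t => rhs x0 (v t)).
Proof.
move=> Vx0.
have [r1 [r10 Vr1 H1]] := rhs_small Vx0 ltr01.
have [rL [L [rL0 L0 VL HL]]] := local_lipschitz Vx0.
have [r [r0 rr1 rrL r_1]] : exists r, [/\ 0 < r, r <= r1, r <= rL & r <= 1].
  exists (Num.min (Num.min r1 rL) 1).
  by split; rewrite ?lt_min ?ge_min ?lexx ?r10 ?rL0 ?ltr01 ?orbT.
have [c c0 Hc] := emb_bounded e mu01'.
exists r => // T v Tr vw vr; split=> [t tT|] eps eps0.
  have t20 : 0 < t / 2 by lra.
  have w0 : 0 < wt mu (t / 2) by apply: wt_gt0.
  have c1 : 0 < c + 1 by lra.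
  have ec0 : 0 < eps * wt mu (t / 2) / (c + 1) by rewrite divr_gt0 ?mulr_gt0.
  have [d d0 Hd] := vw.1 t tT _ ec0.
  exists (Num.min d (t / 2)) => [|s sT]; rewrite lt_min ?d0// => /andP[sd st].
  have ts : t / 2 <= s by move: st; rewrite ltr_distl; lra.
  pose m0 := Num.min s t.
  have m00 : 0 < m0 by rewrite lt_min; move: sT tT => /= /andP[-> _] /andP[-> _].
  have m0s : m0 <= s by rewrite ge_min lexx.
  have m0t : m0 <= t by rewrite ge_min lexx orbT.
  have tm0 : t / 2 <= m0 by rewrite le_min ts/=; lra.
  have m01 : m0 <= 1 by lra.
  have m0r1 : 0 < m0 <= r1 by rewrite m00/=; lra.
  have wm0 : wt mu (t / 2) <= wt mu m0 by apply: wt_mono => //; exact: ltW.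
  clearbody m0.
  have [vs1 vs2] := vr s sT; have [vt1 vt2] := vr t tT.
  have b1 : wt mu m0 * `|v s| <= r1.
    apply: le_trans rr1; apply: le_trans vs2; rewrite ler_wpM2r//.
    by apply: wt_mono => //; exact: ltW.
  have b2 : wt mu m0 * `|v t| <= r1.
    apply: le_trans rr1; apply: le_trans vt2; rewrite ler_wpM2r//.
    by apply: wt_mono => //; exact: ltW.
  have n1 : `|io (v s - v t)| <= (c + 1) * `|v s - v t|.
    by apply: le_trans (Hc _) _; rewrite ler_wpM2r// lerDl.
  have n2 : wt mu m0 * `|v s - v t| <= (c + 1) * `|v s - v t|.
    rewrite ler_wpM2r//; have := @wt_le1 _ mu mu01 m0; rewrite (ltW m00) => /(_ m01).
    by move=> /le_trans; apply; rewrite lerDr ltW.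
  have H := H1 m0 _ _ _ m0r1 (le_trans vs1 rr1) (le_trans vt1 rr1) b1 b2 n1 n2.
  rewrite mul1r in H; rewrite -(ler_pM2l w0).
  apply: le_trans (ler_wpM2r (normr_ge0 _) wm0) _; apply: le_trans H _.
  by have := Hd s sT sd; rewrite ler_pdivlMr// mulrC (mulrC eps).
have [b0 Hb0] := emb_dense x0 mu01' r0.
pose n := 2 * r + `|b0|; have n0 : 0 < n + 1.
  by rewrite /n; have := normr_ge0 b0; lra.
have e80 : 0 < eps / 8 by lra.
have [r2 r20 H2] := F2_small Vx0
  (divr_gt0 e80 n0).
have Lr0 : 0 < L * r + 1 by have := mulr_ge0 L0 (ltW r0); lra.
have [d1 d10 H3] := vw.2 _ r20.
have [d2 d20 H4] := vw.2 _ (divr_gt0 e80 Lr0).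
have [_ /(_ _ r20)[d3 d30 H5]] := wvan_cst mu01 T b0.
have [_ /(_ _ e80)[d4 d40 H6]] := wvan_cst mu01 T (F2 (iob b0)).
have [_ /(_ _ e80)[d5 d50 H7]] := wvan_cst mu01 T (F1 x0).
have [d6 d60 H8] := wt_small mu01 (divr_gt0 e80 Lr0).
exists (Num.min (Num.min d1 d2) (Num.min (Num.min d3 d4) (Num.min (Num.min d5 d6) r2))).
  by rewrite !lt_min d10 d20 d30 d40 d50 d60.
move=> t tT; rewrite !lt_min.
move=> /andP[/andP[t1 t2] /andP[/andP[t3 t4] /andP[/andP[t5 t6] tr2]]].
have [vt1 vt2] := vr t tT; have w0 := wt_ge0 mu t.
have t0 : 0 < t by case/andP: tT.
have tr2' : 0 < t <= r2 by rewrite t0 ltW.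
have wle1 : wt mu t <= 1.
  by apply: (wt_le1 mu01); rewrite (ltW t0)/= (le_trans (proj2 (andP tT)))// (le_trans Tr).
have nb1 : `|io (v t - b0)| <= n.
  rewrite embB// -[io (v t)](subrK x0) -addrA; apply: le_trans (ler_normD _ _) _.
  apply: (@le_trans _ _ (r + r)); first by apply: (lerD vt1); rewrite distrC; exact: Hb0.
  by rewrite /n mulr_natl mulr2n lerDl.
have nb2 : wt mu t * `|v t - b0| <= n.
  apply: le_trans (ler_wpM2l w0 (ler_normB _ _)) _; rewrite mulrDr /n.
  apply: lerD; last by rewrite ler_piMl.
  by apply: le_trans vt2 _; rewrite mulr_natl mulr2n lerDl ltW.
have F2b := H2 t _ _ n tr2' (VL _ (le_trans vt1 rrL)) (VL _ (le_trans Hb0 rrL))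
  (le_trans vt1 r_1) (le_trans Hb0 r_1) (H3 t tT t1) (H5 t tT t3) nb1 nb2.
have x00 : `|x0 - x0| <= rL by rewrite subrr normr0 ltW.
have [/(_ (v t)) Ab Fb] := HL _ _ x00 (le_trans vt1 rrL).
rewrite (distrC x0) in Ab Fb; rewrite (distrC (F1 x0)) in Fb.
have Lvr : L * `|io (v t) - x0| <= L * r + 1.
  by apply: le_trans (ler_wpM2l L0 vt1) _; rewrite lerDl.
have h1 : wt mu t * `|A x0 (v t) - A (io (v t)) (v t)| <= eps / 8.
  apply: (@le_trans _ _ (wt mu t * ((L * r + 1) * `|v t|))).
    apply: (ler_wpM2l w0); apply: (le_trans Ab); exact: (ler_wpM2r (normr_ge0 _) Lvr).
  by have := H4 t tT t2; rewrite ler_pdivlMr// mulrCA mulrC.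
have h2 : wt mu t * `|F1 (io (v t)) - F1 x0| <= eps / 8.
  apply: (@le_trans _ _ (wt mu t * (L * r + 1))).
    by apply: (ler_wpM2l w0); exact: (le_trans Fb Lvr).
  by have := H8 t t0 t6; rewrite ler_pdivlMr.
have h3 := H6 t tT t4; have h4 := H7 t tT t5.
have h5 : wt mu t * `|F2 (iob (v t)) - F2 (iob b0)| <= eps / 8.
  apply: le_trans F2b _; rewrite mulrAC ler_pdivrMr//.
  by rewrite ler_wpM2l ?(ltW e80)// lerDl.
have -> : rhs x0 (v t) = (A x0 (v t) - A (io (v t)) (v t)) + (F1 (io (v t)) - F1 x0) +
   (F2 (iob (v t)) - F2 (iob b0)) + F2 (iob b0) + F1 x0 by rewrite /rhs; zmod.
move: h1 h2 h3 h4 h5.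
move: (A x0 (v t) - A (io (v t)) (v t)) (F1 (io (v t)) - F1 x0) (F2 (iob (v t)) - F2 (iob b0)) => a1 a2 a3.
move: (F2 (iob b0)) (F1 x0) => a4 a5.
move=> h1 h2 h3 h4 h5.
have := ler_wpM2l w0 (ler_normD (a1 + a2 + a3 + a4) a5).
have := ler_wpM2l w0 (ler_normD (a1 + a2 + a3) a4).
have := ler_wpM2l w0 (ler_normD (a1 + a2) a3).
have := ler_wpM2l w0 (ler_normD a1 a2).
clra.
Qed.

(** * Local solutions *)

Definition sol (x : cinterp e mu) T (u : R -> E1) (u' : R -> E0) :=
  [/\ evol e mu T u u' (\val x), V x, forall t, 0 < t <= T -> V (io (u t)) &
    forall t, 0 < t <= T ->
      u' t + A (io (u t)) (u t) = F1 (io (u t)) + F2 (iob (u t))].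

Lemma sol_lsol x0 x T u u' : sol x T u u' ->
  lsol e mu (A x0) T (fun t => rhs x0 (u t)) (\val x) u u'.
Proof.
move=> [uE _ _ uS]; split=> // t tT; rewrite /rhs -addrA -(uS t tT).
by zmod.
Qed.

Lemma lsol_sol x0 x T u u' : V x -> (forall t, 0 < t <= T -> V (io (u t))) ->
  lsol e mu (A x0) T (fun t => rhs x0 (u t)) (\val x) u u' -> sol x T u u'.
Proof.
move=> Vx Vu [uE uS]; split=> // t tT.
apply: (addrI (A x0 (u t) - A (io (u t)) (u t))).
rewrite (addrA _ (F1 _)) -[RHS](uS t tT); zmod.
Qed.

Definition near_on (x0 : cinterp e mu) T (u : R -> E1) r :=
  forall t, 0 < t <= T -> `|io (u t) - x0| <= r /\ wt mu t * `|u t| <= r.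

(** The solutions near x0 depend on their initial values in a Lipschitz way:
    their difference solves a linear problem whose right-hand side is a small
    multiple of the difference itself. *)
Lemma sol_lipschitz x0 : V x0 -> exists C r, [/\ 0 < C, 0 < r &
  forall T x1 x2 u1 u1' u2 u2', 0 < T <= r -> sol x1 T u1 u1' -> sol x2 T u2 u2' ->
    near_on x0 T u1 r -> near_on x0 T u2 r ->
    wbd mu T (fun t => u1 t - u2 t) (C * `|x1 - x2|) /\
    wbd mu T (fun t => u1' t - u2' t) (C * `|x1 - x2|)].
Proof.
move=> Vx0; have mu0 : 0 < mu by mulra.
have [M [T0 [c [M0 T00 Ac _ HM]]]] := maximal_regularity_bound mu01 (A_maxreg Vx0).
have eta0 : 0 < mu / (2 * M) by rewrite divr_gt0// mulr_gt0.
have [r1 [r10 _ H1]] := rhs_small Vx0 eta0.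
pose r := Num.min r1 T0; have r0 : 0 < r by rewrite lt_min r10.
have rr1 : r <= r1 by rewrite ge_min lexx.
have rT0 : r <= T0 by rewrite ge_min lexx orbT.
exists (mu + 2 * M), r; split=> // [|T x1 x2 u1 u1' u2 u2' Tr uS1 uS2 ur1 ur2].
  by rewrite addr_gt0// mulr_gt0.
clearbody r.
have TT : 0 < T <= T0 by lra.
have T1 : 0 < T by lra.
have Tr1 t : 0 < t <= T -> 0 < t <= r1 by lra.
have wS := lsolB (sol_lsol x0 uS1) (sol_lsol x0 uS2).
rewrite -valB in wS.
have [[wc wc' _ _] _] := wS.
pose N := Num.max (wnorm mu T (fun t => u1 t - u2 t))
  (wnorm mu T (fun t => u1' t - u2' t)).
have N1 : wbd mu T (fun t => u1 t - u2 t) N.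
  by apply: wbd_le (wnorm_ub mu01 wc); rewrite le_max lexx.
have N2 : wbd mu T (fun t => u1' t - u2' t) N.
  by apply: wbd_le (wnorm_ub mu01 wc'); rewrite le_max lexx orbT.
have N0 : 0 <= N by rewrite le_max (wnorm_ge0 mu01 T1 wc).
have NN : N <= N / mu by rewrite ler_pdivlMr// ler_piMr//; mulra.
have dn : wbd mu T (fun t => rhs x0 (u1 t) - rhs x0 (u2 t))
    (mu / (2 * M) * (N / mu + `|x1 - x2|)).
  move=> t tT; have [a1 b1] := ur1 t tT; have [a2 b2] := ur2 t tT.
  apply: (H1 _ _ _ _ (Tr1 t tT) (le_trans a1 rr1) (le_trans a2 rr1)
    (le_trans b1 rr1) (le_trans b2 rr1)).
    apply: (evol_trace mu01 wS.1 tT).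
      by apply: wbd_restrict N1; case/andP: tT.
    by apply: wbd_restrict N2; case/andP: tT.
  by apply: le_trans (N1 t tT) _; apply: le_trans NN _; rewrite lerDl.
have [w1 w2] := HM _ _ _ _ _ _ TT wS dn.
have NE : N <= M * (mu / (2 * M) * (N / mu + `|x1 - x2|) + `|x1 - x2|).
  rewrite ge_max; apply/andP; split; exact: wnorm_le.
have ME : M * (mu / (2 * M) * (N / mu + `|x1 - x2|) + `|x1 - x2|) =
    N / 2 + (mu / 2 + M) * `|x1 - x2|.
  by move: mu0 M0; move: (`|x1 - x2|) => dx *; field; rewrite !gt_eqF.
rewrite ME in NE.
have {}NE : N <= (mu + 2 * M) * `|x1 - x2|.
  by move: NE; move: (`|x1 - x2|) => dx NE; clra.
by split; [exact: wbd_le N1 | exact: wbd_le N2].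
Qed.

(** Contraction around the solution us of the frozen linear problem that starts at
    x0 with right-hand side 0. The iterates solve linear problems with the exact
    initial value x and stay in the set W of functions whose weighted norms are at
    most r1; by the trace estimate they stay near x0 in E_mu. The radius r is
    chosen for a contraction constant 1/16, then the interval so short that us
    and rhs x0 us are small compared with r1, then eps. *)
Lemma sol_exists x0 rho : V x0 -> 0 < rho -> exists tau eps,
  [/\ 0 < tau, tau <= rho, 0 < eps & forall x : cinterp e mu, `|x - x0| <= eps ->
    exists u u', sol x tau u u' /\ near_on x0 tau u rho].
Proof.
move=> Vx0 rho0; have mu0 : 0 < mu by mulra.
have mu1 : mu < 1 by mulra.
have [M [T0 [c [M0 T00 Ac lsolve HM]]]] := maximal_regularity_bound mu01 (A_maxreg Vx0).
have eta0 : 0 < mu / (16 * M) by rewrite divr_gt0// mulr_gt0.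
have [ra [ra0 Va H1]] := rhs_small Vx0 eta0.
have [rb rb0 Hw] := rhs_wvan Vx0.
have [r r0 /= /and5P[/ltW rra /ltW rrb /ltW rrho /ltW rT0 _]] :=
  @pos_lt_all R [:: ra; rb; rho; T0] ltac:(by rewrite /= ra0 rb0 rho0 T00).
pose r1 := mu * r / 4; have r10 : 0 < r1 by rewrite !divr_gt0// mulr_gt0.
have r1r : r1 <= r / 4 by rewrite /r1 ler_pM2r// ler_piMl// ltW.
have r1mu : r1 / mu = r / 4 by rewrite /r1; field; rewrite gt_eqF.
have r40 : 0 < r / 4 by rewrite divr_gt0.
have [d1 d10 Htr] := evol_trace_near mu01 x0 r40.
(* the reference solution of the linear problem that starts at x0 *)
have TT0 : 0 < T0 <= T0 by rewrite T00 lexx.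
have [us [us' usS]] := lsolve T0 (fun=> 0) x0 TT0 (wvan_cst mu01 T0 0).
have [[usw usw' _ _] _] := usS.
have r140 : 0 < r1 / 4 by rewrite divr_gt0.
have [d2 d20 Hus] := wvan_wbd_small r140 usw.
have [d3 d30 Hus'] := wvan_wbd_small r140 usw'.
have [tau1 tau10 /= /and5P[/ltW tau1r t1d1 t1d2 t1d3 _]] :=
  @pos_lt_all R [:: r; d1; d2; d3] ltac:(by rewrite /= r0 d10 d20 d30).
have t1T0 : tau1 <= T0 by apply: le_trans rT0.
have us1 := Hus _ t1T0 t1d2; have us1' := Hus' _ t1T0 t1d3.
(* the trace estimate keeps the functions of weighted norm at most r1 near x0 *)
have nearW T x u u' N : T <= tau1 -> evol e mu T u u' (\val x) ->
    `|x - x0| <= r / 8 -> N <= r1 ->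
    wbd mu T u N -> wbd mu T u' N -> near_on x0 T u r.
  move=> Tt uE xx0 Nr1 uN u'N t tT.
  have td : t < d1 by apply: le_lt_trans t1d1; apply: le_trans Tt; case/andP: tT.
  have tT' : t <= T by case/andP: tT.
  have := Htr _ _ _ _ _ _ uE tT td (wbd_restrict tT' uN) (wbd_restrict tT' u'N).
  have Nmu : N / mu <= r / 4 by rewrite -r1mu ler_pM2r ?invr_gt0.
  have h2 : wt mu t * `|u t| <= r.
    by apply: le_trans (uN t tT) _; apply: le_trans Nr1 _; lra.
  move=> h1; split=> //; rewrite -[io (u t)](subrK x) -addrA.
  apply: le_trans (ler_normD _ _) _.
  move: h1 xx0; move: (`|_ - x0|) (`|_ - x|) => a b h1 h2'.
  by clear Htr H1 Hw; clra.
have x00 : `|x0 - x0| <= r / 8 by rewrite subrr normr0 divr_ge0// ltW.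
have us_lsol T : T <= T0 -> lsol e mu (A x0) T (fun=> 0) (\val x0) us us'.
  by move=> TT; exact: lsol_restrict TT usS.
have us_near : near_on x0 tau1 us r.
  apply: (nearW tau1 x0 us us' (r1 / 4)) => //; first exact: (us_lsol _ t1T0).1.
  by rewrite ler_pdivrMr//; lra.
have rusw : wvan mu tau1 (fun t => rhs x0 (us t)).
  apply: Hw; [by apply: le_trans rrb|exact: wvan_restrict t1T0 usw|].
  by move=> t /us_near[h1 h2]; split; [exact: le_trans h1 rrb|exact: le_trans h2 rrb].
have k0 : 0 < r1 / 4 / M by rewrite divr_gt0.
have [d4 d40 Hrus] := wvan_wbd_small k0 rusw.
have [tau [tau0 taut td4]] : exists t, [/\ 0 < t, t <= tau1 & t < d4].
  by exists (Num.min tau1 (d4 / 2)); split; rewrite ?lt_min ?gt_min ?ge_min ?lexx ?tau10//; lra.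
have rus := Hrus _ taut td4.
have tauT0 : 0 < tau <= T0 by rewrite tau0 (le_trans taut).
have taur t : 0 < t <= tau -> 0 < t <= ra.
  by move=> /andP[-> tt]; rewrite (le_trans tt)// (le_trans taut)// (le_trans tau1r).
have [eps [eps0 eps8 epsM]] : exists eps, [/\ 0 < eps, eps <= r / 8 & (1 + M) * eps <= r1 / 8].
  have M1 : 0 < 1 + M by lra.
  have r180 : 0 < r1 / 8 by rewrite divr_gt0.
  exists (Num.min (r / 8) (r1 / 8 / (1 + M))).
  split; first by rewrite lt_min (divr_gt0 r0)// (divr_gt0 r180 M1).
    by rewrite ge_min lexx.
  by rewrite mulrC -ler_pdivlMr// ge_min lexx orbT.
have us1t := wbd_restrict taut us1; have us1t' := wbd_restrict taut us1'.
exists tau, eps; split=> //.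
  by apply: le_trans rrho; apply: le_trans tau1r.
move=> x xx0.
have xx8 : `|x - x0| <= r / 8 by apply: le_trans xx0 eps8.
pose W (p : (R -> E1) * (R -> E0)) := [/\ evol e mu tau p.1 p.2 (\val x),
  wbd mu tau p.1 r1 & wbd mu tau p.2 r1].
have Wnear p : W p -> near_on x0 tau p.1 r.
  by move=> [pE p1 p2]; apply: (nearW tau x p.1 p.2 r1).
have Wrhs p : W p -> wvan mu tau (fun t => rhs x0 (p.1 t)).
  move=> Wp; have [[pw _ _ _] _ _] := Wp.
  apply: Hw; [by apply: le_trans rrb; apply: le_trans tau1r|exact: pw|].
  by move=> t /(Wnear p Wp)[h1 h2]; split; [exact: le_trans h1 rrb|exact: le_trans h2 rrb].
have us_near' : near_on x0 tau us r.
  by move=> t tt; apply: us_near; case/andP: tt => -> tt; rewrite (le_trans tt).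
have Hrhs (y : cinterp e mu) u u' v v' N :
    evol e mu tau (fun t => u t - v t) (fun t => u' t - v' t) (\val y) ->
    near_on x0 tau u r -> near_on x0 tau v r ->
    wbd mu tau (fun t => u t - v t) N -> wbd mu tau (fun t => u' t - v' t) N ->
    wbd mu tau (fun t => rhs x0 (u t) - rhs x0 (v t))
      (mu / (16 * M) * (N / mu + `|y|)).
  move=> wE ur vr N1 N2 t tt; have [a1 b1] := ur t tt; have [a2 b2] := vr t tt.
  have tt' : t <= tau by case/andP: tt.
  have N0 : 0 <= N by apply: le_trans (N1 t tt); rewrite mulr_ge0// wt_ge0.
  apply: (H1 _ _ _ _ (taur t tt) (le_trans a1 rra) (le_trans a2 rra)
    (le_trans b1 rra) (le_trans b2 rra)).
    exact: (evol_trace mu01 wE tt (wbd_restrict tt' N1) (wbd_restrict tt' N2)).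
  apply: le_trans (N1 t tt) _; apply: (@le_trans _ _ (N / mu)); last by rewrite lerDl.
  by rewrite ler_pdivlMr// ler_piMr// ltW.
(* the difference to us solves a linear problem with small data *)
have inW w w' f N : lsol e mu (A x0) tau f (\val x) w w' ->
    wbd mu tau f N -> M * (N + eps) <= r1 / 2 -> W (w, w').
  move=> wS fN MN.
  have dS := lsolB wS (us_lsol _ (proj2 (andP tauT0))); rewrite -valB in dS.
  have fN' : wbd mu tau (fun t => f t - 0) N.
    by move=> t tt; rewrite subr0; exact: fN.
  have [w1 w2] := HM _ _ _ _ _ _ tauT0 dS fN'.
  have MN' : M * (N + `|x - x0|) <= r1 / 2.
    by apply: le_trans MN; rewrite ler_wpM2l ?(ltW M0)// lerD2l; exact: xx0.
  have r134 : r1 / 2 + r1 / 4 <= r1 by clra.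
  split=> /=; first exact: wS.1.
    move=> t tt; rewrite -[w t](subrK (us t)).
    apply: le_trans (ler_wpM2l (wt_ge0 mu t) (ler_normD _ _)) _; rewrite mulrDr.
    apply: le_trans r134; apply: lerD; last exact: us1t.
    by apply: le_trans MN'; exact: w1.
  move=> t tt; rewrite -[w' t](subrK (us' t)).
  apply: le_trans (ler_wpM2l (wt_ge0 mu t) (ler_normD _ _)) _; rewrite mulrDr.
  apply: le_trans r134; apply: lerD; last exact: us1t'.
  by apply: le_trans MN'; exact: w2.
have Meps : M * eps <= r1 / 8.
  by apply: le_trans epsM; rewrite ler_wpM2r ?(ltW eps0)// lerDr.
have step p : W p -> exists2 q, W q & lsol e mu (A x0) tau (fun t => rhs x0 (p.1 t))
    (\val x) q.1 q.2.
  move=> Wp; have [pE p1 p2] := Wp.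
  have [w [w' wS]] := lsolve tau _ x tauT0 (Wrhs p Wp).
  exists (w, w') => //.
  have dE := evolB pE (us_lsol _ (proj2 (andP tauT0))).1; rewrite -valB in dE.
  have dR := Hrhs _ _ _ _ _ _ dE (Wnear p Wp) us_near' (wbdB p1 us1t) (wbdB p2 us1t').
  apply: (inW w w' _ (mu / (16 * M) * ((r1 + r1 / 4) / mu + eps) + r1 / 4 / M) wS).
    move=> t tt; rewrite -[rhs x0 (p.1 t)](subrK (rhs x0 (us t))).
    apply: le_trans (ler_wpM2l (wt_ge0 mu t) (ler_normD _ _)) _; rewrite mulrDr.
    apply: lerD; last exact: rus.
    apply: le_trans (dR t tt) _; apply: (ler_wpM2l (ltW eta0)).
    by rewrite lerD2l; exact: xx0.
  have -> : M * (mu / (16 * M) * ((r1 + r1 / 4) / mu + eps) + r1 / 4 / M + eps) =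
      (r1 + r1 / 4) / 16 + r1 / 4 + mu * eps / 16 + M * eps.
    by field; rewrite !gt_eqF.
  have mue : mu * eps <= r1 / 8.
    apply: le_trans epsM; rewrite ler_wpM2r ?(ltW eps0)//.
    by apply: (le_trans (ltW mu1)); rewrite lerDl ltW.
  clra.
have contr p q p' q' N : W p -> W q ->
    lsol e mu (A x0) tau (fun t => rhs x0 (p.1 t)) (\val x) p'.1 p'.2 ->
    lsol e mu (A x0) tau (fun t => rhs x0 (q.1 t)) (\val x) q'.1 q'.2 ->
    wbd mu tau (fun t => p.1 t - q.1 t) N ->
    wbd mu tau (fun t => p.2 t - q.2 t) N ->
    wbd mu tau (fun t => p'.1 t - q'.1 t) (N / 16) /\
    wbd mu tau (fun t => p'.2 t - q'.2 t) (N / 16).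
  move=> Wp Wq pS qS N1 N2; have [pE _ _] := Wp; have [qE _ _] := Wq.
  have dE := evolB pE qE; rewrite -valB in dE.
  have dR := Hrhs _ _ _ _ _ _ dE (Wnear p Wp) (Wnear q Wq) N1 N2.
  have dS := lsolB pS qS; rewrite -valB in dS.
  have := HM _ _ _ _ _ _ tauT0 dS dR; rewrite subrr normr0 !addr0.
  by rewrite (_ : M * _ = N / 16)//; field; rewrite !gt_eqF.
have [w0 [w0' w0S]] := lsolve tau (fun=> 0) x tauT0 (wvan_cst mu01 tau 0).
have W0 : W (w0, w0').
  apply: (inW w0 w0' _ 0 w0S) => [t tt|]; first by rewrite normr0 mulr0.
  by rewrite add0r; apply: le_trans Meps _; clra.
have [f [_ Hf]] := @dependent_choice_nat _ (fun _ p => W p)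
  (fun _ p q => lsol e mu (A x0) tau (fun t => rhs x0 (p.1 t)) (\val x) q.1 q.2)
  (w0, w0') W0 (fun _ p => step p).
have Wf n : W (f n) by have [] := Hf n.
have Sf n : lsol e mu (A x0) tau (fun t => rhs x0 ((f n).1 t)) (\val x) (f n.+1).1 (f n.+1).2.
  by have [] := Hf n.
have df n : wbd mu tau (fun t => (f n.+1).1 t - (f n).1 t) (2 * r1 * halfX n) /\
    wbd mu tau (fun t => (f n.+1).2 t - (f n).2 t) (2 * r1 * halfX n).
  elim: n => [|n [IH1 IH2]].
    have [_ a1 a2] := Wf 1%N; have [_ b1 b2] := Wf 0%N.
    rewrite halfX0 mulr1 mulr_natl mulr2n; split; exact: wbdB.
  have [h1 h2] := contr _ _ _ _ _ (Wf n.+1) (Wf n) (Sf n.+1) (Sf n) IH1 IH2.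
  have le16 : 2 * r1 * halfX n / 16 <= 2 * r1 * halfX n.+1.
    have := mulr_gt0 r10 (halfX_gt0 (R := R) n); rewrite halfXS => r1h.
    clra.
  by split; [exact: wbd_le le16 h1 | exact: wbd_le le16 h2].
have [u [u' [uE ulim ulim']]] := evol_lim mu01 (fun n => let: And3 E _ _ := Wf n in E)
  (fun n => (df n).1) (fun n => (df n).2)
  (fun eta eta0 => ex_intro _ 0%N (fun n _ => (ltac:(by rewrite subrr normr0 ltW) :
     `|\val x - \val x| <= eta))).
have u1 : wbd mu tau u r1.
  move=> t tt; apply/ler_addgt0Pr => eta eta1.
  have [n Hn] := halfX_small (2 * (2 * r1)) eta1.
  rewrite -[u t](subrK ((f n).1 t)) [leRHS]addrC.
  apply: le_trans (ler_wpM2l (wt_ge0 mu t) (ler_normD _ _)) _; rewrite mulrDr.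
  apply: lerD; first by apply: le_trans Hn; exact: ulim.
  by have [_ + _] := Wf n; apply.
have u2 : wbd mu tau u' r1.
  move=> t tt; apply/ler_addgt0Pr => eta eta1.
  have [n Hn] := halfX_small (2 * (2 * r1)) eta1.
  rewrite -[u' t](subrK ((f n).2 t)) [leRHS]addrC.
  apply: le_trans (ler_wpM2l (wt_ge0 mu t) (ler_normD _ _)) _; rewrite mulrDr.
  apply: lerD; first by apply: le_trans Hn; exact: ulim'.
  by have [_ _ +] := Wf n; apply.
have Wu : W (u, u') by split.
exists u, u'; split; last first.
  by move=> t /(Wnear _ Wu)[h1 h2]; split; [exact: le_trans h1 rrho|exact: le_trans h2 rrho].
have Vu t : 0 < t <= tau -> V (io (u t)).
  by move=> /(Wnear _ Wu)[h1 _]; apply: Va; exact: le_trans h1 rra.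
have Vx : V x.
  apply: Va; apply: le_trans xx8 _; apply: le_trans rra.
  by rewrite ler_pdivrMr// ler_peMr ?(ltW r0)// ler1n.
apply: (lsol_sol (x0 := x0)) => //; split=> // t tt.
(* the limit solves the equation: the residual is compared with that of the iterates *)
have wt0 : 0 < wt mu t by apply: wt_gt0; case/andP: tt.
apply/eqP; rewrite -subr_eq0 -normr_le0 -(pmulr_rle0 _ wt0).
apply/ler_addgt0Pr => eta eta1; rewrite add0r.
pose K := 2 * (2 * r1); have K0 : 0 <= K by rewrite !mulr_ge0// ltW.
have [n Hn] := halfX_small (K + `|c| * K + mu / (16 * M) * (K / mu)) eta1.
have -> : u' t + A x0 (u t) - rhs x0 (u t) = (u' t - (f n.+1).2 t) +
    A x0 (u t - (f n.+1).1 t) - (rhs x0 (u t) - rhs x0 ((f n).1 t)).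
  by have [_ <-//] := Sf n; rewrite (linearB (A x0)); zmod.
have dE : evol e mu tau (fun t => u t - (f n).1 t) (fun t => u' t - (f n).2 t) (\val (x - x)).
  by rewrite valB; apply: evolB => //; case: (Wf n).
have h1 := Hrhs _ _ _ _ _ _ dE (Wnear _ Wu) (Wnear _ (Wf n)) (ulim n) (ulim' n) t tt.
rewrite subrr normr0 addr0 in h1.
have hn : halfX n.+1 <= halfX n :> R by apply: halfX_mono.
have h2 : wt mu t * `|u' t - (f n.+1).2 t| <= K * halfX n.
  by apply: le_trans (ulim' n.+1 t tt) _; rewrite ler_wpM2l.
have h3 : wt mu t * `|A x0 (u t - (f n.+1).1 t)| <= `|c| * (K * halfX n).
  apply: (@le_trans _ _ (`|c| * (wt mu t * `|u t - (f n.+1).1 t|))).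
    rewrite mulrCA ler_wpM2l ?(ltW wt0)//; apply: le_trans (Ac _) _.
    by rewrite ler_wpM2r// ler_norm.
  rewrite ler_wpM2l//; apply: le_trans (ulim n.+1 t tt) _.
  by rewrite ler_wpM2l.
move: h1 h2 h3.
move: (u' t - _) (A x0 (u t - _)) (rhs x0 (u t) - _) => a1 a2 a3 h1 h2 h3.
have k1 := ler_wpM2l (ltW wt0) (ler_normB (a1 + a2) a3).
have k2 := ler_wpM2l (ltW wt0) (ler_normD a1 a2).
apply: le_trans k1 _; apply: le_trans Hn; rewrite mulrDr 2!mulrDl.
apply: lerD.
  by apply: le_trans k2 _; rewrite mulrDr; apply: lerD => //; rewrite -mulrA.
by apply: le_trans h1 _; rewrite -/K le_eqVlt; apply/orP; left; apply/eqP; ring.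
Qed.

(** * Uniqueness and continuation of solutions *)

Lemma sol_restrict x T T' u u' : T' <= T -> sol x T u u' -> sol x T' u u'.
Proof.
move=> TT [uE Vx Vu uS]; split=> //; first exact: evol_restrict TT uE.
  by move=> t /andP[t0 tT]; apply: Vu; rewrite t0 (le_trans tT).
by move=> t /andP[t0 tT]; apply: uS; rewrite t0 (le_trans tT).
Qed.

Lemma sol_ext x T u u' v v' : (forall t, 0 < t <= T -> u t = v t) ->
  (forall t, 0 < t <= T -> u' t = v' t) -> sol x T u u' -> sol x T v v'.
Proof.
move=> uv uv' [uE Vx Vu uS]; split=> //; first exact: evol_ext uv uv' uE.
  by move=> t tT; rewrite -uv//; exact: Vu.
by move=> t tT; rewrite -uv// -uv'//; exact: uS.
Qed.

Lemma sol_deriv_unique x y T S u u' v v' t s : sol x T u u' -> sol y S v v' ->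
  0 < t <= T -> 0 < s <= S -> u t = v s -> u' t = v' s.
Proof.
move=> [_ _ _ uS] [_ _ _ vS] tT sT uv; have := uS t tT; rewrite uv -(vS s sT).
by move/addIr.
Qed.

Lemma sol_shift x T a u u' : 0 < a < T -> sol x T u u' ->
  sol (io (u a)) (T - a) (fun t => u (t + a)) (fun t => u' (t + a)).
Proof.
move=> aT [uE Vx Vu uS].
have ta t : 0 < t <= T - a -> 0 < t + a <= T by lra.
split.
- by rewrite (val_emb _ _ mu01'); exact: evol_shift uE.
- by apply: Vu; clear uS; lra.
- by move=> t /ta; exact: Vu.
- by move=> t /ta; exact: uS.
Qed.

Lemma sol_glue x T a S u u' w w' : 0 < a < T -> T <= a + S ->
  sol x T u u' -> sol (io (u a)) S w w' ->
  (forall t, 0 < t <= T - a -> u (t + a) = w t) ->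
  exists v v', sol x (a + S) v v' /\ forall t, 0 < t <= T -> v t = u t.
Proof.
move=> aT TS uS wS uw.
pose G t := if t <= a then u t else w (t - a).
pose G' t := if t <= a then u' t else w' (t - a).
have sS := sol_shift aT uS.
have [uE Vx Vu uQ] := uS; have [wE _ Vw wQ] := wS.
have Gu t : 0 < t <= T -> G t = u t.
  move=> tT; rewrite /G; case: (leP t a) => // ta.
  by rewrite -uw ?subrK//; lra.
have Gu' t : 0 < t <= T -> G' t = u' t.
  move=> tT; rewrite /G'; case: (leP t a) => // ta.
  rewrite -[in RHS](subrK a t); symmetry.
  have h1 : 0 < t - a <= T - a by lra.
  have h2 : 0 < t - a <= S by lra.
  exact: (sol_deriv_unique sS wS h1 h2 (uw _ h1)).
have Gw t : a < t <= a + S -> G t = w (t - a).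
  by move=> tS; rewrite /G ifF//; apply/negbTE; rewrite -ltNge; lra.
have Gw' t : a < t <= a + S -> G' t = w' (t - a).
  by move=> tS; rewrite /G' ifF//; apply/negbTE; rewrite -ltNge; lra.
exists G, G'; split=> //; split=> //.
- rewrite (val_emb _ _ mu01') in wE.
  exact: evol_glue aT TS uE wE Gu Gu' Gw Gw'.
- move=> t tS; have [tT|Tt] := leP t T.
    by rewrite Gu; [apply: Vu|]; lra.
  by rewrite Gw; [apply: Vw|]; lra.
- move=> t tS; have [tT|Tt] := leP t T.
    by rewrite Gu' ?Gu; [apply: uQ| |]; lra.
  by rewrite Gw' ?Gw; [apply: wQ| |]; lra.
Qed.

(** The weighted norms of u and u' tend to 0 at time 0, and so does the distance
    from u to x in E_mu by the trace estimate. *)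
Lemma sol_near x T u u' r : 0 < r -> sol x T u u' ->
  exists2 d, 0 < d & forall T', T' <= T -> T' < d -> near_on x T' u r.
Proof.
move=> r0 [uE _ _ _]; have [uw uw' _ _] := uE; have mu0 : 0 < mu by mulra.
have r20 : 0 < r / 2 by rewrite divr_gt0.
have [d1 d10 H1] := evol_trace_near mu01 x r20.
pose r1 := Num.min r (r / 2 * mu); have r10 : 0 < r1 by rewrite lt_min r0 mulr_gt0.
have r1r : r1 <= r by rewrite ge_min lexx.
have r1mu : r1 / mu <= r / 2 by rewrite ler_pdivrMr// ge_min lexx orbT.
have [d2 d20 H2] := wvan_wbd_small r10 uw.
have [d3 d30 H3] := wvan_wbd_small r10 uw'.
exists (Num.min d1 (Num.min d2 d3)) => [|T' TT]; rewrite !lt_min ?d10 ?d20//.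
move=> /and3P[T1 T2 T3] t /andP[t0 tT].
have tT' : 0 < t <= T by rewrite t0 (le_trans tT).
have b2 := H2 _ TT T2; have b3 := H3 _ TT T3.
split; last by apply: le_trans r1r; apply: b2; rewrite t0.
have := H1 _ _ _ _ _ _ uE tT' (le_lt_trans tT T1) (wbd_restrict tT b2) (wbd_restrict tT b3).
rewrite subrr normr0 addr0 => /le_trans; apply.
by rewrite [leRHS]splitr lerD2r.
Qed.

Lemma sol_unique_local x T u u' v v' : 0 < T -> sol x T u u' -> sol x T v v' ->
  exists2 d, 0 < d <= T & forall t, 0 < t <= d -> u t = v t.
Proof.
move=> T0 uS vS; have Vx : V x by case: uS.
have [C [r [C0 r0 H]]] := sol_lipschitz Vx.
have [d1 d10 H1] := sol_near r0 uS; have [d2 d20 H2] := sol_near r0 vS.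
have [d d0 /= /and5P[/ltW dT /ltW dr dd1 dd2 _]] :=
  @pos_lt_all R [:: T; r; d1; d2] ltac:(by rewrite /= T0 r0 d10 d20).
exists d => [|t td]; first by rewrite d0.
have dr' : 0 < d <= r by rewrite d0.
have [H3 _] := H _ _ _ _ _ _ _ dr' (sol_restrict dT uS) (sol_restrict dT vS)
  (H1 _ dT dd1) (H2 _ dT dd2).
have := H3 t td; rewrite subrr normr0 mulr0 pmulr_rle0; last first.
  by apply: wt_gt0; case/andP: td.
by rewrite normr_le0 subr_eq0 => /eqP.
Qed.

(** At the supremum of the times up to which two solutions agree, both have the same
    value, and local uniqueness applies to the problem restarted there. *)
Theorem sol_unique x T u u' v v' : sol x T u u' -> sol x T v v' ->
  forall t, 0 < t <= T -> u t = v t.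
Proof.
move=> uS vS t0 t0T; have T0 : 0 < T by case/andP: t0T => /lt_le_trans; apply.
have [[uc _] _ _ _] : evol e mu T u u' (\val x) by case: uS.
have [[vc _] _ _ _] : evol e mu T v v' (\val x) by case: vS.
pose S := [set t | 0 < t <= T /\ forall s, 0 < s <= t -> u s = v s].
have [d /andP[d0 dT] Hd] := sol_unique_local T0 uS vS.
have Sd : S d by split; rewrite ?d0.
have Sub : has_ubound S by exists T => t [/andP[]].
have Ss : has_sup S by split=> //; exists d.
have dc : d <= sup S by apply: ub_le_sup.
have cT : sup S <= T by apply: ge_sup => [|t [/andP[]]//]; exists d.
have c0 : 0 < sup S by apply: lt_le_trans dc.
have cc : 0 < sup S <= T by rewrite c0.
have below t : 0 < t -> t < sup S -> u t = v t.
  move=> tp tc; have := sup_adherent (_ : 0 < sup S - t) Ss.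
  rewrite subr_gt0 => /(_ tc)[s [sT Hs]]; rewrite subKr => ts.
  by apply: Hs; rewrite tp ltW.
have atc : u (sup S) = v (sup S).
  apply/eqP; rewrite -subr_eq0 -normr_le0; apply/ler_addgt0Pr => eps eps0; rewrite add0r.
  have e20 : 0 < eps / 2 by rewrite divr_gt0.
  have [d1 d10 H1] := uc _ cc _ e20; have [d2 d20 H2] := vc _ cc _ e20.
  have [h h0 /= /and4P[hc hd1 hd2 _]] :=
    @pos_lt_all R [:: sup S; d1; d2] ltac:(by rewrite /= c0 d10 d20).
  have [s [s0 sc sd1 sd2]] : exists s, [/\ 0 < s, s < sup S, sup S - s < d1 & sup S - s < d2].
    by exists (sup S - h); rewrite subKr subr_gt0 gtrDl oppr_lt0.
  have sT : halfopen T s by rewrite /= s0 (le_trans (ltW sc)).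
  have sd1' : `|s - sup S| < d1 by rewrite distrC gtr0_norm ?subr_gt0.
  have sd2' : `|s - sup S| < d2 by rewrite distrC gtr0_norm ?subr_gt0.
  have := H1 s sT sd1'; have := H2 s sT sd2'; rewrite (below s s0 sc).
  have -> : u (sup S) - v (sup S) = (v s - v (sup S)) - (v s - u (sup S)) by zmod.
  move=> h1 h2; apply: le_trans (ler_normB _ _) _; lra.
have upto t : 0 < t <= sup S -> u t = v t.
  by move=> /andP[tp]; rewrite le_eqVlt => /orP[/eqP-> //|]; exact: below.
have [cTlt|Tc] := ltP (sup S) T; last first.
  by apply: upto; case/andP: t0T => -> /le_trans; apply.
have cc' : 0 < sup S < T by rewrite c0.
have uS' := sol_shift cc' uS; have vS' := sol_shift cc' vS.
rewrite atc in uS'; have Tc0 : 0 < T - sup S by rewrite subr_gt0.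
have [h /andP[hp hT] Hh] := sol_unique_local Tc0 uS' vS'.
have : S (sup S + h).
  split=> [|s /andP[s0 sh]]; first by rewrite addr_gt0//= -lerBrDl.
  have [sc|cs] := leP s (sup S); first by apply: upto; rewrite s0.
  have := Hh (s - sup S); rewrite subrK; apply.
  by rewrite subr_gt0 cs lerBlDl.
by move=> /(ub_le_sup Sub); rewrite gerDl leNgt hp.
Qed.

(** Solutions passing close enough to x1, close enough to their final time, can
    be continued by a time that depends on x1 only. *)
Lemma sol_extend_near x1 : V x1 -> exists tau eps, [/\ 0 < tau, 0 < eps &
  forall x T a u u', sol x T u u' -> 0 < a < T -> T <= a + tau ->
    `|io (u a) - x1| <= eps ->
    exists v v', sol x (a + tau) v v' /\ forall t, 0 < t <= T -> v t = u t].
Proof.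
move=> Vx1.
have [tau [eps [tau0 _ eps0 H]]] := sol_exists Vx1 ltr01.
exists tau, eps; split=> // x T a u u' uS aT Ta ux1.
have [w [w' [wS _]]] := H _ ux1.
apply: (sol_glue aT Ta uS wS) => t tT.
have TS : T - a <= tau by rewrite lerBlDl.
exact: (sol_unique (sol_shift aT uS) (sol_restrict TS wS) tT).
Qed.

Lemma sol_extend x T u u' : 0 < T -> sol x T u u' ->
  exists h v v', [/\ 0 < h, sol x (T + h) v v' & forall t, 0 < t <= T -> v t = u t].
Proof.
move=> T0 uS; have [[[uc _] _ _ _] _ Vu _] := uS.
have TT : 0 < T <= T by rewrite T0 lexx.
have [tau [eps [tau0 eps0 H]]] := sol_extend_near (Vu T TT).
have [c c0 Hc] := emb_bounded e mu01'.
have [d d0 Hd] := uc T TT _ (divr_gt0 eps0 c0).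
have [h h0 /= /and4P[hT htau hd _]] :=
  @pos_lt_all R [:: T; tau; d] ltac:(by rewrite /= T0 tau0 d0).
have [a [a0 aT Ta ad]] : exists a, [/\ 0 < a, a < T, T < a + tau & T - a < d].
  exists (T - h); rewrite subKr subr_gt0 gtrDl oppr_lt0; split=> //.
  by rewrite -addrA ltrDl addrC subr_gt0.
have aT' : 0 < a < T by rewrite a0.
have near : `|io (u a) - io (u T)| <= eps.
  rewrite -embB//; apply: le_trans (Hc _) _; rewrite mulrC -ler_pdivlMr//.
  by apply: Hd; rewrite /= ?a0 ?(ltW aT)// distrC gtr0_norm ?subr_gt0.
have [v [v' [vS vu]]] := H _ _ _ _ _ uS aT' (ltW Ta) near.
exists (a + tau - T), v, v'; split=> //; first by rewrite subr_gt0.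
by rewrite addrC subrK.
Qed.

Lemma is_solutionP x T u : 0 < T ->
  is_solution V A F1 F2 x T u <-> exists u', sol x T u u'.
Proof.
move=> T0; split=> [[uE Vu uS ux]|[u' [uE Vx Vu uS]]].
  exists (derive_within `]0, T] (e \o u)); split.
  - exact: EE1_evol.
  - by have := Vu 0; rewrite /trajectory eqxx; apply; rewrite lexx ltW.
  - move=> t /andP[t0 tT]; have := Vu t; rewrite /trajectory (gt_eqF t0) embE; apply.
    by rewrite (ltW t0).
  - by move=> t tT; have := uS t tT; rewrite /= !embE.
have [uE1 ux du] := evol_EE1 mu01 T0 uE.
split=> //.
  move=> t /andP[t0 tT]; rewrite /trajectory; case: eqVneq => // tn.
  by rewrite embE; apply: Vu; rewrite lt_def tn t0.
by move=> t tT; rewrite /= !embE du//; exact: uS.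
Qed.

Lemma local_well_posedness x0 : V x0 -> exists tau eps sigma : R,
  [/\ 0 < tau, 0 < eps, 0 < sigma,
    forall x, closed_ball x0 eps x ->
      exists2 u, is_solution V A F1 F2 x tau u &
        forall v, is_solution V A F1 F2 x tau v ->
          forall t, 0 < t <= tau -> v t = u t &
    forall x1 x2 u1 u2, closed_ball x0 eps x1 -> closed_ball x0 eps x2 ->
      is_solution V A F1 F2 x1 tau u1 -> is_solution V A F1 F2 x2 tau u2 ->
      (EE1_norm e mu tau (fun t => u1 t - u2 t)%R <= (sigma * `|x1 - x2|)%:E)%E].
Proof.
move=> Vx0.
have [C [r [C0 r0 HC]]] := sol_lipschitz Vx0.
have [tau [eps [tau0 taur eps0 H]]] := sol_exists Vx0 r0.
exists tau, eps, (2 * C); split=> // [|x /(closed_ball_normP _ _ eps0) xx0|].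
- by rewrite mulr_gt0.
- have [u [u' [uS _]]] := H x xx0.
  exists u; first by apply/is_solutionP => //; exists u'.
  move=> v /(is_solutionP _ _ tau0)[v' vS] t tt.
  exact: (sol_unique vS uS tt).
move=> x1 x2 u1 u2 /(closed_ball_normP _ _ eps0) xx1 /(closed_ball_normP _ _ eps0) xx2.
move=> /(is_solutionP _ _ tau0)[u1' uS1] /(is_solutionP _ _ tau0)[u2' uS2].
have near x u u' : `|x - x0| <= eps -> sol x tau u u' -> near_on x0 tau u r.
  move=> xx uS; have [v [v' [vS vr]]] := H x xx => t tt.
  by rewrite (sol_unique uS vS tt); exact: vr.
have tr : 0 < tau <= r by rewrite tau0.
have [h1 h2] := HC _ _ _ _ _ _ _ tr uS1 uS2 (near _ _ _ xx1 uS1) (near _ _ _ xx2 uS2).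
have [uE1 _ _ _] := uS1; have [uE2 _ _ _] := uS2.
have dE := evolB uE1 uE2; rewrite -valB in dE.
have [_ _ du] := evol_EE1 mu01 tau0 dE.
apply: ge_ereal_sup => _ [t + <-]; rewrite set_itvoc /= => tt; rewrite lee_fin du//.
by rewrite mulrDr -mulrA mulr_natl mulr2n; apply: lerD; [exact: h2|exact: h1].
Qed.

Lemma sol_trajectory_cont x T u u' t : sol x T u u' -> 0 <= t < T ->
  cont_at [set s | 0 <= s <= T] (trajectory x u) t.
Proof.
move=> uS /andP[t0 tT] eps eps0.
have io_traj s : 0 < s -> trajectory x u s = io (u s).
  by move=> s0; rewrite /trajectory (gt_eqF s0) embE.
have [->|tn] := eqVneq t 0.
  have [d d0 Hd] := sol_near eps0 uS.
  exists (Num.min d T) => [|s /= /andP[s0 sT]].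
    by rewrite lt_min d0 (le_lt_trans t0 tT).
  rewrite subr0 lt_min {2}/trajectory eqxx => /andP[sd _].
  have [->|sn] := eqVneq s 0; first by rewrite /trajectory eqxx subrr normr0 ltW.
  have sp : 0 < s by rewrite lt_def sn.
  rewrite (io_traj s sp); rewrite (gtr0_norm sp) in sd.
  have ss : 0 < s <= s by rewrite sp lexx.
  by have [+ _] := Hd s sT sd s ss.
have tp : 0 < t by rewrite lt_def tn.
have [[[uc _] _ _ _] _ _ _] := uS.
have [c c0 Hc] := emb_bounded e mu01'.
have tT' : 0 < t <= T by rewrite tp ltW.
have [d d0 Hd] := uc t tT' _ (divr_gt0 eps0 c0).
exists (Num.min d t) => [|s /= /andP[s0 sT]]; first by rewrite lt_min d0.
rewrite lt_min => /andP[sd st].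
have sp : 0 < s by move: st; rewrite ltr_distl => /andP[+ _]; rewrite subrr.
rewrite (io_traj s sp) (io_traj t tp) -embB//; apply: le_trans (Hc _) _.
rewrite mulrC -ler_pdivlMr//; apply: Hd => //=.
by rewrite sp.
Qed.

(** All solutions agree where they are defined, so u may take at t the value of any
    solution on [0, t]. The existence times have no maximum, by [sol_extend]. *)
Lemma maximal_solution_exists x0 : V x0 -> exists tplus u,
  [/\ is_maximal_solution V A F1 F2 x0 tplus u,
    forall T v, 0 < T -> is_solution V A F1 F2 x0 T v ->
      (T%:E < tplus)%E /\ forall t, 0 < t <= T -> v t = u t,
    {within [set t : R | 0 <= t /\ (t%:E < tplus)%E], continuous (trajectory x0 u)} &
    {within [set t : R | 0 < t /\ (t%:E < tplus)%E], continuous u}].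
Proof.
move=> Vx0.
pose S := [set T : R | 0 < T /\ exists u u', sol x0 T u u'].
pose tplus := ereal_sup [set T%:E | T in S].
have /choice[U HU] : forall T, exists u, S T -> exists u', sol x0 T u u'.
  move=> T; have [[T0 [u [u' uS]]]|nS] := pselect (S T); last by exists (fun=> 0).
  by exists u => _; exists u'.
pose u t := U t t.
have uE T v v' t : sol x0 T v v' -> 0 < t <= T -> v t = u t.
  move=> vS /andP[t0 tT]; have vS' := sol_restrict tT vS.
  have [u' uS] : exists u', sol x0 t (U t) u' by apply: HU; split=> //; exists v, v'.
  by apply: (sol_unique vS' uS); rewrite t0 lexx.
have below T : (T%:E < tplus)%E -> exists2 T', T < T' & exists v v', sol x0 T' v v'.
  by move=> /ereal_sup_gt[_ [T' [T'0 T'S] <-]]; rewrite lte_fin; exists T'.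
have above T v v' : 0 < T -> sol x0 T v v' -> (T%:E < tplus)%E.
  move=> T0 vS; have [h [w [w' [h0 wS _]]]] := sol_extend T0 vS.
  apply: (@lt_le_trans _ _ (T + h)%:E); first by rewrite lte_fin ltrDl.
  by apply: ereal_sup_ubound; exists (T + h) => //; split; [rewrite addr_gt0|exists w, w'].
have uS T : 0 < T -> (T%:E < tplus)%E -> exists u', sol x0 T u u'.
  move=> T0 /below[T' TT' [v [v' vS]]]; exists v'.
  have vS' := sol_restrict (ltW TT') vS.
  by apply: sol_ext (vS') => // t tT; exact: (uE _ _ _ _ vS' tT).
have tpos : (0%:E < tplus)%E.
  have [tau [eps [tau0 _ eps0 H]]] := sol_exists Vx0 ltr01.
  have [|v [v' [vS _]]] := H x0; first by rewrite subrr normr0 ltW.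
  by apply: lt_trans (above _ _ _ tau0 vS); rewrite lte_fin.
exists tplus, u; split.
- split=> // [T T0 /(uS T T0) ?|T v Tt vS _]; first exact/is_solutionP.
  have T0 : 0 < T by rewrite -lte_fin; exact: lt_le_trans Tt.
  have [v' vS'] := (is_solutionP x0 v T0).1 vS.
  by have := lt_le_trans (above _ _ _ T0 vS') Tt; rewrite ltxx.
- move=> T v T0 /(is_solutionP x0 v T0)[v' vS].
  by split; [exact: above vS | move=> t; exact: uE vS].
- apply/within_contP => t [t0 /below[T' tT' [v [v' vS]]]].
  have T'0 : 0 < T' by apply: le_lt_trans tT'.
  have vt := above _ _ _ T'0 vS; have [u' uS'] := uS T' T'0 vt.
  have tT'' : 0 <= t < T' by rewrite t0.
  apply: (cont_at_local (D := [set s | 0 <= s <= T']) (r := T' - t)) (sol_trajectory_cont uS' tT'').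
  + by rewrite subr_gt0.
  + by rewrite /= t0 ltW.
  + by move=> s [s0 _]; rewrite ltr_distl /= s0 => /andP[_]; rewrite addrC subrK => /ltW.
  + by [].
- apply/within_contP => t [t0 /below[T' tT' [v [v' vS]]]].
  have T'0 : 0 < T' by apply: lt_trans tT'.
  have vt := above _ _ _ T'0 vS; have [u' [[[uc _] _ _ _] _ _ _]] := uS T' T'0 vt.
  have tT'' : 0 < t <= T' by rewrite t0 ltW.
  apply: (cont_at_local (D := halfopen T') (r := T' - t)) (uc t tT'').
  + by rewrite subr_gt0.
  + by [].
  + by move=> s [s0 _]; rewrite ltr_distl /= s0 => /andP[_]; rewrite addrC subrK => /ltW.
  + by [].
Qed.

(** * Global solutions *)

Section blow_up.
Variables (x0 : cinterp e mu) (T : R) (u : R -> E1) (eta : R).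
Hypotheses (Vx0 : V x0) (umax : is_maximal_solution V A F1 F2 x0 T%:E u)
  (eta0 : 0 < eta)
  (udist : forall t, 0 <= t -> (t%:E < T%:E)%E ->
            (eta%:E < edist_inf (boundary V) (trajectory x0 u t))%E).

Let T0 : 0 < T. Proof. by have [+ _ _] := umax; rewrite lte_fin. Qed.

Let uS S : 0 < S -> S < T -> exists u', sol x0 S u u'.
Proof.
move=> S0 ST; apply/(is_solutionP x0 u S0).
by have [_ H _] := umax; apply: H => //; rewrite lte_fin.
Qed.

Let traj t : 0 < t -> trajectory x0 u t = io (u t).
Proof. by move=> t0; rewrite /trajectory (gt_eqF t0) embE. Qed.

(** An accumulation point of the trajectory lies in V, by its distance to the
    boundary, and the solution can be continued past T from there. *)
Lemma no_accumulation (F : set_system R) (x1 : cinterp e mu) : ProperFilter F ->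
  (forall d, 0 < d -> F [set t | 0 < t < T /\ T - t < d]) ->
  (forall eps, 0 < eps -> F [set t | `|trajectory x0 u t - x1| <= eps]) -> False.
Proof.
move=> FF FT Fx.
have near eps d : 0 < eps -> 0 < d ->
    exists t, [/\ 0 < t, t < T, T - t < d & `|io (u t) - x1| <= eps].
  move=> eps0 d0; have [t [[/andP[tp tT] td] tx]] := filter_ex (filterI (FT d d0) (Fx eps eps0)).
  by exists t; split=> //; rewrite -traj.
have Vx1 : V x1.
  apply: contrapT => nV.
  have e20 : 0 < eta / 2 by rewrite divr_gt0.
  have bx1 : boundary V x1.
    split; last by move=> /interior_subset.
    move=> B /nbhs_ballP[r /= r0 Br]; have r20 : 0 < r / 2 by rewrite divr_gt0.
    have [t [tp tT _ tx]] := near _ _ r20 T0; exists (io (u t)); split.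
      have [u' [_ _ Vu _]] := uS tp tT.
      by apply: Vu; rewrite tp lexx.
    apply: Br; rewrite -ball_normE /ball_/= distrC; apply: le_lt_trans tx _.
    by rewrite ltr_pdivrMr// mulr_natr mulr2n ltrDl.
  have [t [tp tT _ tx]] := near _ _ e20 T0.
  have := udist (ltW tp); rewrite lte_fin => /(_ tT); rewrite ltNge => /negP; apply.
  apply: (@le_trans _ _ (edist (trajectory x0 u t, x1))).
    by apply: ereal_inf_lbound; exists x1.
  apply: edist_fin => //=; rewrite -ball_normE /ball_/= traj//.
  apply: le_lt_trans tx _; by rewrite ltr_pdivrMr// mulr_natr mulr2n ltrDl.
have [tau [eps [tau0 eps0 H]]] := sol_extend_near Vx1.
have [a [a0 aT Ta ax]] := near _ _ eps0 tau0.
have Tat : T < a + tau by rewrite -ltrBlDl.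
pose S := (a + T) / 2.
have aS : a < S by rewrite /S ltr_pdivlMr// mulr_natr mulr2n ltrD2l.
have ST : S < T by rewrite /S ltr_pdivrMr// mulr_natr mulr2n ltrD2r.
clearbody S; have S0 : 0 < S by apply: lt_trans aS.
have [u' uSS] := uS S0 ST.
have aS' : 0 < a < S by rewrite a0.
have [v [v' [vS _]]] := H _ _ _ _ _ uSS aS' (ltW (lt_trans ST Tat)) ax.
have [_ _ /(_ (a + tau) v)] := umax; apply.
- by rewrite lee_fin ltW.
- have at0 : 0 < a + tau by rewrite addr_gt0.
  exact: (is_solutionP x0 v at0).2 (ex_intro _ v' vS).
move=> t tp; rewrite lte_fin => tT; have [w' wS] := uS tp tT.
have vS' := sol_restrict (ltW (lt_trans tT Tat)) vS.
by apply: (sol_unique vS' wS); rewrite tp lexx.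
Qed.

Let left_filter : ProperFilter (T^'-).
Proof. exact: at_left_proper_filter. Qed.

Let left_near d : 0 < d -> (T^'-) [set t | 0 < t < T /\ T - t < d].
Proof.
move=> d0; apply/nbhs_ballP; exists (Num.min d T) => /=; first by rewrite lt_min d0.
move=> t; rewrite -ball_normE /ball_/= lt_min => /andP[td tT] tlt.
rewrite gtr0_norm ?subr_gt0// in td tT.
by split=> //; rewrite tlt andbT -(ltrD2l T) addr0 -ltrBlDr.
Qed.

(** A uniformly continuous trajectory has a limit at T. *)
Lemma unif_continuous_blow_up :
  unif_continuous (trajectory x0 u :
    subspace [set t : R | 0 <= t /\ (t%:E < T%:E)%E] -> cinterp e mu) -> False.
Proof.
move=> uc; have [|x1 Hx1] := @cinterp_complete _ _ _ e mu R (T^'-) (trajectory x0 u) _.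
  move=> eps eps0.
  have := uc [set xy | ball xy.1 eps xy.2] (entourage_ball _ (PosNum eps0)).
  move=> [B entB HB].
  have [r r0 Br] : exists2 r : R, 0 < r & forall s t : R, `|s - t| < r -> B (s, t).
    have : entourage_ (@ball R R) B by rewrite entourage_ballE.
    move=> [r r0 Hr].
    by exists r => // s t st; apply: Hr; rewrite /= -ball_normE.
  exists [set t | 0 < t < T /\ T - t < r]; split; first exact: left_near.
  move=> s t [/andP[sp sT] sr] [/andP[tp tT] tr].
  have : ball (trajectory x0 u s) eps (trajectory x0 u t).
    apply: (HB (s, t)); right; rewrite /= !lte_fin (ltW sp) (ltW tp); do 2 split=> //.
    apply: Br; rewrite ltr_norml; apply/andP; split; clra.
  by rewrite -ball_normE /ball_/= => /ltW.
exact: (no_accumulation left_filter left_near Hx1).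
Qed.

Lemma compact_blow_up (delta tau : R) : compact_embedding e -> mu < delta <= 1 ->
  tau < T -> bounded_in e delta [set t : R | tau <= t /\ (t%:E < T%:E)%E] u -> False.
Proof.
move=> cpt /andP[mud d1] tauT ub.
have mu0 : 0 < mu by case/andP: mu01.
have [theta [K [muth th1 HK]]] : exists theta K, [/\ mu < theta, theta <= 1 &
    forall t, tau <= t /\ (t%:E < T%:E)%E -> `|emb e theta (u t)| <= K].
  move: ub; rewrite /bounded_in; case: eqVneq => [_|_] /pinfty_ex_gt0[M M0 HM]; last first.
    by exists delta, M.
  have th01 : 0 <= (1 : R) <= 1 by rewrite ler01 lexx.
  have [c c0 Hc] := emb_bounded e th01.
  exists 1, (c * M); split=> [|//|t tt]; first by mulra.
  apply: le_trans (Hc _) _; rewrite ler_wpM2l ?(ltW c0)//; exact: HM.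
have [U [UU sU]] := ultraFilterLemma left_filter.
have UD : U [set t | 0 < t /\ (tau <= t /\ (t%:E < T%:E)%E)].
  apply: sU; have Tt : 0 < T - tau by rewrite subr_gt0.
  apply: filterS (left_near Tt) => t [/andP[tp tT] td]; split=> //.
  rewrite lte_fin; split=> //.
  by move: td; rewrite ltrBlDr -ltrBlDl opprB addrC subrK => /ltW.
have [|x1 Hx1] := @cinterp_complete _ _ _ e mu R U (trajectory x0 u) _.
  move=> eps eps0.
  have [A' [UA' HA']] := compact_cauchy_interp cpt UU UD mu0 muth th1
    (fun t tt => HK t tt.2) eps0.
  exists (A' `&` [set t | 0 < t /\ (tau <= t /\ (t%:E < T%:E)%E)]).
  split; first exact: filterI.
  by move=> s t [As [sp _]] [At [tp _]]; rewrite !traj//; exact: HA'.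
by apply: (no_accumulation _ _ Hx1) => d d0; apply: sU; exact: left_near.
Qed.

End blow_up.

End nonlinearity.

Theorem theorem2p2 (R : realType) (E0 E1 : completeNormedModType R)
  (e : dense_embedding E0 E1) (mu : R) (mu01 : 0 < mu < 1)
  (V : set (cinterp e mu)) (Vopen : open V)
  (A : cinterp e mu -> {linear E1 -> E0}) (F1 : cinterp e mu -> E0)
  (A_maxreg : forall x, V x -> maximal_regularity e mu (A x))
  (AF1_lipschitz : forall x0, V x0 -> exists r L : R, 0 < r /\
    forall x y, V x -> V y -> ball x0 r x -> ball x0 r y ->
      (opnorm (fun b => A x b - A y b)%R <= (L * `|x - y|)%:E)%E /\
      `|F1 x - F1 y| <= L * `|x - y|)
  (beta : R) (mu_beta : mu < beta < 1)
  (F2 : cinterp e beta -> E0)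
  (m : nat) (betas rhos : 'I_m -> R)
  (betas_itv : forall j, mu <= betas j <= beta)
  (rhos_ge0 : forall j, 0 <= rhos j)
  (subcritical : forall j,
    (rhos j * (beta - mu) + (betas j - mu)) / (1 - mu) <= 1)
  (F2_growth : forall x0, V x0 -> forall r : R, 0 < r ->
    exists2 C : R, 0 < C & forall x1 x2 : cinterp e beta,
      let y1 := to_cinterp e mu (\val x1) in
      let y2 := to_cinterp e mu (\val x2) in
      V y1 -> V y2 -> closed_ball x0 r y1 -> closed_ball x0 r y2 ->
      `|F2 x1 - F2 x2| <=
        C * \sum_(j < m) (1 + `|x1| `^ rhos j + `|x2| `^ rhos j) *
              `|to_cinterp e (betas j) (\val x1 - \val x2)|) :
  [/\ (forall x0, V x0 -> exists tau eps sigma : R,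
        [/\ 0 < tau, 0 < eps, 0 < sigma,
          forall x, closed_ball x0 eps x ->
            exists2 u, is_solution V A F1 F2 x tau u &
              forall v, is_solution V A F1 F2 x tau v ->
                forall t, 0 < t <= tau -> v t = u t &
          forall x1 x2 u1 u2,
            closed_ball x0 eps x1 -> closed_ball x0 eps x2 ->
            is_solution V A F1 F2 x1 tau u1 ->
            is_solution V A F1 F2 x2 tau u2 ->
            (EE1_norm e mu tau (fun t => u1 t - u2 t)%R
               <= (sigma * `|x1 - x2|)%:E)%E]),
      (forall x0, V x0 -> exists tplus u,
        [/\ is_maximal_solution V A F1 F2 x0 tplus u,
          forall T v, 0 < T -> is_solution V A F1 F2 x0 T v ->
            (T%:E < tplus)%E /\ forall t, 0 < t <= T -> v t = u t,
          {within [set t : R | 0 <= t /\ (t%:E < tplus)%E],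
            continuous (trajectory x0 u)} &
          {within [set t : R | 0 < t /\ (t%:E < tplus)%E], continuous u}]) &
      (forall x0 tplus u, V x0 -> is_maximal_solution V A F1 F2 x0 tplus u ->
        (exists2 eta : R, 0 < eta &
          forall t, 0 <= t -> (t%:E < tplus)%E ->
            (eta%:E < edist_inf (boundary V) (trajectory x0 u t))%E) ->
        (unif_continuous (trajectory x0 u :
           subspace [set t : R | 0 <= t /\ (t%:E < tplus)%E] -> cinterp e mu) ->
         tplus = +oo%E) /\
        (compact_embedding e ->
         (exists delta tau : R, [/\ mu < delta <= 1,
            0 < tau, (tau%:E < tplus)%E &
            bounded_in e delta [set t : R | tau <= t /\ (t%:E < tplus)%E] u]) ->
         tplus = +oo%E))].
Proof.
split.
- exact: (local_well_posedness mu01 Vopen A_maxreg AF1_lipschitz mu_beta betas_itv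
    rhos_ge0 subcritical F2_growth).
- exact: (maximal_solution_exists mu01 Vopen A_maxreg AF1_lipschitz mu_beta betas_itv
    rhos_ge0 subcritical F2_growth).
move=> x0 tplus u _ umax [eta eta0 udist].
have [tpos _ _] := umax.
case: tplus tpos umax udist => [T _ umax udist|//|//].
split=> [uc|cpt [delta [tau [delta1 _ tauT ub]]]]; exfalso.
- exact: (unif_continuous_blow_up mu01 Vopen A_maxreg AF1_lipschitz mu_beta betas_itv
    rhos_ge0 subcritical F2_growth umax eta0 udist uc).
- exact: (compact_blow_up mu01 Vopen A_maxreg AF1_lipschitz mu_beta betas_itv
    rhos_ge0 subcritical F2_growth umax eta0 udist cpt delta1 tauT ub).
Qed.
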